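(* Let $D$, $U=\prod_{l\ne p}U_l\times U_0(p^m)$, $E$ be as in the context, and let $\psi_m:\mathbb{Z}_p^\times\to E^\times$ be a finite character of conductor $p^m$ with the same $m$ that defines the level structure $U$. Let $t=\dim S_2^D(U;\psi_m)$. Then for every $k\in\mathbb{Z}_p$ the Newton polygon for the slopes of $U_p$ acting on the space $S^{D,\dagger}(U;\,x\langle x\rangle^k\psi_m)$ of overconvergent automorphic forms lies above the polygon with vertices $$(0,0),\ (t,0),\ (2t,t),\ \dots,\ \bigl(nt,\tfrac{n(n-1)}2t\bigr),\ \dots$$
   Context: $p$ is a prime, $v$ the $p$-adic valuation with $v(p)=1$. $D$ is a definite quaternion algebra over $\mathbb{Q}$ with a fixed isomorphism $D\otimes\mathbb{Q}_p\cong M_2(\mathbb{Q}_p)$; $D_f=D\otimes_{\mathbb Q}\mathbb{A}_f$. $\mathcal S$ is a finite set of primes containing $p$ and all primes where $D$ ramifies. For $l\ne p$, $U_l\subset (D\otimes\mathbb{Q}_l)^\times$ is open compact, equal to $GL_2(\mathbb{Z}_l)$ under a fixed isomorphism $D\otimes \mathbb{Q}_l\cong M_2(\mathbb{Q}_l)$ for $l\notin\mathcal S$. $U_0(p^m)=\begin{pmatrix}\mathbb{Z}_p^\times&\mathbb{Z}_p\\ p^m\mathbb{Z}_p&\mathbb{Z}_p^\times\end{pmatrix}$, $U=\prod_{l\neq p}U_l\times U_0(p^m)$, and $U$ is assumed so small that $x^{-1}D^\times x\cap U=\{1\}$ for all $x\in D_f^\times$. $E$ is a finite extension of $\mathbb{Q}_p$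 containing the values of $\psi_m$. Conductor: $\psi_m$ factors through $(\mathbb{Z}/p^m)^\times$ but not through $(\mathbb{Z}/p^{m'})^\times$ for a smaller positive $m'$ ($m'\ge 2$ if $p=2$); the trivial character has conductor $p$ ($m=1$), or $4$ ($m=2$) if $p=2$. $\omega$ is the Teichmüller character of $\mathbb{Z}_p^\times$ (for $p=2$: $\omega(a)=\pm1\equiv a\bmod 4$), $\langle a\rangle=a\omega(a)^{-1}$. Overconvergent forms: let $\mathcal A=E\langle z\rangle$ be the Tate algebra and $\kappa(a)=a\langle a\rangle^k\psi_m(a)$. For $\gamma=\begin{pmatrix}a&b\\c&d\end{pmatrix}\in M_2(\mathbb{Z}_p)$ with $p^m\mid c$, $p\nmid d$, $\det\gamma\ne0$ and $h\in\mathcal A$ put $$(h\|_\kappa\gamma)(z)=\frac{\kappa(cz+d)}{cz+d}\,h\Bigl(\frac{az+b}{cz+d}\Bigr)=\psi_m(d)\langle d\rangle^k\bigl(1+\tfrac cd z\bigr)^{k}h\Bigl(\frac{az+b}{cz+d}\Bigr).$$ $S^{D,\dagger}(U;\kappa)$ is the Banach space of functions $\varphi:D_f^\times\to\mathcal A$ with $\varphi(\delta gu)=\varphi(g)\|_\kappa u_p$ for $\delta\in D^\times,g\in D_f^\times,u\in U$. $U_p(\varphi)(g)=\sum_{j=0}^{p-1}\varphi(gv_j^{-1})\|_\kappa v_j$, $v_j=\begin{pmatrix}p&0\\ j p^m&1\end{pmatrix}$ placed at $p$; this is a nuclear operator. The Newton polygon for its slopes is the lower convex hull of the points $(n,v(c_n))$,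 where $\det(1-XU_p)=\sum_n c_nX^n$ is the Fredholm characteristic series. $S_2^D(U;\psi_m)$ is the space of functions $\varphi:D_f^\times\to E$ with $\varphi(\delta gu)=\psi_m(d)\varphi(g)$ for $\delta\in D^\times$, $g\in D_f^\times$, $u\in U$ with $u_p=\begin{pmatrix}a&b\\c&d\end{pmatrix}$. *)

(* Defs.v *)
From HB Require Import structures.
From mathcomp Require Import all_boot all_order all_algebra all_field.
From mathcomp Require Import boolp classical_sets functions cardinality.
From mathcomp Require Import reals ereal topology.

Set Implicit Arguments.
Unset Strict Implicit.
Unset Printing Implicit Defensive.

Import Order.TTheory GRing.Theory Num.Theory.
Local Open Scope classical_set_scope.
Local Open Scope ring_scope.

(** * Valued fields and p-adic numbers *)

Section Valuations.
Variables (R : realType) (K : fieldType).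
Implicit Types (v : K -> \bar R) (u : nat -> K).

Definition is_valuation v :=
  [/\ forall x, (v x == +oo%E) = (x == 0),
      forall x, v x != -oo%E,
      forall x y, v (x * y) = (v x + v y)%E
    & forall x y, (Order.min (v x) (v y) <= v (x + y)%R)%E].

Definition vcvg v u (l : K) :=
  forall r : R, exists N, forall n, (N <= n)%N -> (r%:E <= v (u n - l)%R)%E.

Definition vcauchy v u :=
  forall r : R, exists N, forall i j, (N <= i)%N -> (N <= j)%N ->
    (r%:E <= v (u i - u j)%R)%E.

Definition vlim v u : K := xget 0 [set l | vcvg v u l].

Definition vsum v u : K := vlim v (fun n => \sum_(i < n) u i).

End Valuations.

(** The completion of [rat] for the [l]-adic valuation; it is unique up to
    unique isomorphism of valued fields. *)
Record padicField (R : realType) (l : nat) := PadicField {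
  padic_sort :> fieldType;
  padic_rat : {rmorphism rat -> padic_sort};
  padic_val : padic_sort -> \bar R;
  padic_valuation : is_valuation padic_val;
  padic_val_nat : forall n : nat, (0 < n)%N ->
    padic_val n%:R = ((logn l n)%:R)%:E;
  padic_dense : forall (x : padic_sort) (r : R),
    exists q : rat, (r%:E <= padic_val (x - padic_rat q)%R)%E;
  padic_complete : forall u : nat -> padic_sort,
    vcauchy padic_val u -> exists x, vcvg padic_val u x }.

Arguments padic_rat {R l} _.
Arguments padic_val {R l K} _ : rename.

Notation primeT := {l : nat | prime l}.

(** * Finite adeles *)

Section Adeles.
Variables (R : realType) (Q_ : forall l : primeT, padicField R (val l)).

Lemma padic_val1 (l : primeT) : padic_val (1 : Q_ l) = 0%E.
Proof. by have := padic_val_nat (Q_ l) (n := 1) isT; rewrite logn1. Qed.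

Lemma padic_valM (l : primeT) (x y : Q_ l) :
  padic_val (x * y) = (padic_val x + padic_val y)%E.
Proof. by case: (padic_valuation (Q_ l)). Qed.

Lemma padic_val0 (l : primeT) : padic_val (0 : Q_ l) = +oo%E.
Proof. by apply/eqP; case: (padic_valuation (Q_ l)) => ->; rewrite eqxx. Qed.

Lemma padic_intM (l : primeT) (x y : Q_ l) : (0 <= padic_val x)%E ->
  (0 <= padic_val y)%E -> (0 <= padic_val (x * y)%R)%E.
Proof. by move=> x0 y0; rewrite padic_valM adde_ge0. Qed.

Lemma padic_intD (l : primeT) (x y : Q_ l) : (0 <= padic_val x)%E ->
  (0 <= padic_val y)%E -> (0 <= padic_val (x + y)%R)%E.
Proof.
move=> x0 y0; case: (padic_valuation (Q_ l)) => _ _ _ /(_ x y).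
by apply: le_trans; rewrite le_min x0 y0.
Qed.

Lemma padic_valN1 (l : primeT) : padic_val (-1 : Q_ l) = 0%E.
Proof.
have := padic_valM (-1) (-1 : Q_ l); rewrite mulrNN mulr1 padic_val1.
case: (padic_val (-1)) => [r||] //= /eqP.
by rewrite -EFinD eqe -mulr2n eq_sym mulrn_eq0 /= => /eqP->.
Qed.

Lemma padic_intN (l : primeT) (x : Q_ l) : (0 <= padic_val x)%E ->
  (0 <= padic_val (- x)%R)%E.
Proof. by rewrite -mulN1r padic_valM padic_valN1 add0e. Qed.

Lemma padic_int_nat (l : primeT) n : (0 <= padic_val (n%:R : Q_ l))%E.
Proof.
case: n => [|n]; first by rewrite padic_val0.
by rewrite padic_val_nat // lee_fin ler0n.
Qed.

Lemma padic_int_rat (q : rat) :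
  finite_set [set l | ~ (0 <= padic_val (padic_rat (Q_ l) q))%E].
Proof.
pose s : set primeT := val @^-1` [set` iota 0 (`|denq q|%N).+1].
have fs : finite_set s.
  apply: finite_preimage; last exact: finite_seq.
  by move=> x y _ _; apply: val_inj.
apply: sub_finite_set fs => l /= nint.
change (is_true (val l \in iota 0 (`|denq q|%N).+1)); apply: contraT.
rewrite mem_iota /= add0n ltnS -ltnNge => ltl; case: nint.
set K := Q_ l; set d := `|denq q|%N in ltl.
have d0 : (0 < d)%N by rewrite absz_gt0 denq_neq0.
have vd : padic_val (d%:R : K) = 0%E.
  rewrite padic_val_nat // lognE; case: ifP => // /and3P[_ _ /dvdn_leq].
  by move=> /(_ d0); rewrite leqNgt ltl.
have : (0 <= padic_val ((numq q)%:~R : K))%E.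
  case: (numq q) => n; first exact: padic_int_nat.
  by rewrite NegzE mulrNz; apply: padic_intN; exact: padic_int_nat.
have -> : ((numq q)%:~R : K) = padic_rat K q * d%:R.
  rewrite -(rmorph_int (padic_rat K)) -(rmorph_nat (padic_rat K)) -rmorphM.
  by rewrite -[d%:R]/(d%:Z%:~R) absz_denq numqE.
by rewrite padic_valM vd adde0.
Qed.

Record adele := Adele {
  adele_at :> forall l : primeT, Q_ l;
  adele_int : finite_set [set l | ~ (0 <= padic_val (adele_at l))%E] }.

Lemma adele_ext (x y : adele) : (forall l, x l = y l) -> x = y.
Proof.
case: x y => [x ix] [y iy] /= xy.
have {}xy : x = y by apply: functional_extensionality_dep.
by move: ix; rewrite xy => ix; congr Adele; exact: Prop_irrelevance.
Qed.

HB.instance Definition _ := gen_eqMixin adele.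
HB.instance Definition _ := gen_choiceMixin adele.

Definition adele_rat q := Adele (padic_int_rat q).

Fact adele_opp_int (x : adele) :
  finite_set [set l | ~ (0 <= padic_val (- x l)%R)%E].
Proof.
by apply: sub_finite_set (adele_int x) => l /= nx x0; apply/nx/padic_intN.
Qed.

Fact adele_add_int (x y : adele) :
  finite_set [set l | ~ (0 <= padic_val (x l + y l)%R)%E].
Proof.
apply: (sub_finite_set (B := [set l | ~ (0 <= padic_val (x l))%E] `|`
   [set l | ~ (0 <= padic_val (y l))%E])).
  by move=> l /= nxy; apply/not_andP => -[x0 y0]; apply/nxy/padic_intD.
by rewrite finite_setU; split; exact: adele_int.
Qed.

Fact adele_mul_int (x y : adele) :
  finite_set [set l | ~ (0 <= padic_val (x l * y l)%R)%E].
Proof.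
apply: (sub_finite_set (B := [set l | ~ (0 <= padic_val (x l))%E] `|`
   [set l | ~ (0 <= padic_val (y l))%E])).
  by move=> l /= nxy; apply/not_andP => -[x0 y0]; apply/nxy/padic_intM.
by rewrite finite_setU; split; exact: adele_int.
Qed.

Definition adele_opp x := Adele (adele_opp_int x).
Definition adele_add x y := Adele (adele_add_int x y).
Definition adele_mul x y := Adele (adele_mul_int x y).

Fact adele_addA : associative adele_add.
Proof. by move=> x y z; apply: adele_ext => l /=; rewrite addrA. Qed.
Fact adele_addC : commutative adele_add.
Proof. by move=> x y; apply: adele_ext => l /=; rewrite addrC. Qed.
Fact adele_add0 : left_id (adele_rat 0) adele_add.
Proof. by move=> x; apply: adele_ext => l /=; rewrite rmorph0 add0r. Qed.
Fact adele_addN : left_inverse (adele_rat 0) adele_opp adele_add.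
Proof. by move=> x; apply: adele_ext => l /=; rewrite rmorph0 addNr. Qed.

HB.instance Definition _ := GRing.isZmodule.Build adele
  adele_addA adele_addC adele_add0 adele_addN.

Fact adele_mulA : associative adele_mul.
Proof. by move=> x y z; apply: adele_ext => l /=; rewrite mulrA. Qed.
Fact adele_mulC : commutative adele_mul.
Proof. by move=> x y; apply: adele_ext => l /=; rewrite mulrC. Qed.
Fact adele_mul1 : left_id (adele_rat 1) adele_mul.
Proof. by move=> x; apply: adele_ext => l /=; rewrite rmorph1 mul1r. Qed.
Fact adele_mulDl : left_distributive adele_mul +%R.
Proof. by move=> x y z; apply: adele_ext => l /=; rewrite mulrDl. Qed.

HB.instance Definition _ := GRing.Zmodule_isComPzRing.Build adele
  adele_mulA adele_mulC adele_mul1 adele_mulDl.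

Fact adele_rat_zmod : zmod_morphism adele_rat.
Proof. by move=> x y; apply: adele_ext => l /=; rewrite rmorphB. Qed.
Fact adele_rat_monoid : monoid_morphism adele_rat.
Proof. by split=> // x y; apply: adele_ext => l /=; rewrite rmorphM. Qed.

HB.instance Definition _ := GRing.isZmodMorphism.Build rat adele adele_rat
  adele_rat_zmod.
HB.instance Definition _ := GRing.isMonoidMorphism.Build rat adele adele_rat
  adele_rat_monoid.

End Adeles.

(** * Extension of scalars of a finite-dimensional algebra over [rat] *)

(** [D ⊗ K] along [f], in coordinates with respect to the basis
    [vbasis {:D}]; the multiplication below depends on [f]. *)
Definition ext (D : falgType rat) (K : comPzRingType)
  (f : {rmorphism rat -> K}) : Type := 'rV[K]_(\dim {:D}).

Section ScalarExtension.
Variables (D : falgType rat) (K : comPzRingType) (f : {rmorphism rat -> K}).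

Local Notation ext := (ext D f).

HB.instance Definition _ := GRing.Lmodule.on ext.

Local Notation e i := ((vbasis {:D})`_i).

Definition ext_in (d : D) : ext :=
  \row_k f (coord (vbasis {:D}) k d).

Definition ext_mul (x y : ext) : ext :=
  \sum_i \sum_j (x 0 i * y 0 j) *: ext_in (e (val i) * e (val j)).

Fact ext_in_zmod : zmod_morphism ext_in.
Proof. by move=> x y; apply/rowP => k; rewrite !mxE !raddfB. Qed.

HB.instance Definition _ := GRing.isZmodMorphism.Build D ext ext_in
  ext_in_zmod.

Lemma ext_inZ (a : rat) d : ext_in (a *: d) = f a *: ext_in d.
Proof. by apply/rowP => k; rewrite !mxE linearZ /= rmorphM. Qed.

Lemma ext_in_sum (x : D) :
  x = \sum_i coord (vbasis {:D}) i x *: e (val i).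
Proof. by apply: coord_vbasis; rewrite memvf. Qed.

Fact ext_mulDl : left_distributive ext_mul +%R.
Proof.
move=> x y z; rewrite /ext_mul -big_split; apply: eq_bigr => i _ /=.
rewrite -big_split; apply: eq_bigr => j _ /=.
by rewrite !mxE mulrDl scalerDl.
Qed.

Fact ext_mulDr : right_distributive ext_mul +%R.
Proof.
move=> x y z; rewrite /ext_mul -big_split; apply: eq_bigr => i _ /=.
rewrite -big_split; apply: eq_bigr => j _ /=.
by rewrite !mxE mulrDr scalerDl.
Qed.

Lemma ext_mulZl a x y : ext_mul (a *: x) y = a *: ext_mul x y.
Proof.
rewrite /ext_mul scaler_sumr; apply: eq_bigr => i _.
rewrite scaler_sumr; apply: eq_bigr => j _.
by rewrite !mxE scalerA mulrA.
Qed.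

Lemma ext_mulZr a x y : ext_mul x (a *: y) = a *: ext_mul x y.
Proof.
rewrite /ext_mul scaler_sumr; apply: eq_bigr => i _.
rewrite scaler_sumr; apply: eq_bigr => j _.
by rewrite !mxE scalerA mulrCA.
Qed.

Lemma ext_mul0l y : ext_mul 0 y = 0.
Proof. by have := ext_mulZl 0 0 y; rewrite !scale0r. Qed.

Lemma ext_mul0r x : ext_mul x 0 = 0.
Proof. by have := ext_mulZr 0 x 0; rewrite !scale0r. Qed.

Lemma ext_mul_suml (I : finType) (F : I -> ext) y :
  ext_mul (\sum_i F i) y = \sum_i ext_mul (F i) y.
Proof.
by apply: (big_morph (ext_mul^~ y)) => [u w|]; rewrite ?ext_mul0l ?ext_mulDl.
Qed.

Lemma ext_mul_sumr (I : finType) (F : I -> ext) x :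
  ext_mul x (\sum_i F i) = \sum_i ext_mul x (F i).
Proof.
by apply: (big_morph (ext_mul x)) => [u w|]; rewrite ?ext_mul0r ?ext_mulDr.
Qed.

Lemma ext_in_mul c d : ext_in (c * d) = ext_mul (ext_in c) (ext_in d).
Proof.
rewrite {1}[c]ext_in_sum {1}[d]ext_in_sum mulr_suml raddf_sum.
apply: eq_bigr => i _; rewrite mulr_sumr raddf_sum; apply: eq_bigr => j _ /=.
by rewrite -scalerAl -scalerAr !ext_inZ scalerA !mxE.
Qed.

Lemma ext_sum (x : ext) : x = \sum_i x 0 i *: ext_in (e (val i)).
Proof.
apply/rowP => k; rewrite summxE (bigD1 k) //= big1 ?addr0.
  by rewrite !mxE coord_free ?(basis_free (vbasisP _)) // eqxx rmorph1 mulr1.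
move=> i /negPf ik; rewrite !mxE coord_free ?(basis_free (vbasisP _)) //.
by rewrite [_ == _]ik rmorph0 mulr0.
Qed.

Fact ext_mulA : associative ext_mul.
Proof.
have sumE (x : ext) : exists a : 'I_(\dim {:D}) -> K,
  x = \sum_i a i *: ext_in (e (val i)).
  by exists (x 0); exact: ext_sum.
move: ext_mul ext_mulZl ext_mulZr ext_mul_suml ext_mul_sumr ext_in_mul.
move=> mul mulZl mulZr suml sumr inM x y z.
have [a ->] := sumE x; rewrite !suml; apply: eq_bigr => i _.
have [b ->] := sumE y; rewrite !mulZl sumr !suml sumr; congr (_ *: _).
apply: eq_bigr => j _; rewrite !(mulZl, mulZr); congr (_ *: _).
have [c ->] := sumE z; rewrite !sumr; apply: eq_bigr => k _.
by rewrite !mulZr -!inM mulrA.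
Qed.

Fact ext_mul1 : left_id (ext_in 1) ext_mul.
Proof.
move=> x; rewrite [x in LHS]ext_sum ext_mul_sumr [RHS]ext_sum.
by apply: eq_bigr => i _; rewrite ext_mulZr -ext_in_mul mul1r.
Qed.

Fact ext_mulr1 : right_id (ext_in 1) ext_mul.
Proof.
move=> x; rewrite [x in LHS]ext_sum ext_mul_suml [RHS]ext_sum.
by apply: eq_bigr => i _; rewrite ext_mulZl -ext_in_mul mulr1.
Qed.

HB.instance Definition _ := GRing.Zmodule_isPzRing.Build ext
  ext_mulA ext_mul1 ext_mulr1 ext_mulDl ext_mulDr.

Fact ext_in_monoid : monoid_morphism ext_in.
Proof. by split=> // x y; rewrite ext_in_mul. Qed.

HB.instance Definition _ := GRing.isMonoidMorphism.Build D ext ext_in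
  ext_in_monoid.

End ScalarExtension.

(** * Unit groups *)

Section UnitGroup.
Variable A : pzRingType.

Record unitg := Unitg {
  uval :> A;
  uinv : A;
  uvalK : uval * uinv = 1;
  uinvK : uinv * uval = 1 }.

Lemma uval_inj : injective uval.
Proof.
case=> x x' xK x'K [y y' yK y'K] /= xy; subst y.
have e : x' = y' by rewrite -[x']mulr1 -yK mulrA x'K mul1r.
by subst y'; congr Unitg; exact: Prop_irrelevance.
Qed.

HB.instance Definition _ := gen_eqMixin unitg.
HB.instance Definition _ := gen_choiceMixin unitg.

Definition unitg1 : unitg := Unitg (mulr1 1) (mulr1 1).

Definition unitgV (x : unitg) : unitg := Unitg (uinvK x) (uvalK x).

Fact unitg_mulK (x y : unitg) : (uval x * uval y) * (uinv y * uinv x) = 1.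
Proof. by rewrite mulrA -(mulrA (uval x)) uvalK mulr1 uvalK. Qed.

Fact unitg_mulVK (x y : unitg) : (uinv y * uinv x) * (uval x * uval y) = 1.
Proof. by rewrite mulrA -(mulrA (uinv y)) uinvK mulr1 uinvK. Qed.

Definition unitgM (x y : unitg) : unitg :=
  Unitg (unitg_mulK x y) (unitg_mulVK x y).

Fact unitgA : associative unitgM.
Proof. by move=> x y z; apply: uval_inj; rewrite /= mulrA. Qed.
Fact unitg_mul1 : left_id unitg1 unitgM.
Proof. by move=> x; apply: uval_inj; rewrite /= mul1r. Qed.
Fact unitg_mulr1 : right_id unitg1 unitgM.
Proof. by move=> x; apply: uval_inj; rewrite /= mulr1. Qed.
Fact unitg_mulV : left_inverse unitg1 unitgV unitgM.
Proof. by move=> x; apply: uval_inj; rewrite /= uinvK. Qed.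
Fact unitg_mulrV : right_inverse unitg1 unitgV unitgM.
Proof. by move=> x; apply: uval_inj; rewrite /= uvalK. Qed.

HB.instance Definition _ := isGroup.Build unitg
  unitgA unitg_mul1 unitg_mulr1 unitg_mulV unitg_mulrV.

End UnitGroup.

Section UnitMap.
Variables (A B : pzRingType) (f : {rmorphism A -> B}).

Fact unit_map_mulK (x : unitg A) : f (uval x) * f (uinv x) = 1.
Proof. by rewrite -rmorphM uvalK rmorph1. Qed.
Fact unit_map_mulVK (x : unitg A) : f (uinv x) * f (uval x) = 1.
Proof. by rewrite -rmorphM uinvK rmorph1. Qed.

Definition unit_map (x : unitg A) : unitg B :=
  Unitg (unit_map_mulK x) (unit_map_mulVK x).

End UnitMap.

(** * Definite quaternion algebras *)

Definition division_ring (A : pzRingType) :=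
  forall x : A, x <> 0 -> exists y, x * y = 1 /\ y * x = 1.

Definition quaternion_algebra (D : falgType rat) :=
  [/\ \dim {:D} = 4,
      ('Z({:D}) = 1)%VS
    & forall I : {vspace D},
        (forall x y, y \in I -> x * y \in I /\ y * x \in I) ->
        I = 0%VS \/ I = {:D}%VS].

Definition definite (R : realType) (D : falgType rat) :=
  division_ring (ext D (@ratr R)).

Section LocalAlgebra.
Variables (R : realType) (l : nat) (D : falgType rat) (K : padicField R l).

Definition local_alg : Type := ext D (padic_rat K).

HB.instance Definition _ := GRing.Lmodule.on local_alg.
HB.instance Definition _ := GRing.PzRing.on local_alg.

Definition integral_vec (x : local_alg) := forall i, (0 <= padic_val (x 0%R i))%E.

Definition local_open : set_system local_alg := fun A =>
  forall x, A x -> exists r : R,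
    forall y : local_alg, (forall i, (r%:E <= padic_val (y 0 i - x 0 i)%R)%E) -> A y.

Fact local_openT : local_open setT.
Proof. by move=> x _; exists 0. Qed.

Fact local_openI : setI_closed local_open.
Proof.
move=> A B oA oB x [/oA[r rA] /oB[s sB]]; exists (Num.max r s) => y xy.
split; [apply: rA | apply: sB] => i; apply: le_trans (xy i);
  by rewrite lee_fin le_max lexx ?orbT.
Qed.

Fact local_open_bigU (I : Type) (F : I -> set local_alg) :
  (forall i, local_open (F i)) -> local_open (\bigcup_i F i).
Proof.
move=> oF x [i _ /(oF i)[r rF]]; exists r => y xy.
by exists i => //; exact: rF.
Qed.

HB.instance Definition _ := isOpenTopological.Build local_alg
  local_openT local_openI local_open_bigU.

Definition alg_iso (eta : 'M[K]_2 -> local_alg) :=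
  [/\ bijective eta, linear eta, eta 1 = 1
    & forall M N, eta (M * N) = eta M * eta N].

Definition ramified := division_ring local_alg.

Definition integral_mx (M : 'M[K]_2) := forall i j, (0 <= padic_val (M i j))%E.

Definition GL2Z : set 'M[K]_2 :=
  [set M | integral_mx M /\ padic_val (\det M) = 0%E].

Definition open_compact_unit_subgroup (A : set local_alg) :=
  [/\ open A, compact A, A 1,
      forall x y, A x -> A y -> A (x * y)
    & forall x, A x -> exists2 y, A y & x * y = 1 /\ y * x = 1].

End LocalAlgebra.

Arguments ramified {R l} D K.
Arguments GL2Z {R l} K.

(** * The group [D_f^×] and the level *)

Section FiniteAdelicGroup.
Variables (R : realType) (Q_ : forall l : primeT, padicField R (val l)).
Variable D : falgType rat.

Definition Df : pzRingType := ext D (adele_rat Q_).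

Definition Dfx := unitg Df.

Definition Dx_in (d : unitg D) : Dfx :=
  unit_map (ext_in (adele_rat Q_) : {rmorphism D -> Df}) d.

Definition component (l : primeT) (g : Dfx) : local_alg D (Q_ l) :=
  \row_k ((uval g : 'rV[adele Q_]_(\dim {:D})) 0 k) l.

Section Level.
Variable eta : forall l : primeT, 'M[Q_ l]_2 -> local_alg D (Q_ l).
Variables (p : primeT) (Ul : forall l : primeT, set (local_alg D (Q_ l))).
Variable m : nat.

Definition U0 : set 'M[Q_ p]_2 :=
  [set M | [/\ padic_val (M 0 0) = 0%E, (0 <= padic_val (M 0%R 1%R))%E,
               (m%:R%:E <= padic_val (M 1%R 0%R))%E
             & padic_val (M 1 1) = 0%E]].

Definition level : set Dfx :=
  [set u | (forall l, l <> p -> Ul (component l u)) /\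
           exists2 M, U0 M & component p u = eta M].

Definition at_p (M : 'M[Q_ p]_2) : Dfx :=
  xget 1%g [set g | component p g = eta M /\
                    forall l, l <> p -> component l g = 1].

End Level.
End FiniteAdelicGroup.

(** * Characters of [Z_p^×] and the weight *)

Section Weight.
Variables (R : realType) (p : nat) (K : padicField R p).

Definition factors_mod (T : Type) (psi : K -> T) (n : nat) :=
  forall x y : K, padic_val x = 0%E -> padic_val y = 0%E ->
    (n%:R%:E <= padic_val (x - y)%R)%E -> psi x = psi y.

Definition min_level : nat := if p == 2%N then 2 else 1.

(** Only the values of [psi] at the units of [Z_p] matter. *)
Definition finite_character (L : fieldType) (psi : K -> L) :=
  [/\ psi 1 = 1,
      forall x y : K, padic_val x = 0%E -> padic_val y = 0%E ->
        psi (x * y) = psi x * psi y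
    & exists n, factors_mod psi n].

(** [psi] has conductor [p^m]; the trivial character has conductor [p], or
    [4] if [p = 2]. *)
Definition has_conductor (T : Type) (psi : K -> T) (m : nat) :=
  [/\ (min_level <= m)%N, factors_mod psi m
    & forall m', (min_level <= m')%N -> (m' < m)%N -> ~ factors_mod psi m'].

Definition teich_modulus : nat := if p == 2%N then 4 else p.

(** For [p = 2] this is the sign congruent to [a] modulo [4]. *)
Definition teichmuller (a : K) : K :=
  xget 0 [set w | w ^+ totient teich_modulus = 1 /\
    (padic_val (teich_modulus%:R : K) <= padic_val (w - a)%R)%E].

Definition one_unit_part (a : K) : K := a / teichmuller a.

Definition gbinomial (k : K) (n : nat) : K :=
  (\prod_(i < n) (k - i%:R)) / n`!%:R.

(** [x^k] for [x] in [1+pZ_p] and [k] in [Z_p], as a binomial series. *)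
Definition unit_power (x k : K) : K :=
  vsum (@padic_val R p K) (fun n => gbinomial k n * (x - 1) ^+ n).

End Weight.

(** * Overconvergent automorphic forms *)

(** A sequence of coefficients stands for a power series in [z]. *)
Section PowerSeries.
Variable A : comNzRingType.
Implicit Types f g : nat -> A.

Definition ps_one : nat -> A := fun n => (n == 0)%:R.

Definition ps_mul f g : nat -> A := fun n => \sum_(i < n.+1) f i * g (n - i)%N.

Definition ps_exp f (i : nat) : nat -> A := iter i (ps_mul f) ps_one.

End PowerSeries.

Section Slash.
Variables (R : realType) (p : nat) (K : padicField R p) (E : fieldExtType K).
Variables (v : E -> \bar R) (psi : K -> E) (k : K).

Definition tate (h : nat -> E) :=
  forall r : R, exists N, forall n, (N <= n)%N -> (r%:E <= v (h n))%E.

Definition ps_subst (h : nat -> E) (w : nat -> K) : nat -> E :=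
  fun n => vsum v (fun i => h i * (ps_exp w i n)%:A).

(** The expansion of [(az+b)/(cz+d)] at [z = 0]. *)
Definition mobius (M : 'M[K]_2) : nat -> K :=
  ps_mul (fun n => [:: M 0 1; M 0 0]`_n)
         (fun n => (- M 1 0) ^+ n / M 1 1 ^+ n.+1).

(** [(1+(c/d)z)^k] *)
Definition aut_factor (M : 'M[K]_2) : nat -> K :=
  fun n => gbinomial k n * (M 1 0 / M 1 1) ^+ n.

(** [κ(cz+d)/(cz+d) h((az+b)/(cz+d))] for [κ(x) = x <x>^k psi(x)], that is
    [psi(d) <d>^k (1+(c/d)z)^k h((az+b)/(cz+d))]; meaningful when [p^m]
    divides [c] and [d] is a unit. *)
Definition slash (h : nat -> E) (M : 'M[K]_2) : nat -> E :=
  fun n => psi (M 1 1) * (unit_power (one_unit_part (M 1 1)) k)%:A *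
    ps_mul (fun i => (aut_factor M i)%:A) (ps_subst h (mobius M)) n.

End Slash.

Section Forms.
Variables (R : realType) (Q_ : forall l : primeT, padicField R (val l)).
Variables (D : falgType rat).
Variable eta : forall l : primeT, 'M[Q_ l]_2 -> local_alg D (Q_ l).
Variables (p : primeT) (Ul : forall l : primeT, set (local_alg D (Q_ l))).
Variables (m : nat) (E : fieldExtType (Q_ p)) (v : E -> \bar R).
Variable psi : Q_ p -> E.

Local Notation Dfx := (Dfx Q_ D).
Local Notation level := (level eta p Ul m).

Definition classical_forms : set (Dfx -> E) :=
  [set phi | forall (d : unitg D) (g u : Dfx) (M : 'M[Q_ p]_2),
    level u -> component p u = eta M ->
    phi (Dx_in Q_ d * g * u)%g = psi (M 1 1) * phi g].

Variable k : Q_ p.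

Definition overconvergent_forms : set (Dfx -> nat -> E) :=
  [set phi | (forall g, tate v (phi g)) /\
    forall (d : unitg D) (g u : Dfx) (M : 'M[Q_ p]_2),
      level u -> component p u = eta M ->
      phi (Dx_in Q_ d * g * u)%g = slash v psi k (phi g) M].

Definition hecke_mx (j : nat) : 'M[Q_ p]_2 :=
  \matrix_(a < 2, b < 2)
    if a == 0 then (if b == 0 then (val p)%:R else 0)
    else (if b == 0 then j%:R * (val p)%:R ^+ m else 1).

Definition Up (phi : Dfx -> nat -> E) : Dfx -> nat -> E := fun g n =>
  \sum_(j < val p)
    slash v psi k (phi (g * (at_p eta (hecke_mx j))^-1)%g) (hecke_mx j) n.

End Forms.

Definition has_dim (E : fieldType) (X : Type) (S : set (X -> E)) (t : nat) :=
  exists b : 'I_t -> X -> E, (forall i, S (b i)) /\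
    forall phi, S phi ->
      exists! a : 'rV[E]_t, phi = fun x => \sum_i a 0 i * b i x.

(** * Fredholm characteristic series *)

(** [S] is a Banach space of functions [X -> E<z>] for the norm
    [sup_(g, n) |phi g n|]; [sup_bound phi r] means that the norm of [phi] is
    at most that of an element of valuation [r]. *)
Section Fredholm.
Variables (R : realType) (E : fieldType) (v : E -> \bar R) (X : Type).
Implicit Types (phi : X -> nat -> E) (e : nat -> X -> nat -> E).

Definition sup_bound phi (r : R) := forall g n, (r%:E <= v (phi g n))%E.

Definition null_sequence (a : nat -> E) := vcvg v a 0.

Definition expands e (a : nat -> E) phi :=
  null_sequence a /\
  forall r : R, exists N, forall N', (N <= N')%N ->
    sup_bound (fun g n => phi g n - \sum_(i < N') a i * e i g n) r.

Definition orthonormal_basis (S : set (X -> nat -> E)) e :=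
  [/\ forall i, S (e i),
      forall phi, S phi -> exists a, expands e a phi
    & forall phi a, S phi -> expands e a phi ->
        forall r : R, sup_bound phi r <-> forall i, (r%:E <= v (a i))%E].

(** [det (1 - X T)] is the coefficientwise limit of the characteristic series
    of the finite truncations of the matrix of [T]. *)
Definition fredholm_series (S : set (X -> nat -> E))
    (T : (X -> nat -> E) -> X -> nat -> E) (c : nat -> E) :=
  exists e (a : nat -> nat -> E),
    [/\ orthonormal_basis S e,
        forall j, expands e (a^~ j) (T (e j))
      & forall n, vcvg v (fun N =>
          (\det (1%:M - 'X *: map_mx polyC
             (\matrix_(i < N, j < N) a (val i) (val j))))`_n) (c n)].

End Fredholm.

(** * Newton polygons *)

Section NewtonPolygon.
Variables (R : realType) (E : fieldType) (v : E -> \bar R).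

(** The convex hull of the points [(n, v (c n))] with [c n != 0]. *)
Definition newton_hull (c : nat -> E) : set (R * R) :=
  [set z | exists N (w : 'I_N -> R),
    [/\ forall i, 0 <= w i, \sum_i w i = 1,
        forall i, c (val i) = 0 -> w i = 0
      & z = (\sum_i w i * (val i)%:R, \sum_i w i * fine (v (c (val i))))]].

Definition newton_polygon (c : nat -> E) (x : R) : \bar R :=
  ereal_inf [set z.2%:E | z in [set z | newton_hull c z /\ z.1 = x]].

(** [f] lies above the polygon with vertices [V 0, V 1, V 2, ...] *)
Definition lies_above (f : R -> \bar R) (V : nat -> R * R) :=
  forall (n : nat) (s : R), 0 <= s <= 1 ->
    (((1 - s) * (V n).2 + s * (V n.+1).2)%:E
       <= f ((1 - s) * (V n).1 + s * (V n.+1).1)%R)%E.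

End NewtonPolygon.

(* Main.v *)
Require Import Defs.
From mathcomp Require Import all_boot all_order all_algebra all_field.
From mathcomp Require Import boolp classical_sets functions cardinality.
From mathcomp Require Import reals ereal topology.
From mathcomp Require Import perm cyclic.
From mathcomp Require Import ring lra zify.

(** A form [phi] is determined by its values at representatives of the double
    cosets [D^x \ D_f^x / U], and by the smallness of [U] these values are
    arbitrary elements of the Tate algebra [E<z>]. The same argument for
    classical forms, with [E] in place of [E<z>], shows that the number [n0] of
    double cosets is at most [t] ([inequivalent_leq], [exists_reps]). Hence the
    overconvergent forms have an orthonormal basis consisting of the monomials
    [z^r] supported on one double coset, [n0] of them in each degree [r]
    ([eps_basis]).

    The matrices [v_j] that define [U_p] act through
    [z |-> (p z) / (j p^m z + 1)], so the coefficient of [z^r] in a value of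
    [U_p phi] is divisible by [p^r] when [phi] is integral ([Up_slope]). Thus in
    this basis the rows of the matrix of [U_p] in degree [r] are divisible by
    [p^r]. An [n x n] minor therefore has valuation at least the sum of the [n]
    smallest weights, which are [0] with multiplicity [n0], [1] with
    multiplicity [n0], and so on ([fdet_row_bound]); as [n0 <= t], this sum
    is at least the height of the polygon of the theorem over [n]
    ([natr_sum_line]), and the Newton polygon lies above it.

    A characteristic series is allowed to be computed in any orthonormal basis.
    A change of basis destroys the divisibility of rows, but a finite truncation
    of the new matrix is, modulo a high power of [p], a product [C B] in which
    [C] is integral and [B] has divisible rows, and [det (1 - X C B)] equals
    [det (1 - X B C)] by Sylvester's identity ([char_series_bound]). The same
    exchange of factors shows that the coefficients converge for the monomial
    basis ([fdet_cvg]).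

    The analytic part is the fact that the formula of weight [k] is an action of
    a monoid of matrices on [E<z>] ([slash_comp]). A Tate series is determined
    by its values at the integral points of [E] ([ps_eval_inj]), evaluation is
    compatible with products and substitution because polynomials are dense
    ([bdd_linear_ext]), and powers of one-units with exponent [k] are uniform
    limits of powers with natural exponents ([upow_approx]); so the cocycle
    relation is checked pointwise in the field [E]. All of this uses that [E] is
    complete ([ext_complete]). Finally [U_p] preserves the forms because right
    translation by [U] permutes the cosets that define it ([hecke_swap]). *)

Set Implicit Arguments.
Unset Strict Implicit.
Unset Printing Implicit Defensive.

Import Order.TTheory GRing.Theory Num.Theory.
Local Open Scope classical_set_scope.
Local Open Scope ring_scope.

(** * Valued fields, null sequences and convergent series *)

Lemma nat_bound (R : realType) (r : R) : exists N : nat, r <= N%:R.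
Proof.
by exists (Num.bound `|r|); apply: le_trans (ler_norm _) (ltW (archi_boundP _)).
Qed.

Section ValuedField.
Variables (R : realType) (E : fieldType) (v : E -> \bar R).
Hypothesis hv : is_valuation v.
Implicit Types (r s B : R) (x y z : E) (f g h u w : nat -> E).

Lemma val0 : v 0 = +oo%E.
Proof. by apply/eqP; case: hv => ->. Qed.

Lemma valM x y : v (x * y) = (v x + v y)%E.
Proof. by case: hv. Qed.

Lemma val1 : v 1 = 0%E.
Proof.
case: hv => v0 vN _ _; have := valM 1 1; rewrite mulr1.
have := v0 1; have := vN 1; rewrite oner_eq0.
by case: (v 1) => [r||] //= _ _ [] /eqP; rewrite -subr_eq0 opprD addNKr oppr_eq0 => /eqP->.
Qed.

Lemma valN1 : v (-1) = 0%E.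
Proof.
have := valM (-1) (-1); rewrite mulrNN mulr1 val1.
case: (v (-1)) => [r||] //= /eqP.
by rewrite -EFinD eqe -mulr2n eq_sym mulrn_eq0 /= => /eqP->.
Qed.

Lemma valN x : v (- x) = v x.
Proof. by rewrite -mulN1r valM valN1 add0e. Qed.

Lemma val_fin x : x != 0 -> v x \is a fin_num.
Proof.
case: hv => v0 vN _ _ x0; rewrite fin_numE vN /=.
by rewrite v0.
Qed.

Lemma valV x : x != 0 -> v x^-1 = (- v x)%E.
Proof.
move=> x0; have := valM x x^-1; rewrite divff // val1.
rewrite -(fineK (val_fin x0)) -(fineK (val_fin (x := x^-1) _)) ?invr_eq0 //.
rewrite -EFinD -EFinN => -[] /eqP; rewrite eq_sym addrC addr_eq0 => /eqP->.
by [].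
Qed.

Lemma vge_le r s x : s <= r -> (r%:E <= v x)%E -> (s%:E <= v x)%E.
Proof. by move=> sr; apply: le_trans; rewrite lee_fin. Qed.

Lemma vgeD r x y : (r%:E <= v x -> r%:E <= v y -> r%:E <= v (x + y)%R)%E.
Proof.
move=> rx ry; case: hv => _ _ _ /(_ x y); apply: le_trans.
by rewrite le_min rx ry.
Qed.

Lemma vgeN r x : (r%:E <= v x -> r%:E <= v (- x)%R)%E.
Proof. by rewrite valN. Qed.

Lemma vgeB r x y : (r%:E <= v x -> r%:E <= v y -> r%:E <= v (x - y)%R)%E.
Proof. by move=> rx ry; apply: vgeD => //; exact: vgeN. Qed.

Lemma vgeC r x y : (r%:E <= v (x - y)%R -> r%:E <= v (y - x)%R)%E.
Proof. by rewrite -opprB valN. Qed.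

Lemma vge_trans r x y z :
  (r%:E <= v (x - y)%R -> r%:E <= v (y - z)%R -> r%:E <= v (x - z)%R)%E.
Proof. by move=> a b; rewrite -(subrKA y); exact: vgeD. Qed.

Lemma vgeM r s x y : (r%:E <= v x -> s%:E <= v y -> (r + s)%R%:E <= v (x * y)%R)%E.
Proof. by move=> rx sy; rewrite valM EFinD; exact: leeD. Qed.

Lemma vge_mull r x y : (0 <= v x -> r%:E <= v y -> r%:E <= v (x * y)%R)%E.
Proof. by move=> x0 ry; rewrite -[r]add0r; exact: vgeM. Qed.

Lemma vge_mulr r x y : (r%:E <= v x -> 0 <= v y -> r%:E <= v (x * y)%R)%E.
Proof. by rewrite mulrC => rx y0; exact: vge_mull. Qed.

Lemma vge0 r : (r%:E <= v 0)%E.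
Proof. by rewrite val0 leey. Qed.

Lemma vge_sum r (I : Type) (s : seq I) (P : pred I) (F : I -> E) :
  (forall i, P i -> (r%:E <= v (F i))%E) -> (r%:E <= v (\sum_(i <- s | P i) F i)%R)%E.
Proof. by move=> H; apply: (big_ind (fun x => (r%:E <= v x)%E)) => //; [exact: vge0 | move=> *; exact: vgeD]. Qed.

Lemma vgeX r x n : (r%:E <= v x -> (n%:R * r)%R%:E <= v (x ^+ n)%R)%E.
Proof.
move=> rx; elim: n => [|n IH]; first by rewrite mul0r expr0 val1.
by rewrite exprS -add1n natrD mulrDl mul1r; exact: vgeM.
Qed.

Lemma vintX x n : (0 <= v x -> 0 <= v (x ^+ n)%R)%E.
Proof. by move/(vgeX n); rewrite mulr0. Qed.

Lemma vint_nat n : (0 <= v n%:R)%E.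
Proof.
by elim: n => [|n IH]; rewrite ?vge0 // -add1n natrD vgeD // val1.
Qed.

Lemma val_root_unity x n : (0 < n)%N -> x ^+ n = 1 -> v x = 0%E.
Proof.
move=> n0 xn; have x0 : x != 0.
  by apply/eqP => x0; move: xn; rewrite x0 expr0n gtn_eqF // => /esym/eqP; rewrite oner_eq0.
have := fineK (val_fin x0); set r := fine _ => vr.
have : forall i : nat, v (x ^+ i) = (i%:R * r)%:E.
  elim=> [|i IH]; first by rewrite expr0 mul0r val1.
  by rewrite exprS valM -vr IH -EFinD -add1n natrD mulrDl mul1r.
move=> /(_ n); rewrite xn val1 => -[] /esym/eqP.
by rewrite mulf_eq0 pnatr_eq0 gtn_eqF //= => /eqP r0; rewrite -vr r0.
Qed.

(** The valuation is separated. As the value group need not be discrete,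
    equalities are proved below from bounds by every real number. *)
Lemma vge_all0 x : (forall r, (r%:E <= v x)%E) -> x = 0.
Proof.
move=> H; apply/eqP; apply: contraT => /val_fin /fineK e.
by have := H (fine (v x) + 1); rewrite -e lee_fin gerDl ler10.
Qed.

Lemma vge_all_eq x y : (forall r, (r%:E <= v (x - y)%R)%E) -> x = y.
Proof. by move/vge_all0/eqP; rewrite subr_eq0 => /eqP. Qed.

Lemma vge_ex x : exists r, (r%:E <= v x)%E.
Proof.
case: (eqVneq x 0) => [->|/val_fin/fineK e]; first by exists 0; exact: vge0.
by exists (fine (v x)); rewrite e.
Qed.

Lemma vge_exn F (N : nat) : exists r, forall i, (i < N)%N -> (r%:E <= v (F i))%E.
Proof.
elim: N => [|N [r IH]]; first by exists 0.
have [s sN] := vge_ex (F N); exists (Num.min r s) => i.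
rewrite ltnS leq_eqVlt => /predU1P[->|/IH].
  by apply: vge_le sN; rewrite ge_min lexx orbT.
by apply: vge_le; rewrite ge_min lexx.
Qed.

Lemma vunitD r x y : 0 < r -> v x = 0%E -> (r%:E <= v y)%E -> v (x + y) = 0%E.
Proof.
move=> r0 x0 ry; apply/eqP; rewrite eq_le; apply/andP; split; last first.
  by apply: vgeD; [rewrite x0 | apply: vge_le ry; exact: ltW].
rewrite leNgt; apply/negP => xy.
have [s s0 sxy] : exists2 s, 0 < s & (s%:E <= v (x + y)%R)%E.
  case: (v (x + y)) xy => [s||] // s0; first by exists s; rewrite ?lte_fin in s0 *.
  by exists 1; rewrite ?leey.
have : ((Num.min r s)%:E <= v x)%E.
  rewrite -[x](addrK y); apply: vgeB; [apply: vge_le sxy | apply: vge_le ry];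
    by rewrite ge_min lexx ?orbT.
by rewrite x0 lee_fin leNgt lt_min r0 s0.
Qed.

(** ** Null sequences *)

Definition nullseq f := forall r, exists N, forall n, (N <= n)%N -> (r%:E <= v (f n))%E.

Definition seq_bound f r := forall n, (r%:E <= v (f n))%E.

Lemma nullseq_bdd f : nullseq f -> exists r, seq_bound f r.
Proof.
move=> /(_ 0)[N fN]; have [r rf] := vge_exn f N.
exists (Num.min 0 r) => n; have [/fN|/rf] := leqP N n; apply: vge_le;
  by rewrite ge_min lexx ?orbT.
Qed.

Lemma nullseqB f g : nullseq f -> nullseq g -> nullseq (fun n => f n - g n).
Proof.
move=> nf ng r; have [[N fN] [M gM]] := (nf r, ng r).
by exists (maxn N M) => n; rewrite geq_max => /andP[/fN ? /gM ?]; exact: vgeB.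
Qed.

Lemma nullseqD f g : nullseq f -> nullseq g -> nullseq (fun n => f n + g n).
Proof.
move=> nf ng r; have [[N fN] [M gM]] := (nf r, ng r).
by exists (maxn N M) => n; rewrite geq_max => /andP[/fN ? /gM ?]; exact: vgeD.
Qed.

Lemma nullseqM f g : nullseq f -> (exists r, seq_bound g r) ->
  nullseq (fun n => f n * g n).
Proof.
move=> nf [B gB] r; have [N fN] := nf (r - B).
by exists N => n /fN fn; rewrite -[r](subrK B); exact: vgeM.
Qed.

Lemma nullseqZ a f : nullseq f -> nullseq (fun n => a * f n).
Proof.
move=> nf; have [B aB] := vge_ex a.
have: nullseq (fun n => f n * a) by apply: nullseqM => //; exists B.
by move=> H r; have [N HN] := H r; exists N => n /HN; rewrite mulrC.
Qed.

Lemma nullseq_fin f N : (forall n, (N <= n)%N -> f n = 0) -> nullseq f.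
Proof. by move=> fN r; exists N => n /fN ->; exact: vge0. Qed.

Lemma nullseq_sum (I : Type) (s : seq I) (P : pred I) (F : I -> nat -> E) :
  (forall i, P i -> nullseq (F i)) -> nullseq (fun n => \sum_(i <- s | P i) F i n).
Proof.
move=> H; elim: s => [|i s IH].
  by apply: (@nullseq_fin _ 0) => n _; rewrite big_nil.
move=> r; have [N HN] := IH r.
case Pi: (P i); last by exists N => n /HN; rewrite big_cons Pi.
have [M HM] := H i Pi r; exists (maxn N M) => n.
by rewrite geq_max big_cons Pi => /andP[/HN ? /HM ?]; exact: vgeD.
Qed.

Lemma nullseq_lim f : (forall r, exists2 g, nullseq g & forall n, (r%:E <= v (f n - g n)%R)%E) ->
  nullseq f.
Proof.
move=> H r; have [g ng fg] := H r; have [N gN] := ng r.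
by exists N => n /gN gn; rewrite -[f n](subrK (g n)); exact: vgeD.
Qed.

(** ** Limits and sums *)

Lemma vcvg_uniq u x y : vcvg v u x -> vcvg v u y -> x = y.
Proof.
move=> ux uy; apply: vge_all_eq => r; have [[N xN] [M yM]] := (ux r, uy r).
apply: (@vge_trans _ _ (u (maxn N M))); last by apply: yM; rewrite leq_maxr.
by apply: vgeC; apply: xN; rewrite leq_maxl.
Qed.

Lemma vcvg_lim u x : vcvg v u x -> vlim v u = x.
Proof.
move=> ux; rewrite /vlim; case: xgetP => [y -> uy|/(_ x)//].
exact: vcvg_uniq uy ux.
Qed.

Lemma vcvg_ge u x r : vcvg v u x -> (forall n, (r%:E <= v (u n))%E) -> (r%:E <= v x)%E.
Proof.
move=> ux ur; have [N xN] := ux r.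
by rewrite -[x](subKr (u N)); apply: vgeB => //; exact: xN.
Qed.

Definition vcomplete := forall u, vcauchy v u -> exists x, vcvg v u x.

Lemma psum_tail f r N M : (N <= M)%N -> (forall n, (N <= n)%N -> (r%:E <= v (f n))%E) ->
  (r%:E <= v (\sum_(i < M) f i - \sum_(i < N) f i)%R)%E.
Proof.
move=> NM fN; rewrite -!(big_mkord xpredT) (big_cat_nat (leq0n N) NM) /= addrAC subrr add0r.
by rewrite big_nat_cond; apply: vge_sum => i; rewrite andbT => /andP[/fN].
Qed.

Hypothesis cE : vcomplete.

Lemma vsum_cvg f : nullseq f -> vcvg v (fun n => \sum_(i < n) f i) (vsum v f).
Proof.
move=> nf; suff [x fx] : exists x, vcvg v (fun n => \sum_(i < n) f i) x.
  by rewrite /vsum (vcvg_lim fx).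
apply: cE => r; have [N fN] := nf r; exists N => i j Ni Nj.
apply: (@vge_trans _ _ (\sum_(i < N) f i)); first exact: psum_tail.
by apply: vgeC; exact: psum_tail.
Qed.

Lemma vsum_uniq f x : vcvg v (fun n => \sum_(i < n) f i) x -> vsum v f = x.
Proof. exact: vcvg_lim. Qed.

(** The workhorse for infinite sums: every identity between them is reduced to
    finite sums up to an error of arbitrarily large valuation. *)
Lemma vsum_tail f r N : nullseq f -> (forall n, (N <= n)%N -> (r%:E <= v (f n))%E) ->
  (r%:E <= v (vsum v f - \sum_(i < N) f i)%R)%E.
Proof.
move=> nf fN; have [M fM] := vsum_cvg nf r.
apply: (@vge_trans _ _ (\sum_(i < maxn N M) f i)).
  by apply: vgeC; apply: fM; rewrite leq_maxr.
by apply: psum_tail => //; rewrite leq_maxl.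
Qed.

Lemma vsum_ge f r : nullseq f -> seq_bound f r -> (r%:E <= v (vsum v f))%E.
Proof.
move=> nf fr; have := @vsum_tail f r 0 nf; rewrite big_ord0 subr0; apply.
by move=> n _.
Qed.

Lemma vsum_fin f N : (forall n, (N <= n)%N -> f n = 0) -> vsum v f = \sum_(i < N) f i.
Proof.
move=> f0; apply: vsum_uniq => r; exists N => n Nn.
by apply: psum_tail => // i /f0 ->; exact: vge0.
Qed.

Lemma vsum_lin a f g : nullseq f -> nullseq g ->
  vsum v (fun n => a * f n + g n) = a * vsum v f + vsum v g.
Proof.
move=> nf ng; have nafg : nullseq (fun n => a * f n + g n).
  by apply: nullseqD => //; exact: nullseqZ.
apply: vge_all_eq => r; have [B aB] := vge_ex a.
have [[N fN] [M gM]] := (nf (r - B), ng r).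
set K := maxn N M.
have -> : vsum v (fun n => a * f n + g n) - (a * vsum v f + vsum v g) =
  (vsum v (fun n => a * f n + g n) - \sum_(i < K) (a * f i + g i))
  - (a * (vsum v f - \sum_(i < K) f i) + (vsum v g - \sum_(i < K) g i)).
  by rewrite big_split -mulr_sumr /=; ring.
have fK n : (K <= n)%N -> ((r - B)%:E <= v (f n))%E.
  by rewrite geq_max => /andP[/fN].
have gK n : (K <= n)%N -> (r%:E <= v (g n))%E.
  by rewrite geq_max => /andP[_ /gM].
have afr n : (K <= n)%N -> (r%:E <= v (a * f n)%R)%E.
  by move/fK => fn; rewrite -[r](subrK B) addrC; exact: vgeM.
apply: vgeB; first by apply: vsum_tail => // n Kn; apply: vgeD; [exact: afr | exact: gK].
apply: vgeD; last exact: vsum_tail.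
by rewrite -[r](subrK B) addrC; apply: vgeM => //; exact: vsum_tail.
Qed.

Lemma vsumZ a f : nullseq f -> vsum v (fun n => a * f n) = a * vsum v f.
Proof.
move=> nf; have n0 : nullseq (fun _ => 0) by apply: (@nullseq_fin _ 0).
have := vsum_lin a nf n0; rewrite (@vsum_fin (fun=> 0) 0) // big_ord0 addr0 => <-.
by congr vsum; apply: funext => n; rewrite addr0.
Qed.

Lemma vsumB f g : nullseq f -> nullseq g ->
  vsum v (fun n => f n - g n) = vsum v f - vsum v g.
Proof.
move=> nf ng; rewrite addrC -mulN1r -vsum_lin //.
by congr vsum; apply: funext => n; rewrite mulN1r addrC.
Qed.

End ValuedField.

(** * Tate series and their values *)

Section TateSeries.
Variables (R : realType) (E : fieldType) (v : E -> \bar R).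
Hypotheses (hv : is_valuation v) (cE : vcomplete v).
Implicit Types (r s B : R) (x y z : E) (f g h u w : nat -> E).

Local Notation nullseq := (nullseq v).
Local Notation seq_bound := (seq_bound v).

Definition ps_mono i : nat -> E := fun n => (n == i)%:R.

Lemma ps_mono_null i : nullseq (ps_mono i).
Proof.
apply: (nullseq_fin hv (N := i.+1)) => n; rewrite /ps_mono.
by case: eqP => // ->; rewrite ltnn.
Qed.

(** Boundedness only with a loss [B]: multiplication by a series that is not
    integral must be allowed. *)
Definition bdd_linear (L : (nat -> E) -> E) :=
  (forall a f g, nullseq f -> nullseq g ->
     L (fun n => a * f n + g n) = a * L f + L g) /\
  exists B, forall f r, nullseq f -> seq_bound f r -> ((r + B)%R%:E <= v (L f))%E.

Definition bdd_op (A : (nat -> E) -> nat -> E) :=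
  [/\ forall f, nullseq f -> nullseq (A f),
      forall a f g, nullseq f -> nullseq g ->
        A (fun n => a * f n + g n) = fun n => a * A f n + A g n
    & exists B, forall f r, nullseq f -> seq_bound f r -> seq_bound (A f) (r + B)].

Lemma bdd_linear_comp L A : bdd_linear L -> bdd_op A -> bdd_linear (L \o A).
Proof.
move=> [linL [B LB]] [nA linA [C AC]]; split=> [a f g nf ng|] /=.
  by rewrite linA // linL //; exact: nA.
exists (C + B) => f r nf fr; rewrite addrA; apply: LB; first exact: nA.
exact: AC.
Qed.

Lemma bdd_linearZ L c : bdd_linear L -> bdd_linear (fun f => L f * c).
Proof.
move=> [linL [B LB]]; have [C cC] := vge_ex hv c.
split=> [a f g nf ng|]; first by rewrite linL // mulrDl mulrA.
by exists (B + C) => f r nf fr; rewrite addrA; apply: (vgeM hv) => //; exact: LB.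
Qed.

Definition ps_head N f : nat -> E := fun n => if (n < N)%N then f n else 0.

Lemma ps_head_null N f : nullseq (ps_head N f).
Proof.
by apply: (nullseq_fin hv (N := N)) => n; rewrite /ps_head ltnNge => ->.
Qed.

(** Polynomials are dense, so a bounded linear functional is determined by its
    values at the monomials. *)
Lemma bdd_linear_ext L1 L2 : bdd_linear L1 -> bdd_linear L2 ->
  (forall i, L1 (ps_mono i) = L2 (ps_mono i)) -> forall f, nullseq f -> L1 f = L2 f.
Proof.
have lin0 L : bdd_linear L -> L (fun=> 0) = 0.
  move=> [linL _]; have n0 : nullseq (fun=> 0) by exact: (nullseq_fin hv (N := 0)).
  have := linL 1 _ _ n0 n0; rewrite mul1r addr0 mul1r => /eqP.
  by rewrite -subr_eq0 opprD addNKr oppr_eq0 => /eqP.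
move=> lL1 lL2 L12 f nf.
have headE N : L1 (ps_head N f) = L2 (ps_head N f).
  elim: N => [|N IH]; first by rewrite [ps_head 0 f]/ps_head !lin0.
  have -> : ps_head N.+1 f = fun n => f N * ps_mono N n + ps_head N f n.
    apply: funext => n; rewrite /ps_head /ps_mono ltnS leq_eqVlt.
    by case: eqP => [->|_] /=; rewrite ?ltnn ?mulr1 ?mulr0 ?addr0 ?add0r.
  by rewrite lL1.1 ?lL2.1 ?L12 ?IH //; first [exact: ps_mono_null | exact: ps_head_null].
apply: (vge_all_eq hv) => r; have [[_ [B1 LB1]] [_ [B2 LB2]]] := (lL1, lL2).
have [N fN] := nf (r - Num.min B1 B2).
pose T n := f n - ps_head N f n.
have nT : nullseq T by apply: (nullseqB hv) => //; exact: ps_head_null.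
have fE : f = fun n => 1 * T n + ps_head N f n.
  by apply: funext => n; rewrite mul1r subrK.
have Tb : seq_bound T (r - Num.min B1 B2).
  move=> n; rewrite /T /ps_head; have [Nn|nN] := leqP N n; rewrite ?subr0 ?subrr.
    exact: fN.
  exact: (vge0 hv).
rewrite fE lL1.1 ?lL2.1 ?headE //; try exact: ps_head_null.
rewrite !mul1r opprD addrACA subrr addr0; apply: (vgeB hv).
  apply: (vge_le _ (LB1 _ _ nT Tb)).
  by rewrite -addrA lerDl addrC subr_ge0 ge_min lexx.
apply: (vge_le _ (LB2 _ _ nT Tb)).
by rewrite -addrA lerDl addrC subr_ge0 ge_min lexx orbT.
Qed.

(** ** Products *)

Lemma ps_mulC f g : ps_mul f g = ps_mul g f.
Proof.
apply: funext => n; rewrite /ps_mul (reindex_inj rev_ord_inj) /=.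
by apply: eq_bigr => i _; rewrite subSS subKn 1?mulrC // -ltnS.
Qed.

Lemma ps_mul_mono i j : ps_mul (ps_mono i) (ps_mono j) = ps_mono (i + j).
Proof.
apply: funext => n; rewrite /ps_mul /ps_mono.
have [iN|ni] := ltnP i n.+1.
  rewrite (bigD1 (Ordinal iN)) //= eqxx mul1r big1 ?addr0 => [|k].
    by congr (_%:R); lia.
  by rewrite -val_eqE /= => /negPf ->; rewrite mul0r.
rewrite big1 => [|k _]; first by case: eqP => //; lia.
by case: eqP => [ki|]; rewrite ?mul0r //; have := ltn_ord k; lia.
Qed.

Lemma ps_mul_linl g a f f' :
  ps_mul (fun n => a * f n + f' n) g = fun n => a * ps_mul f g n + ps_mul f' g n.
Proof.
apply: funext => n; rewrite /ps_mul mulr_sumr -big_split /=.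
by apply: eq_bigr => i _; rewrite mulrDl mulrA.
Qed.

(** Bound on the coefficients growing with slope [s]; the slope [0] gives the
    sup norm, the slope [1] the norm of the disc of radius [p]. *)
Definition slope_bound s f r := forall n, ((r + n%:R * s)%R%:E <= v (f n))%E.

Lemma slope_bound0 f r : slope_bound 0 f r <-> seq_bound f r.
Proof. by split=> H n; have := H n; rewrite mulr0 addr0. Qed.

Lemma slope_bound_mul s f g r r' :
  slope_bound s f r -> slope_bound s g r' -> slope_bound s (ps_mul f g) (r + r').
Proof.
move=> fr gr n; apply: (vge_sum hv) => i _.
have iN : (i <= n)%N by rewrite -ltnS; exact: ltn_ord.
have -> : r + r' + n%:R * s = (r + (val i)%:R * s) + (r' + (n - i)%N%:R * s).
  by rewrite addrACA -mulrDl -natrD subnKC.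
by apply: (vgeM hv); [exact: fr | exact: gr].
Qed.

Lemma seq_bound_mul f g r r' :
  seq_bound f r -> seq_bound g r' -> seq_bound (ps_mul f g) (r + r').
Proof.
move=> fr gr; apply/slope_bound0; apply: slope_bound_mul; exact/slope_bound0.
Qed.

(** In a coefficient of high degree of a product, one of the two indices is
    large, while the other factor stays bounded. *)
Lemma ps_mul_null f g : nullseq f -> nullseq g -> nullseq (ps_mul f g).
Proof.
move=> nf ng r; have [[B fB] [C gC]] := (nullseq_bdd hv nf, nullseq_bdd hv ng).
have [[N fN] [M gM]] := (nf (r - C), ng (r - B)).
exists (N + M)%N => n NMn; apply: (vge_sum hv) => i _.
have [Ni|iN] := leqP N i.
  by rewrite -[r](subrK C); apply: (vgeM hv) => //; exact: fN.
rewrite -[r](subrK B) addrC; apply: (vgeM hv) => //; apply: gM.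
by have := ltn_ord i; lia.
Qed.

Lemma ps_mul_op g : nullseq g -> bdd_op (fun f => ps_mul f g).
Proof.
move=> ng; split=> [f nf|a f f' _ _|]; first exact: ps_mul_null.
  exact: ps_mul_linl.
have [B gB] := nullseq_bdd hv ng.
by exists B => f r _ fr; exact: seq_bound_mul.
Qed.

(** ** Evaluation at points of the closed unit disc *)

Definition ps_eval f z : E := vsum v (fun n => f n * z ^+ n).

Lemma ps_eval_null f z : (0 <= v z)%E -> nullseq f -> nullseq (fun n => f n * z ^+ n).
Proof.
by move=> z0 nf; apply: (nullseqM hv) => //; exists 0 => n; exact: vintX.
Qed.

Lemma ps_eval_linear z : (0 <= v z)%E -> bdd_linear (ps_eval^~ z).
Proof.
move=> z0; split=> [a f g nf ng|].
  rewrite /ps_eval -(vsum_lin hv cE); try exact: ps_eval_null.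
  by congr vsum; apply: funext => n; rewrite mulrDl mulrA.
exists 0 => f r nf fr; rewrite addr0; apply: (vsum_ge hv cE).
  exact: ps_eval_null.
by move=> n; apply: (vge_mulr hv) => //; exact: (vintX hv).
Qed.

Lemma ps_eval_int f z : (0 <= v z)%E -> nullseq f -> seq_bound f 0 ->
  (0 <= v (ps_eval f z))%E.
Proof.
move=> z0 nf f0; apply: (vsum_ge hv cE); first exact: ps_eval_null.
by move=> n; apply: (vge_mulr hv) => //; exact: (vintX hv).
Qed.

Lemma ps_eval_mono i z : ps_eval (ps_mono i) z = z ^+ i.
Proof.
rewrite /ps_eval (vsum_fin hv (N := i.+1)) => [|n].
  rewrite (bigD1 ord_max) //= /ps_mono eqxx mul1r big1 ?addr0 // => k.
  by rewrite -val_eqE /= => /negPf ->; rewrite mul0r.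
by rewrite /ps_mono; case: eqP => [->|]; rewrite ?ltnn ?mul0r.
Qed.

(** Both sides are bounded and linear in [f] and in [g], which reduces the claim
    to monomials. *)
Lemma ps_evalM f g z : (0 <= v z)%E -> nullseq f -> nullseq g ->
  ps_eval (ps_mul f g) z = ps_eval f z * ps_eval g z.
Proof.
move=> z0 nf ng.
have lL := bdd_linear_comp (ps_eval_linear z0) (ps_mul_op ng).
have lR := bdd_linearZ (ps_eval g z) (ps_eval_linear z0).
apply: (bdd_linear_ext lL lR) nf => i /=; rewrite ps_mulC ps_eval_mono.
have ni := ps_mono_null i.
have lL' := bdd_linear_comp (ps_eval_linear z0) (ps_mul_op ni).
have lR' := bdd_linearZ (z ^+ i) (ps_eval_linear z0).
rewrite mulrC; apply: (bdd_linear_ext lL' lR') ng => j /=.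
by rewrite ps_mul_mono !ps_eval_mono exprD.
Qed.

(** ** Substitution *)

Lemma ps_exp_null w i : nullseq w -> nullseq (ps_exp w i).
Proof.
move=> nw; elim: i => [|i IH]; first exact: ps_mono_null.
exact: ps_mul_null.
Qed.

Lemma ps_exp_slope s w i : slope_bound s w 0 -> slope_bound s (ps_exp w i) 0.
Proof.
move=> w0; elim: i => [|i IH] /=; last first.
  by rewrite -[X in slope_bound _ _ X]addr0; exact: slope_bound_mul.
case=> [|n]; first by rewrite mul0r addr0 /ps_exp /= /ps_one (val1 hv).
by rewrite /ps_exp /= /ps_one; exact: (vge0 hv).
Qed.

Lemma ps_exp_bound w i : seq_bound w 0 -> seq_bound (ps_exp w i) 0.
Proof. by move=> /slope_bound0 w0; apply/slope_bound0; exact: ps_exp_slope. Qed.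

Definition ps_comp h w : nat -> E := fun n => vsum v (fun i => h i * ps_exp w i n).

Lemma ps_comp_terms h w n : nullseq h -> seq_bound w 0 ->
  nullseq (fun i => h i * ps_exp w i n).
Proof.
move=> nh w0; apply: (nullseqM hv) => //; exists 0 => i; exact: ps_exp_bound.
Qed.

Lemma ps_comp_slope s h w r : nullseq h -> seq_bound w 0 ->
  seq_bound h r -> slope_bound s w 0 -> slope_bound s (ps_comp h w) r.
Proof.
move=> nh w0 hr ws n; apply: (vsum_ge hv cE) => [|i]; first exact: ps_comp_terms.
apply: (vgeM hv); first exact: hr.
by have := ps_exp_slope i ws n; rewrite add0r.
Qed.

(** Up to a small error only finitely many powers of [w] contribute, and each of
    them is a null sequence. *)
Lemma ps_comp_null h w : nullseq h -> nullseq w -> seq_bound w 0 ->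
  nullseq (ps_comp h w).
Proof.
move=> nh nw w0; apply: (nullseq_lim hv) => r; have [N hN] := nh r.
exists (fun n => \sum_(i < N) h i * ps_exp w i n).
  by apply: (nullseq_sum hv) => i _; apply: (nullseqZ hv); exact: ps_exp_null.
move=> n; apply: (vsum_tail hv cE) => [|i Ni]; first exact: ps_comp_terms.
by apply: (vge_mulr hv); [exact: hN | exact: ps_exp_bound].
Qed.

Lemma ps_comp_op w : nullseq w -> seq_bound w 0 -> bdd_op (ps_comp^~ w).
Proof.
move=> nw w0; split=> [f nf|a f g nf ng|]; first exact: ps_comp_null.
  apply: funext => n; rewrite /ps_comp -(vsum_lin hv cE); try exact: ps_comp_terms.
  by congr vsum; apply: funext => i; rewrite mulrDl mulrA.
exists 0 => f r nf fr; rewrite addr0; apply/slope_bound0.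
by apply: ps_comp_slope => //; exact/slope_bound0.
Qed.

Lemma ps_eval_exp w i z : (0 <= v z)%E -> nullseq w ->
  ps_eval (ps_exp w i) z = ps_eval w z ^+ i.
Proof.
move=> z0 nw; elim: i => [|i IH]; first by rewrite expr0 -(expr0 z) -ps_eval_mono.
by rewrite exprS -IH -ps_evalM //; exact: ps_exp_null.
Qed.

Lemma ps_comp_mono i w : ps_comp (ps_mono i) w = ps_exp w i.
Proof.
apply: funext => n; rewrite /ps_comp (vsum_fin hv (N := i.+1)) => [|k].
  rewrite (bigD1 ord_max) //= /ps_mono eqxx mul1r big1 ?addr0 // => k.
  by rewrite -val_eqE /= => /negPf ->; rewrite mul0r.
by rewrite /ps_mono; case: eqP => [->|]; rewrite ?ltnn ?mul0r.
Qed.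

(** By density of polynomials it is enough to evaluate a power of [w]. *)
Lemma ps_eval_comp h w z : (0 <= v z)%E -> nullseq h -> nullseq w ->
  seq_bound w 0 -> ps_eval (ps_comp h w) z = ps_eval h (ps_eval w z).
Proof.
move=> z0 nh nw w0.
have lL := bdd_linear_comp (ps_eval_linear z0) (ps_comp_op nw w0).
have lR := ps_eval_linear (ps_eval_int z0 nw w0).
apply: (bdd_linear_ext lL lR) nh => i /=.
by rewrite ps_comp_mono ps_eval_exp // ps_eval_mono.
Qed.

(** ** A Tate series is determined by its values *)

(** At a point of large valuation the lowest nonzero term of a series
    dominates all the others. *)
Lemma ps_eval_inj (q : E) f g : v q = 1%E -> nullseq f -> nullseq g ->
  (forall z, (0 <= v z)%E -> ps_eval f z = ps_eval g z) -> f = g.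
Proof.
move=> vq nf ng fg; pose h n := -1 * g n + f n.
have nh : nullseq h by apply: (nullseqD hv) => //; exact: (nullseqZ hv).
have h0 z : (0 <= v z)%E -> ps_eval h z = 0.
  by move=> z0; rewrite (ps_eval_linear z0).1 // fg // mulN1r addNr.
suff hn n : h n = 0.
  by apply: funext => n; have /eqP := hn n; rewrite /h mulN1r addrC subr_eq0 => /eqP.
elim/ltn_ind: n => n IH.
have [B hB] := nullseq_bdd hv nh.
apply: (vge_all0 hv) => r.
have [N Nr] := nat_bound (r - B).
have vqN k : v (q ^+ k) = k%:R%:E.
  elim: k => [|k IHk]; first by rewrite expr0 (val1 hv).
  by rewrite exprS (valM hv) vq IHk -EFinD -add1n natrD.
have z0 : (0 <= v (q ^+ N)%R)%E by rewrite vqN lee_fin ler0n.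
(* At [q ^ N] the term of index [n] has valuation [v (h n) + n N], the tail at least
   [B + (n + 1) N]; so [v (h n)] is at least [B + N]. *)
have := @vsum_tail _ _ v hv cE (fun k => h k * (q ^+ N) ^+ k) (B + (n.+1 * N)%N%:R) n.+1
  (ps_eval_null z0 nh).
rewrite -/(ps_eval h (q ^+ N)) h0 // sub0r big_ord_recr /= big1 ?add0r => [|i _]; last first.
  by rewrite IH ?mul0r.
have tail k : (n < k)%N ->
    ((B + (n.+1 * N)%:R)%R%:E <= v (h k * (q ^+ N) ^+ k)%R)%E.
  move=> nk; apply: (vgeM hv) => //.
  by rewrite -exprM vqN lee_fin ler_nat mulnC leq_mul2l nk orbT.
move=> /(_ tail); rewrite (valN hv) (valM hv) -exprM vqN.
case: (v (h n)) => [s| |]; [|by move=> _; rewrite leey|by []].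
rewrite -EFinD !lee_fin mulSn natrD mulnC => H.
by move: H Nr; lra.
Qed.

End TateSeries.

(** * Completeness of finite extensions *)

Section FiniteExtension.
Variables (R : realType) (K : fieldType) (E : fieldExtType K).
Variables (vK : K -> \bar R) (v : E -> \bar R).
Hypotheses (hvK : is_valuation vK) (hv : is_valuation v).
Hypothesis vA : forall x : K, v x%:A = vK x.
Hypothesis cK : vcomplete vK.

Lemma val_scale (x : K) (y : E) : v (x *: y) = (vK x + v y)%E.
Proof. by rewrite -mulr_algl (valM hv) vA. Qed.

(** Adjoin one vector [b] at a time. If the coordinates along [b] of a Cauchy
    sequence were not Cauchy, dividing differences of the sequence by
    differences of coordinates would exhibit [- b] as a limit of vectors of the
    smaller space, which is complete by induction. *)
Lemma span_complete (s : seq E) (u : nat -> E) :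
  (forall n, u n \in <<s>>%VS) -> vcauchy v u ->
  exists2 x, x \in <<s>>%VS & vcvg v u x.
Proof.
elim: s u => [|b s IH] u.
  rewrite span_nil => us _; exists 0; first exact: mem0v.
  move=> r; exists 0 => n _; have := us n; rewrite memv0 => /eqP->.
  by rewrite subr0; exact: (vge0 hv).
have [bs|bs] := boolP (b \in <<s>>%VS).
  suff -> : <<b :: s>>%VS = <<s>>%VS by exact: IH.
  by rewrite span_cons; apply/addv_idPr; rewrite -memvE.
rewrite span_cons => us cu.
have /choice[aw awP] n : exists aw : K * E, aw.2 \in <<s>>%VS /\ u n = aw.1 *: b + aw.2.
  have /memv_addP[y /vlineP[a ->] [w ws ->]] := us n.
  by exists (a, w).
pose a n := (aw n).1; pose w n := (aw n).2.
have ws n : w n \in <<s>>%VS by case: (awP n).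
have uE n : u n = a n *: b + w n by case: (awP n).
have [B bB] := vge_ex hv b.
have [ca|] := pselect (vcauchy vK a).
  have [al aal] := cK ca.
  have cw : vcauchy v w.
    move=> r; have [[N uN] [M aM]] := (cu r, ca (r - B)).
    exists (maxn N M) => i j; rewrite !geq_max => /andP[Ni Mi] /andP[Nj Mj].
    have -> : w i - w j = (u i - u j) - (a i - a j) *: b.
      by rewrite !uE scalerBl; ring.
    apply: (vgeB hv); first exact: uN.
    by rewrite val_scale -[r](subrK B) EFinD; apply: leeD => //; exact: aM.
  have [om oms wom] := IH w ws cw.
  exists (al *: b + om).
    by rewrite memv_add ?memv_line // memvZ ?memv_line.
  move=> r; have [[N wN] [M aM]] := (wom r, aal (r - B)).
  exists (maxn N M) => n; rewrite geq_max => /andP[Nn Mn].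
  have -> : u n - (al *: b + om) = (a n - al) *: b + (w n - om).
    by rewrite uE scalerBl; ring.
  apply: (vgeD hv); last exact: wN.
  by rewrite val_scale -[r](subrK B) EFinD; apply: leeD => //; exact: aM.
rewrite /vcauchy => /existsNP[r nr].
have /choice[ij ijP] N : exists ij : nat * nat,
    [/\ (N <= ij.1)%N, (N <= ij.2)%N & ~ (r%:E <= vK (a ij.1 - a ij.2))%E].
  have /forallNP/(_ N)/existsNP[i /existsNP[j /not_implyP[Ni /not_implyP[Nj H]]]] := nr.
  by exists (i, j).
pose c N := a (ij N).1 - a (ij N).2.
have cr N : (vK (c N) < r%:E)%E.
  by case: (ijP N) => _ _ /negP; rewrite -ltNge.
have c0 N : c N != 0.
  by apply/eqP => e; have := cr N; rewrite e (val0 hvK) ltNge leey.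
(* [w' N + b] is a difference of terms of [u] divided by [c N], which is bounded
   away from zero; so [w'] tends to [- b]. *)
pose w' N := (c N)^-1 *: (w (ij N).1 - w (ij N).2).
have w'b : vcvg v w' (- b).
  move=> t; have [N uN] := cu (t + r); exists N => n Nn; rewrite opprK.
  have -> : w' n + b = (c n)^-1 *: (u (ij n).1 - u (ij n).2).
    have -> : u (ij n).1 - u (ij n).2 = c n *: b + (w (ij n).1 - w (ij n).2).
      by rewrite !uE scalerBl; ring.
    by rewrite scalerDr scalerA mulVf // scale1r addrC.
  rewrite val_scale -[t](addrK r) addrC EFinD; apply: leeD.
    rewrite (valV hvK) // -(fineK (val_fin hvK (c0 n))) -EFinN lee_fin lerN2.
    by apply: ltW; rewrite -lte_fin (fineK (val_fin hvK (c0 n))).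
  by case: (ijP n) => i j _; apply: uN; apply: leq_trans Nn _.
have w's N : w' N \in <<s>>%VS by rewrite memvZ // memvB.
have [|y ys w'y] := IH w' w's.
  move=> t; have [N HN] := w'b t; exists N => i j Ni Nj.
  by apply: (vge_trans hv (HN i Ni)); apply: (vgeC hv); exact: HN.
by move: ys; rewrite (vcvg_uniq hv w'y w'b) memvN (negPf bs).
Qed.

(** [E] is complete for every valuation extending that of [K]: this is what makes
    the infinite sums over [E] converge. *)
Lemma ext_complete : vcomplete v.
Proof.
move=> u cu; have [|x _ ux] := @span_complete (vbasis {:E}) u _ cu; last by exists x.
by move=> n; rewrite (span_basis (vbasisP _)) memvf.
Qed.

Lemma vsumA (f : nat -> K) : nullseq vK f ->
  (vsum vK f)%:A = vsum v (fun n => (f n)%:A).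
Proof.
move=> nf; apply/esym/(vsum_uniq hv) => r; have [N fN] := vsum_cvg hvK cK nf r.
exists N => n /fN; rewrite -vA scalerBl scaler_suml.
by [].
Qed.

End FiniteExtension.

(** * The field of p-adic numbers *)

Section Padic.
Variables (R : realType) (p : nat) (K : padicField R p).
Hypothesis pr_p : prime p.
Local Notation v := (@padic_val R p K).
Implicit Types (x y a b k w : K) (r : R).

Let hv : is_valuation v := padic_valuation K.

Lemma padic_vcomplete : vcomplete v.
Proof. by move=> u; exact: padic_complete. Qed.

Lemma val_p : v p%:R = 1%E.
Proof. by rewrite padic_val_nat ?prime_gt0 // logn_prime // eqxx. Qed.

Lemma natf_neq0 n : (0 < n)%N -> (n%:R : K) != 0.
Proof.
move=> n0; apply/eqP => e; have := padic_val_nat K n0.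
by rewrite e (val0 hv).
Qed.

Lemma val_int (z : int) : (0 <= v z%:~R)%E.
Proof.
case: z => n; first exact: (vint_nat hv).
by rewrite NegzE mulrNz (valN hv); exact: (vint_nat hv).
Qed.

Lemma val_pX n : v (p%:R ^+ n) = n%:R%:E.
Proof.
elim: n => [|n IH]; first by rewrite expr0 (val1 hv).
by rewrite exprS (valM hv) val_p IH -EFinD -add1n natrD.
Qed.

Lemma val_dvdz (N : nat) (z : int) : ((p ^ N)%N%:Z %| z)%Z -> (N%:R%:E <= v z%:~R)%E.
Proof.
case/dvdzP => c ->; rewrite rmorphM /= (valM hv) -pmulrn natrX val_pX.
by rewrite -[X in (X <= _)%E]add0e; apply: leeD => //; exact: val_int.
Qed.

Lemma val_eqmod (N i j : nat) : i = j %[mod p ^ N] ->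
  (N%:R%:E <= v (i%:R - j%:R)%R)%E.
Proof.
wlog ji : i j / (j <= i)%N.
  move=> H; have [ji|ij] := leqP j i; first exact: H.
  by move=> e; apply: (vgeC hv); apply: H => //; exact: ltnW.
move/eqP; rewrite eqn_mod_dvd // => dv; rewrite -natrB //.
by rewrite [(i - j)%:R]pmulrn; apply: val_dvdz; rewrite /dvdz /=.
Qed.

Lemma val_nat_pos n : (1%:E <= v n%:R)%E -> (p %| n)%N.
Proof.
case: n => // n; rewrite padic_val_nat // lee_fin ler1n logn_gt0.
by rewrite mem_primes => /and3P[].
Qed.

Lemma val_eqmod1 (i j : nat) : (1%:E <= v (i%:R - j%:R)%R)%E -> i = j %[mod p].
Proof.
wlog ji : i j / (j <= i)%N.
  move=> H; have [ji|ij] := leqP j i; first exact: H.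
  by move/(vgeC hv) => e; apply/esym; apply: H => //; exact: ltnW.
by rewrite -natrB // => /val_nat_pos dv; apply/eqP; rewrite eqn_mod_dvd.
Qed.

Lemma val_coprime n : coprime n p -> v n%:R = 0%E.
Proof.
case: n => [|n] co.
  by move: (prime_gt1 pr_p); rewrite -(eqP co) gcd0n ltnn.
rewrite padic_val_nat //; have := logn_gt0 p n.+1.
rewrite mem_primes pr_p /= (_ : (p %| n.+1)%N = false); last first.
  by move: co; rewrite coprime_sym prime_coprime // => /negPf.
by rewrite lt0n => /negbFE/eqP->.
Qed.

(** [nat] is dense in the ring of integers: write an approximating fraction
    with denominator prime to [p] and invert the denominator modulo [p ^ N]. *)
Lemma nat_dense x (N : nat) : (0 <= v x)%E ->
  exists n : nat, (N%:R%:E <= v (x - n%:R)%R)%E.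
Proof.
move=> x0; have [q xq] := padic_dense x N%:R.
set y := padic_rat K q in xq.
have y0 : (0 <= v y)%E.
  rewrite -[y](subKr x); apply: (vgeB hv) => //.
  by apply: (vge_le _ xq); rewrite ler0n.
pose d := `|denq q|%N.
have d0 : (0 < d)%N by rewrite absz_gt0 denq_neq0.
have yd : y * d%:R = (numq q)%:~R.
  rewrite /y -(rmorph_int (padic_rat K)) -(rmorph_nat (padic_rat K)) -rmorphM.
  by congr (padic_rat K _); rewrite numqE -absz_denq.
have cod : coprime d p.
  rewrite coprime_sym prime_coprime //; apply/negP => pd.
  have pn : (p %| `|numq q|)%N.
    apply: val_nat_pos; have : (1%:E <= v (y * d%:R))%E.
      rewrite (valM hv) -[1%:E]add0e; apply: leeD => //.
      rewrite padic_val_nat // lee_fin ler1n logn_gt0 mem_primes pr_p d0.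
      by [].
    rewrite yd; case: (numq q) => n //=.
    by rewrite NegzE mulrNz (valN hv).
  have : (p %| gcdn `|numq q| d)%N by rewrite dvdn_gcd pn.
  by rewrite (eqP (coprime_num_den q)) dvdn1 => /eqP p1; move: pr_p; rewrite p1.
have codN : coprime d (p ^ N) by rewrite coprimeXr.
pose a := `|(numq q %% (p ^ N)%N%:Z)%Z|%N.
(* [X] is divisible by [d] and congruent to the numerator modulo [p ^ N]. *)
pose X := chinese d (p ^ N) 0 a.
have dX : (d %| X)%N by rewrite /dvdn /X (chinese_modl codN) mod0n.
exists (X %/ d)%N; apply: (vge_trans hv xq).
have vd : v d%:R = 0%E by exact: val_coprime.
have -> : v (y - (X %/ d)%N%:R) = v ((y - (X %/ d)%N%:R) * d%:R).
  by rewrite (valM hv) vd adde0.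
rewrite mulrBl yd -natrM divnK //.
apply: (vge_trans hv (y := a%:R)); last first.
  by apply: val_eqmod; rewrite /X (chinese_modr codN).
have pN0 : (p ^ N)%N%:Z != 0 by rewrite eqz_nat -lt0n expn_gt0 prime_gt0.
have -> : (a%:R : K) = ((numq q %% (p ^ N)%N)%Z)%:~R.
  by rewrite pmulrn /a gez0_abs ?modz_ge0.
rewrite -rmorphB /=; apply: val_dvdz.
by rewrite -eqz_mod_dvd modz_mod.
Qed.

(** Euler's theorem, applied to an integer congruent to [x] modulo [p ^ N]. *)
Lemma unit_Xtotient x N : v x = 0%E ->
  (N%:R%:E <= v (x ^+ totient (p ^ N) - 1)%R)%E.
Proof.
case: N => [|N] x0.
  by apply: (vgeB hv); rewrite ?(val1 hv) //; apply: (vintX hv); rewrite x0.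
have [|n xn] := @nat_dense x N.+1; first by rewrite x0.
have con : coprime n p.
  rewrite coprime_sym prime_coprime //; apply/negP => /dvdnP[c nc].
  have : (1%:E <= v x)%E.
    rewrite -[x](subrK n%:R); apply: (vgeD hv).
      by apply: (vge_le _ xn); rewrite ler1n.
    by rewrite nc natrM; apply: (vge_mull hv); [exact: (vint_nat hv) | rewrite val_p].
  by rewrite x0 lee_fin ler10.
apply: (vge_trans hv (y := n%:R ^+ totient (p ^ N.+1))); last first.
  rewrite -natrX; apply: (@val_eqmod N.+1 (n ^ totient (p ^ N.+1)) 1).
  by apply: Euler_exp_totient; rewrite coprimeXr.
rewrite subrXX; apply: (vge_mulr hv) => //; apply: (vge_sum hv) => i _.
rewrite -[0]addr0; apply: (vgeM hv); last exact/(vintX hv)/(vint_nat hv).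
by apply: (vintX hv); rewrite x0.
Qed.

(** ** The Teichmüller character *)

Local Notation q := (teich_modulus p).
Local Notation e := (totient q).

(** In the definitions [4] and [2] are numerals of the ring [nat]; these forms
    are convertible and can be rewritten. *)
Lemma teich_modulusE : q = if p == 2%N then 4%N else p.
Proof. by []. Qed.

Lemma min_levelE : min_level p = if p == 2%N then 2%N else 1%N.
Proof. by []. Qed.

Lemma val_teich_modulus : v q%:R = (min_level p)%:R%:E.
Proof.
rewrite teich_modulusE min_levelE; case: eqP => [p2|_]; last exact: val_p.
have -> : 4%N = (p ^ 2)%N by rewrite p2.
by rewrite natrX val_pX.
Qed.

Lemma min_level_gt0 : (0 < min_level p)%N.
Proof. by rewrite min_levelE; case: ifP. Qed.

Lemma val_totient : (v e%:R < (min_level p)%:R%:E)%E.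
Proof.
rewrite teich_modulusE min_levelE; case: eqP => [p2|_].
  have -> : totient 4 = p by rewrite p2.
  by rewrite val_p lte_fin ltr1n.
rewrite totient_prime // val_coprime ?lte_fin ?ltr01 //.
by rewrite coprime_sym -[X in coprime X _](prednK (prime_gt0 pr_p)) coprimeSn.
Qed.

Lemma totient_q_gt0 : (0 < e)%N.
Proof.
rewrite totient_gt0 teich_modulusE; case: ifP => // _; exact: prime_gt0.
Qed.

(** In the factorization of [w ^+ e - w' ^+ e = 0] the cofactor of [w - w'] is
    congruent to [e w' ^+ (e - 1)] modulo [q], hence is nonzero, because [e] has
    smaller valuation than [q]: [0 < 1] for odd [p], and [1 < 2] for [p = 2]. *)
Lemma teich_uniq w w' : w ^+ e = 1 -> w' ^+ e = 1 ->
  (v q%:R <= v (w - w')%R)%E -> w = w'.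
Proof.
move=> we w'e; rewrite val_teich_modulus => ww'.
have [w0 w'0] := (val_root_unity hv totient_q_gt0 we, val_root_unity hv totient_q_gt0 w'e).
have := subrXX w w' e; rewrite we w'e subrr => /esym/eqP; rewrite mulf_eq0.
case/orP; first by rewrite subr_eq0 => /eqP.
set s := \sum_(i < e) _ => /eqP s0.
have : ((min_level p)%:R%:E <= v (s - e%:R * w' ^+ e.-1))%E.
  have -> : e%:R * w' ^+ e.-1 = \sum_(i < e) w' ^+ (e.-1 - i) * w' ^+ i.
    rewrite (eq_bigr (fun=> w' ^+ e.-1)) => [|i _].
      by rewrite sumr_const card_ord mulr_natl.
    by rewrite -exprD subnK // -ltnS (ltn_predK totient_q_gt0).
  rewrite /s -sumrB; apply: (vge_sum hv) => i _; rewrite -mulrBl.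
  apply: (vge_mulr hv); last by apply: (vintX hv); rewrite w'0.
  rewrite subrXX; apply: (vge_mulr hv) => //; apply: (vge_sum hv) => j _.
  by rewrite -[0]addr0; apply: (vgeM hv); apply: (vintX hv); rewrite ?w0 ?w'0.
rewrite s0 sub0r (valN hv) (valM hv) leNgt => /negP[].
suff -> : v (w' ^+ e.-1) = 0%E by rewrite adde0; exact: val_totient.
apply: (val_root_unity hv totient_q_gt0).
by rewrite -exprM mulnC exprM w'e expr1n.
Qed.

(** For odd [p] the root of unity is the limit of the [a ^+ (p ^ n)], a Cauchy
    sequence by Euler's theorem; for [p = 2] it is a sign. *)
Lemma teich_exists a : v a = 0%E ->
  exists w, w ^+ e = 1 /\ (v q%:R <= v (w - a)%R)%E.
Proof.
move=> a0; rewrite val_teich_modulus.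
have [p2|p2] := eqVneq p 2.
  have -> : e = 2%N by rewrite p2.
  have -> : min_level p = 2%N by rewrite p2.
  have [|n an] := @nat_dense a 2; first by rewrite a0.
  have odn : odd n.
    rewrite -[odd n]negbK -dvdn2; apply/negP => pn.
    have : (1%:E <= v a)%E.
      rewrite -[a](subrK n%:R); apply: (vgeD hv); first by apply: (vge_le _ an); rewrite ler1n.
      case/dvdnP: pn => c ->; rewrite -[2%N]p2 natrM.
      by apply: (vge_mull hv); [exact: (vint_nat hv) | rewrite val_p].
    by rewrite a0 lee_fin ler10.
  have n4 : n = 1 %[mod p ^ 2] \/ n = 3 %[mod p ^ 2].
    by rewrite p2 -[(2 ^ 2)%N]/4%N; lia.
  have v4 : (2%:R%:E <= v 4%:R)%E.
    have -> : 4%N = (p ^ 2)%N by rewrite p2.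
    by rewrite natrX val_pX.
  case: n4 => /val_eqmod n4; [exists 1 | exists (-1)]; rewrite ?sqrrN ?expr1n; split=> //;
    apply: (vgeC hv); apply: (vge_trans hv an); first exact: n4.
  apply: (vge_trans hv n4); rewrite opprK.
  by rewrite -[3%:R + 1]/(3%:R + 1%:R) -natrD.
pose u n := a ^+ (p ^ n).
have pn n : (p ^ n * p.-1)%N = totient (p ^ n.+1).
  by rewrite totient_pfactor //= mulnC.
have uS n : (n.+1%:R%:E <= v (u n.+1 - u n)%R)%E.
  have -> : u n.+1 - u n = u n * (a ^+ totient (p ^ n.+1) - 1).
    rewrite mulrBr mulr1 /u -exprD -pn; congr (a ^+ _ - _).
    by rewrite -[X in (X + _)%N]muln1 -mulnDr add1n prednK ?prime_gt0 // expnSr.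
  by apply: (vge_mull hv); [apply: (vintX hv); rewrite a0 | exact: unit_Xtotient].
have uD n d : (n.+1%:R%:E <= v (u (n + d)%N - u n)%R)%E.
  elim: d => [|d IH]; first by rewrite addn0 subrr; exact: (vge0 hv).
  apply: (vge_trans hv _ IH); rewrite addnS; apply: (vge_le _ (uS _)).
  by rewrite ler_nat ltnS leq_addr.
have cu : vcauchy v u.
  move=> r; have [N rN] := nat_bound (r).
  have uN i : (N <= i)%N -> (r%:E <= v (u i - u N)%R)%E.
    move/subnKC => <-; apply: (vge_le _ (uD _ _)).
    by apply: le_trans rN _; rewrite ler_nat.
  by exists N => i j /uN iN /uN jN; apply: (vge_trans hv iN); exact: (vgeC hv).
have [w uw] := padic_complete cu.
have u0 n : (0 <= v (u n))%E by apply: (vintX hv); rewrite a0.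
have w0 : (0 <= v w)%E by apply: (vcvg_ge hv uw).
have qp : q = p by rewrite teich_modulusE (negPf p2).
exists w; rewrite min_levelE (negPf p2) qp totient_prime //; split.
  apply: (vge_all_eq hv) => r.
  have [N uN] := uw r.
  have [M rM] := nat_bound (r).
  set n := maxn N M; apply: (vge_trans hv (y := u n ^+ p.-1)).
    apply: (vgeC hv); rewrite subrXX; apply: (vge_mulr hv).
      by apply: uN; rewrite leq_maxl.
    by apply: (vge_sum hv) => i _; rewrite -[0]addr0; apply: (vgeM hv); exact: (vintX hv).
  rewrite /u -exprM pn; apply: (vge_le _ (unit_Xtotient _ a0)).
  by apply: le_trans rM _; rewrite ler_nat leqW // leq_maxr.
have [N uN] := uw 1; apply: (vge_trans hv (y := u N)).
  by apply: (vgeC hv); exact: uN.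
by have := uD 0 N; rewrite {2}/u expn0 expr1.
Qed.

Lemma teichP a : v a = 0%E ->
  teichmuller a ^+ e = 1 /\ (v q%:R <= v (teichmuller a - a)%R)%E.
Proof.
move=> a0; rewrite /teichmuller; case: xgetP => [w -> //|H].
by have [w /H] := teich_exists a0.
Qed.

Lemma teichE a w : v a = 0%E -> w ^+ e = 1 -> (v q%:R <= v (w - a)%R)%E ->
  teichmuller a = w.
Proof.
move=> a0 we wa; have [te ta] := teichP a0; apply: teich_uniq => //.
move: wa ta; rewrite val_teich_modulus => wa ta.
by apply: (vge_trans hv ta); exact: (vgeC hv).
Qed.

Lemma val_teich a : v a = 0%E -> v (teichmuller a) = 0%E.
Proof. by move=> /teichP[te _]; exact: (val_root_unity hv totient_q_gt0 te). Qed.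

Lemma unit_neq0 a : v a = 0%E -> a != 0.
Proof. by move=> a0; apply/eqP => e; move: a0; rewrite e (val0 hv). Qed.

Lemma one_unit_partP a : v a = 0%E -> (1%:E <= v (one_unit_part a - 1)%R)%E.
Proof.
move=> a0; have [_] := teichP a0; rewrite val_teich_modulus => ta.
have t0 := unit_neq0 (val_teich a0).
have -> : one_unit_part a - 1 = (a - teichmuller a) / teichmuller a.
  by rewrite /one_unit_part mulrBl divff.
rewrite (valM hv) (valV hv) // val_teich // oppe0 adde0; apply: (vgeC hv).
by apply: (vge_le _ ta); rewrite ler1n min_level_gt0.
Qed.

Lemma one_unit_partM a b : v a = 0%E -> v b = 0%E ->
  one_unit_part (a * b) = one_unit_part a * one_unit_part b.
Proof.
move=> a0 b0; rewrite /one_unit_part (@teichE _ (teichmuller a * teichmuller b)).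
- by rewrite invfM mulrACA.
- by rewrite (valM hv) a0 b0 adde0.
- by have [[ta _] [tb _]] := (teichP a0, teichP b0); rewrite exprMn ta tb mulr1.
have [[_ ta] [_ tb]] := (teichP a0, teichP b0).
move: ta tb; rewrite val_teich_modulus => ta tb.
apply: (vge_trans hv (y := teichmuller a * b)).
  by rewrite -mulrBr; apply: (vge_mull hv) => //; rewrite val_teich.
by rewrite -mulrBl; apply: (vge_mulr hv) => //; rewrite b0.
Qed.

(** The Teichmüller representative depends only on the residue modulo [p], or
    [4] when [p = 2]. *)
Lemma one_unit_partM1 a x : v a = 0%E -> ((min_level p)%:R%:E <= v x)%E ->
  one_unit_part (a * (1 + x)) = one_unit_part a * (1 + x).
Proof.
move=> a0 x1; rewrite /one_unit_part (@teichE (a * (1 + x)) (teichmuller a)).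
- by rewrite mulrAC.
- rewrite (valM hv) a0 add0e; apply: (vunitD hv _ (val1 hv) x1).
  by rewrite ltr0n min_level_gt0.
- by have [] := teichP a0.
have [_ ta] := teichP a0; move: ta; rewrite val_teich_modulus => ta.
apply: (vge_trans hv ta); rewrite mulrDr mulr1 opprD addNKr (valN hv).
by apply: (vge_mull hv) => //; rewrite a0.
Qed.

(** ** Binomial coefficients *)

Lemma prod_ffact (j n : nat) : \prod_(i < n) (j%:R - i%:R : K) = (j ^_ n)%:R.
Proof.
elim: n => [|n IH]; first by rewrite big_ord0 ffactn0.
rewrite big_ord_recr IH ffactnSr natrM /=; have [nj|jn] := leqP n j.
  by rewrite natrB.
by rewrite ffact_small // !mul0r.
Qed.

Lemma gbinomial_nat (j n : nat) : gbinomial (j%:R : K) n = 'C(j, n)%:R.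
Proof.
have n0 : (n`!%:R : K) != 0 by apply: natf_neq0; exact: fact_gt0.
by rewrite /gbinomial prod_ffact -bin_ffact natrM mulfK.
Qed.

(** Polynomials are continuous, and in bounded degree the denominators [n!] cost only
    a bounded loss of precision. *)
Lemma gbinomial_approx k (N : nat) r : (0 <= v k)%E ->
  exists j : nat, forall n, (n < N)%N -> (r%:E <= v (gbinomial k n - 'C(j, n)%:R)%R)%E.
Proof.
move=> k0; pose C := logn p N`!.
have [M rM] := nat_bound (r + C%:R).
have [j kj] := nat_dense M k0; exists j => n nN.
have n0 : (n`!%:R : K) != 0 by apply: natf_neq0; exact: fact_gt0.
rewrite -gbinomial_nat /gbinomial -mulrBl.
have -> : r = (r + C%:R) - C%:R by rewrite addrK.
apply: (vgeM hv); last first.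
  rewrite (valV hv) // padic_val_nat ?fact_gt0 // -EFinN lee_fin lerN2 ler_nat.
  apply: dvdn_leq_log; rewrite ?fact_gt0 //.
  rewrite -(subnKC (ltnW nN)); elim: (N - n)%N => [|d]; first by rewrite addn0.
  by rewrite addnS factS => /dvdn_trans; apply; exact: dvdn_mull.
have ki a (i : nat) : (0 <= v a)%E -> (0 <= v (a - i%:R)%R)%E.
  by move=> a0; apply: (vgeB hv) => //; exact: (vint_nat hv).
suff [//] : ((r + C%:R)%R%:E <= v (\prod_(i < n) (k - i%:R) - \prod_(i < n) (j%:R - i%:R))%R)%E
  /\ (0 <= v (\prod_(i < n) (k - i%:R))%R)%E.
elim: (n) => [|i [IH1 IH2]].
  by rewrite !big_ord0 subrr (val1 hv); split; [exact: (vge0 hv)|].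
rewrite !big_ord_recr /=; split; last first.
  by rewrite -[0]addr0; apply: (vgeM hv) => //; exact: ki.
apply: (vge_trans hv (y := \prod_(l < i) (k - l%:R) * (j%:R - i%:R))).
  rewrite -mulrBr; apply: (vge_mull hv) => //.
  by apply: (vge_le rM); rewrite opprB addrA addrNK.
rewrite -mulrBl; apply: (vge_mulr hv) => //; apply: ki; exact: (vint_nat hv).
Qed.

(** By continuity from the integrality of the ordinary binomial coefficients. *)
Lemma gbinomial_int k n : (0 <= v k)%E -> (0 <= v (gbinomial k n))%E.
Proof.
move=> k0; have [j kj] := gbinomial_approx n.+1 0 k0.
rewrite -[gbinomial k n](subrK 'C(j, n)%:R); apply: (vgeD hv).
  exact: kj.
exact: (vint_nat hv).
Qed.

End Padic.

(** * The weight-[k] action on Tate series *)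

Section MobiusAlgebra.
Variables (F : fieldType) (a b c d a' b' c' d' z : F).
Local Notation z' := ((a' * z + b') / (c' * z + d')).

(** Composition of Möbius maps, with the denominators that will be known to be
    nonzero. *)
Lemma mobius_mul : c' * z + d' != 0 ->
  ((a * a' + b * c') * z + (a * b' + b * d')) /
    ((c * a' + d * c') * z + (c * b' + d * d')) = (a * z' + b) / (c * z' + d).
Proof.
move=> e0; have -> : (a * a' + b * c') * z + (a * b' + b * d') =
  (a * z' + b) * (c' * z + d') by field.
have -> : (c * a' + d * c') * z + (c * b' + d * d') = (c * z' + d) * (c' * z + d').
  by field.
by rewrite -mulf_div divff // mulr1.
Qed.

(** The cocycle relation for [c z + d], divided by [d d']: the first factor on the
    left is the ratio of the [d]-entry of the product to [d d']. *)
Lemma aut_factor_mul : c' * z + d' != 0 -> d != 0 -> d' != 0 ->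
  c * b' + d * d' != 0 ->
  (1 + c * b' / (d * d')) * (1 + (c * a' + d * c') / (c * b' + d * d') * z) =
  (1 + c' / d' * z) * (1 + c / d * z').
Proof. by move=> e0 d0 d'0 dd0; field; rewrite d0 d'0 dd0 e0. Qed.

End MobiusAlgebra.

Section Slash.
Variables (R : realType) (p : nat) (K : padicField R p) (E : fieldExtType K).
Variable v : E -> \bar R.
Hypothesis pr_p : prime p.
Hypothesis hv : is_valuation v.
Hypothesis hvp : forall x : K, v x%:A = padic_val x.
Variables (psi : K -> E) (m : nat).
Hypothesis hpsi : finite_character psi.
Hypothesis hcond : has_conductor psi m.
Variable k : K.
Hypothesis hk : (0 <= padic_val k)%E.
Implicit Types (r : R) (x y z : E) (a b c d : K) (M N : 'M[K]_2) (h f g : nat -> E).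

Local Notation vK := (@padic_val R p K).
Let hvK : is_valuation vK := padic_valuation K.
Let cE : vcomplete v := ext_complete hvK hv hvp (@padic_vcomplete R p K).

Lemma algD a b : ((a + b)%:A : E) = a%:A + b%:A. Proof. exact: scalerDl. Qed.
Lemma algN a : ((- a)%:A : E) = - a%:A. Proof. exact: scaleNr. Qed.
Lemma algB a b : ((a - b)%:A : E) = a%:A - b%:A. Proof. exact: scalerBl. Qed.
Lemma algM a b : ((a * b)%:A : E) = a%:A * b%:A.
Proof. exact: (rmorphM (GRing.in_alg E)). Qed.
Lemma algX a n : ((a ^+ n)%:A : E) = a%:A ^+ n.
Proof. exact: (rmorphXn (GRing.in_alg E)). Qed.
Lemma algV a : ((a^-1)%:A : E) = (a%:A)^-1.
Proof. exact: (fmorphV (GRing.in_alg E)). Qed.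
Lemma alg1 : ((1 : K)%:A : E) = 1. Proof. exact: scale1r. Qed.
Lemma alg0 : ((0 : K)%:A : E) = 0. Proof. exact: scale0r. Qed.
Lemma alg_nat n : ((n%:R : K)%:A : E) = n%:R.
Proof. exact: (rmorph_nat (GRing.in_alg E)). Qed.
Definition algE := (algD, algN, algM, algX, algV, alg1, alg0, alg_nat).

Lemma val_algB1 a : v (a%:A - 1) = vK (a - 1).
Proof. by rewrite -hvp algB alg1. Qed.

Lemma m_gt0 : (0 < m)%N.
Proof. by case: hcond => mm _ _; apply: leq_trans mm; exact: min_level_gt0. Qed.

Lemma vge_level1 c : (m%:R%:E <= vK c)%E -> (1%:E <= vK c)%E.
Proof. by apply: (vge_le _); rewrite ler1n m_gt0. Qed.

(** ** Powers of one-units *)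

Definition upow x : E := vsum v (fun n => (gbinomial k n)%:A * (x - 1) ^+ n).

Lemma pow_null y : (1%:E <= v y)%E -> nullseq v (fun n => y ^+ n).
Proof.
move=> y1 r; have [N rN] := nat_bound (r).
exists N => n Nn; have := vgeX hv n y1; rewrite mulr1; apply: vge_le.
by apply: le_trans rN _; rewrite ler_nat.
Qed.

Lemma upow_terms x : (1%:E <= v (x - 1)%R)%E ->
  nullseq v (fun n => (gbinomial k n)%:A * (x - 1) ^+ n).
Proof.
move=> x1 r; have [N xN] := pow_null x1 r; exists N => n /xN xn.
by apply: (vge_mull hv) => //; rewrite hvp; exact: gbinomial_int.
Qed.

(** On one-units [x ^ k] is a uniform limit of powers with natural exponents;
    the identities below are inherited from those. *)
Lemma upow_approx r : exists j : nat, forall x, (1%:E <= v (x - 1)%R)%E ->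
  (r%:E <= v (upow x - x ^+ j)%R)%E.
Proof.
have [N rN] := nat_bound (r).
have [j kj] := gbinomial_approx pr_p N r hk; exists j => x x1.
have nj : nullseq v (fun n => 'C(j, n)%:R * (x - 1) ^+ n).
  by apply: (nullseq_fin hv (N := j.+1)) => n jn; rewrite bin_small // mul0r.
have -> : x ^+ j = vsum v (fun n => 'C(j, n)%:R * (x - 1) ^+ n).
  rewrite (vsum_fin hv (N := j.+1)) => [|n jn]; last by rewrite bin_small // mul0r.
  rewrite -{1}[x](subrK 1) addrC exprDn; apply: eq_bigr => i _.
  by rewrite expr1n mul1r mulr_natl.
rewrite /upow -(vsumB hv cE) //; last exact: upow_terms.
apply: (vsum_ge hv cE) => [|n].
  by apply: (nullseqB hv) => //; exact: upow_terms.
rewrite -mulrBl; have [Nn|nN] := leqP N n.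
  apply: (vge_mull hv).
    apply: (vgeB hv); last exact: (vint_nat hv).
    by rewrite hvp; exact: gbinomial_int.
  have := vgeX hv n x1; rewrite mulr1; apply: vge_le.
  by apply: le_trans rN _; rewrite ler_nat.
apply: (vge_mulr hv).
  by rewrite -(alg_nat 'C(j, n)) -algB hvp; exact: kj.
apply: (vintX hv); apply: (vge_le _ x1); exact: ler01.
Qed.

Lemma one_unitM x y : (1%:E <= v (x - 1)%R)%E -> (1%:E <= v (y - 1)%R)%E ->
  (1%:E <= v (x * y - 1)%R)%E.
Proof.
move=> x1 y1; have -> : x * y - 1 = x * (y - 1) + (x - 1) by ring.
apply: (vgeD hv) => //; apply: (vge_mull hv) => //.
rewrite -[x](subrK 1); apply: (vgeD hv); last by rewrite (val1 hv).
by apply: (vge_le _ x1); exact: ler01.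
Qed.

Lemma one_unit_int x : (1%:E <= v (x - 1)%R)%E -> (0 <= v x)%E.
Proof.
move=> x1; rewrite -[x](subrK 1); apply: (vgeD hv); last by rewrite (val1 hv).
by apply: (vge_le _ x1); exact: ler01.
Qed.

Lemma upow_int x : (1%:E <= v (x - 1)%R)%E -> (0 <= v (upow x))%E.
Proof.
move=> x1; have [j xj] := upow_approx 0; rewrite -[upow x](subrK (x ^+ j)).
by apply: (vgeD hv); [exact: xj | apply: (vintX hv); exact: one_unit_int].
Qed.

Lemma upow1 : upow 1 = 1.
Proof.
apply: (vge_all_eq hv) => r; have [j /(_ 1)] := upow_approx r.
by rewrite expr1n; apply; rewrite subrr; exact: (vge0 hv).
Qed.

Lemma upowM x y : (1%:E <= v (x - 1)%R)%E -> (1%:E <= v (y - 1)%R)%E ->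
  upow (x * y) = upow x * upow y.
Proof.
move=> x1 y1; apply: (vge_all_eq hv) => r; have [j H] := upow_approx r.
apply: (vge_trans hv (H _ (one_unitM x1 y1))); rewrite exprMn.
apply: (vge_trans hv (y := x ^+ j * upow y)); apply: (vgeC hv).
  rewrite -mulrBr; apply: (vge_mull hv); last exact: H.
  by apply: (vintX hv); exact: one_unit_int.
by rewrite -mulrBl; apply: (vge_mulr hv); [exact: H | exact: upow_int].
Qed.

Lemma unit_powerA a : (1%:E <= vK (a - 1)%R)%E -> (unit_power a k)%:A = upow a%:A.
Proof.
move=> a1; rewrite /unit_power (vsumA hvK hv hvp (@padic_vcomplete R p K)).
  by congr vsum; apply: funext => n; rewrite algM algX algB alg1.
move=> r; have := @upow_terms a%:A; rewrite val_algB1 => /(_ a1 r)[N aN].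
by exists N => n /aN; rewrite -hvp algM algX algB alg1.
Qed.

(** ** The character [d |-> psi(d) <d>^k] *)

(** The values of [psi] at units are roots of unity, since [psi] factors through
    the finite group of units modulo [p ^ m]. *)
Lemma psi_int d : vK d = 0%E -> (0 <= v (psi d))%E.
Proof.
move=> d0; case: hpsi => psi1 psiM _; case: hcond => _ fac _.
have psiX n : vK (d ^+ n) = 0%E /\ psi (d ^+ n) = psi d ^+ n.
  elim: n => [|n [v0 IH]]; first by rewrite (val1 hvK).
  by rewrite exprS (valM hvK) d0 v0 adde0 psiM // IH exprS.
have t0 : (0 < totient (p ^ m))%N by rewrite totient_gt0 expn_gt0 prime_gt0.
have : psi d ^+ totient (p ^ m) = 1.
  rewrite -(psiX _).2 (fac _ 1) //; first by case: (psiX (totient (p ^ m))).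
    exact: (val1 hvK).
  exact: unit_Xtotient.
by move=> /(val_root_unity hv t0) ->.
Qed.

Definition kappa d : E := psi d * (unit_power (one_unit_part d) k)%:A.

Lemma kappaE d : vK d = 0%E -> kappa d = psi d * upow (one_unit_part d)%:A.
Proof. by move=> d0; rewrite /kappa unit_powerA //; exact: one_unit_partP. Qed.

Lemma one_unitA d : vK d = 0%E -> (1%:E <= v ((one_unit_part d)%:A - 1)%R)%E.
Proof. by move=> d0; rewrite val_algB1; exact: one_unit_partP. Qed.

Lemma kappa_int d : vK d = 0%E -> (0 <= v (kappa d))%E.
Proof.
move=> d0; rewrite kappaE // -[0]addr0; apply: (vgeM hv); first exact: psi_int.
by apply: upow_int; exact: one_unitA.
Qed.

(** The form in which multiplicativity of the weight enters the cocycle relation: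
    for a product of matrices the new [d] is [d d' (1 + a)] with [a] divisible
    by [p ^ m], which is invisible to [psi] because of its conductor and to the
    Teichmüller character. *)
Lemma kappaM d d' a : vK d = 0%E -> vK d' = 0%E -> (m%:R%:E <= vK a)%E ->
  kappa (d * d' * (1 + a)) = kappa d * kappa d' * upow (1 + a%:A).
Proof.
move=> d0 d'0 am; case: hpsi => psi1 psiM _; case: hcond => mm fac _.
have a1 := vge_level1 am.
have dd0 : vK (d * d') = 0%E by rewrite (valM hvK) d0 d'0 adde0.
have u0 : vK (1 + a) = 0%E by exact: (vunitD hvK ltr01 (val1 hvK) a1).
have dda : vK (d * d' * (1 + a)) = 0%E by rewrite (valM hvK) dd0 u0 adde0.
rewrite !kappaE // one_unit_partM1 //; last first.
  by apply: (vge_le _ am); rewrite ler_nat.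
rewrite one_unit_partM // (fac _ (d * d')) //; last first.
  rewrite mulrDr mulr1 addrAC subrr add0r.
  by apply: (vge_mull hvK) => //; rewrite dd0.
have u1 : (1%:E <= v (1 + a%:A - 1)%R)%E by rewrite addrAC subrr add0r hvp.
have [du d'u] := (one_unitA d0, one_unitA d'0).
rewrite psiM // (algM (_ * _)) (algM (one_unit_part d)) algD alg1.
by rewrite !upowM ?one_unitM //; ring.
Qed.

(** ** The monoid acting on Tate series *)

(** This contains the level group at [p] and the matrices defining [U_p]. *)
Definition Sigma0 M := [/\ (0 <= vK (M 0%R 0%R))%E, (0 <= vK (M 0%R 1%R))%E,
  (m%:R%:E <= vK (M 1%R 0%R))%E & vK (M 1 1) = 0%E].

Lemma mx2M M N i j : (M * N) i j = M i 0 * N 0 j + M i 1 * N 1 j.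
Proof.
have e1 : lift ord0 ord0 = 1 :> 'I_2 by apply: val_inj.
by rewrite mxE big_ord_recl big_ord1 e1.
Qed.

Lemma Sigma0M M N : Sigma0 M -> Sigma0 N -> Sigma0 (M * N).
Proof.
move=> [a0 b0 cm d0] [a'0 b'0 c'm d'0]; rewrite /Sigma0 !mx2M.
have d0' : (0 <= vK (M 1%R 1%R))%E by rewrite d0.
have d'0' : (0 <= vK (N 1%R 1%R))%E by rewrite d'0.
have c0 : (0 <= vK (M 1%R 0%R))%E by apply: (vge_le _ cm); exact: ler0n.
have c'0 : (0 <= vK (N 1%R 0%R))%E by apply: (vge_le _ c'm); exact: ler0n.
split.
- by apply: (vgeD hvK); apply: (vge_mull hvK).
- by apply: (vgeD hvK); apply: (vge_mull hvK).
- by apply: (vgeD hvK); [apply: (vge_mulr hvK) | apply: (vge_mull hvK)].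
rewrite addrC; apply: (vunitD hvK ltr01).
  by rewrite (valM hvK) d0 d'0 adde0.
by apply: (vge_mulr hvK) => //; exact: vge_level1.
Qed.

Lemma Sigma0_1 : Sigma0 1.
Proof. by rewrite /Sigma0 !mxE /= (val1 hvK) (val0 hvK); split; rewrite ?leey. Qed.

(** The coefficients of [slash] come from [K]; these are their images in [E],
    where all series are summed. *)
Definition mobiusA M : nat -> E := fun n => (mobius M n)%:A.
Definition autA M : nat -> E := fun n => (aut_factor k M n)%:A.
Definition geomA M : nat -> E := fun n => ((- M 1 0) ^+ n / M 1 1 ^+ n.+1)%:A.
Definition numA M : nat -> E := fun n => ([:: M 0 1; M 0 0]`_n)%:A.

Lemma alg_ps_mul (f g : nat -> K) n :
  (ps_mul f g n)%:A = ps_mul (fun i => (f i)%:A) (fun i => (g i)%:A) n :> E.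
Proof. by rewrite /ps_mul scaler_suml; apply: eq_bigr => i _; rewrite algM. Qed.

Lemma alg_ps_exp (w : nat -> K) i n :
  (ps_exp w i n)%:A = ps_exp (fun j => (w j)%:A) i n :> E.
Proof.
elim: i n => [|i IH] n; first by rewrite /ps_exp /= /ps_one alg_nat.
rewrite /ps_exp !iterS alg_ps_mul; congr (ps_mul _ _ n).
by apply: funext => j; rewrite -/(ps_exp w i) IH.
Qed.

Lemma mobiusA_mul M : mobiusA M = ps_mul (numA M) (geomA M).
Proof. by apply: funext => n; rewrite /mobiusA /mobius alg_ps_mul. Qed.

Lemma slashE h M n : slash v psi k h M n =
  kappa (M 1 1) * ps_mul (autA M) (ps_comp v h (mobiusA M)) n.
Proof.
rewrite /slash; congr (_ * ps_mul _ _ _); apply: funext => i.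
rewrite /ps_subst /ps_comp; congr vsum; apply: funext => j.
by rewrite alg_ps_exp.
Qed.

Lemma slope_bound_le s s' f r : s <= s' -> slope_bound v s' f r -> slope_bound v s f r.
Proof.
move=> ss f1 n; apply: (vge_le _ (f1 n)).
by rewrite lerD2l ler_wpM2l.
Qed.

Lemma slope1_null f r : slope_bound v 1 f r -> nullseq v f.
Proof.
move=> f1 s; have [N sN] := nat_bound (s - r).
exists N => n Nn; apply: (vge_le _ (f1 n)); rewrite mulr1 -lerBlDl.
by apply: le_trans sN _; rewrite ler_nat.
Qed.

Section Action.
Variable M : 'M[K]_2.
Hypothesis SM : Sigma0 M.
Local Notation a := ((M 0 0)%:A : E).
Local Notation b := ((M 0 1)%:A : E).
Local Notation c := ((M 1 0)%:A : E).
Local Notation d := ((M 1 1)%:A : E).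

Let vd : v d = 0%E. Proof. by rewrite hvp; case: SM. Qed.
Let vc : (1%:E <= v c)%E.
Proof. by rewrite hvp; apply: vge_level1; case: SM. Qed.

Lemma Sigma0_d_neq0 : d != 0.
Proof. by apply/eqP => e; have := vd; rewrite e (val0 hv). Qed.

Lemma Sigma0_cd : (1%:E <= v (c / d)%R)%E.
Proof. by rewrite (valM hv) (valV hv) ?Sigma0_d_neq0 // vd oppe0 adde0. Qed.

Lemma Sigma0_den z : (0 <= v z)%E -> v (c * z + d) = 0%E.
Proof.
move=> z0; rewrite addrC; apply: (vunitD hv ltr01) => //.
exact: (vge_mulr hv).
Qed.

Lemma Sigma0_den_neq0 z : (0 <= v z)%E -> c * z + d != 0.
Proof. by move=> z0; apply/eqP => e; have := Sigma0_den z0; rewrite e (val0 hv). Qed.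

Lemma Sigma0_aut z : (0 <= v z)%E -> (1%:E <= v ((1 + c / d * z) - 1)%R)%E.
Proof.
by move=> z0; rewrite addrC addKr; apply: (vge_mulr hv) => //; exact: Sigma0_cd.
Qed.

Lemma geomA_slope : slope_bound v 1 (geomA M) 0.
Proof.
move=> n; rewrite /geomA !algE add0r mulr1 exprSr invfM mulrA -exprVn.
rewrite -exprMn -[n%:R]addr0; apply: (vgeM hv).
  have -> : n%:R = n%:R * 1 :> R by rewrite mulr1.
  by apply: (vgeX hv); rewrite mulNr (valN hv); exact: Sigma0_cd.
by rewrite (valV hv) ?Sigma0_d_neq0 // vd oppe0.
Qed.

Lemma numA_bound : slope_bound v 0 (numA M) 0.
Proof.
move=> n; rewrite mulr0 add0r /numA hvp; case: SM => a0 b0 _ _.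
by case: n => [|[|n]] //=; rewrite nth_nil; exact: (vge0 hvK).
Qed.

Lemma numA_null : nullseq v (numA M).
Proof.
apply: (nullseq_fin hv (N := 2)) => -[|[|n]] // _.
by rewrite /numA /= nth_nil alg0.
Qed.

Lemma mobiusA_null : nullseq v (mobiusA M).
Proof.
rewrite mobiusA_mul; apply: (ps_mul_null hv) numA_null _.
exact: slope1_null geomA_slope.
Qed.

Lemma mobiusA_bound : seq_bound v (mobiusA M) 0.
Proof.
apply/slope_bound0; rewrite mobiusA_mul -[X in slope_bound _ _ _ X]addr0.
apply: (slope_bound_mul hv) numA_bound _.
exact: slope_bound_le ler01 geomA_slope.
Qed.

Lemma autA_slope : slope_bound v 1 (autA M) 0.
Proof.
move=> n; rewrite /autA /aut_factor algM; apply: (vgeM hv).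
  by rewrite hvp; exact: gbinomial_int.
by rewrite !algE; apply: (vgeX hv); exact: Sigma0_cd.
Qed.

Lemma geomA_eval z : (0 <= v z)%E -> ps_eval v (geomA M) z = (c * z + d)^-1.
Proof.
move=> z0; apply: (vsum_uniq hv) => r.
have d0 := Sigma0_d_neq0; have e0 := Sigma0_den_neq0 z0.
have y1 : (1%:E <= v (- (c * z) / d)%R)%E.
  by rewrite mulNr (valN hv) mulrAC; apply: (vge_mulr hv) => //; exact: Sigma0_cd.
have [N yN] := pow_null y1 r; exists N => n Nn.
have -> : \sum_(i < n) geomA M i * z ^+ i - (c * z + d)^-1 =
  - (- (c * z) / d) ^+ n / (c * z + d).
  elim: n {Nn} => [|n IH]; first by rewrite big_ord0 expr0 sub0r mulN1r.
  have gE : geomA M n * z ^+ n = (- (c * z) / d) ^+ n / d.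
    rewrite /geomA !algE exprSr invfM mulrA -exprVn -exprMn mulrAC -exprMn.
    by congr (_ ^+ _ / _); ring.
  rewrite big_ord_recr /= addrAC IH gE exprS; set yn := _ ^+ n; field.
  by rewrite e0 d0.
by rewrite mulNr (valN hv); apply: (vge_mulr hv); [exact: yN|];
  rewrite (valV hv) // Sigma0_den // oppe0.
Qed.

Lemma mobiusA_eval z : (0 <= v z)%E ->
  ps_eval v (mobiusA M) z = (a * z + b) / (c * z + d).
Proof.
move=> z0; rewrite mobiusA_mul (ps_evalM hv cE) //; last first.
- exact: slope1_null geomA_slope.
- exact: numA_null.
rewrite geomA_eval //; congr (_ / _).
rewrite /ps_eval (vsum_fin hv (N := 2)) => [|[|[|n]] // _]; last first.
  by rewrite /numA /= nth_nil alg0 mul0r.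
by rewrite big_ord_recl big_ord1 /numA /= expr0 mulr1 expr1 addrC.
Qed.

Lemma mobiusA_point z : (0 <= v z)%E -> (0 <= v ((a * z + b) / (c * z + d))%R)%E.
Proof.
by move=> z0; rewrite -mobiusA_eval //; apply: (ps_eval_int hv cE) => //;
  [exact: mobiusA_null | exact: mobiusA_bound].
Qed.

Lemma autA_eval z : (0 <= v z)%E -> ps_eval v (autA M) z = upow (1 + c / d * z).
Proof.
move=> z0; rewrite /ps_eval /upow; congr vsum; apply: funext => n.
rewrite /autA /aut_factor (algM (gbinomial k n)) algX (algM (M 1 0)) algV.
by rewrite addrAC subrr add0r -[LHS]mulrA -exprMn.
Qed.

Lemma slash_eval h z : (0 <= v z)%E -> nullseq v h ->
  ps_eval v (slash v psi k h M) z =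
  kappa (M 1 1) * upow (1 + c / d * z) * ps_eval v h ((a * z + b) / (c * z + d)).
Proof.
move=> z0 nh.
have na : nullseq v (autA M) := slope1_null autA_slope.
have nc : nullseq v (ps_comp v h (mobiusA M)).
  by apply: (ps_comp_null hv cE) => //; [exact: mobiusA_null | exact: mobiusA_bound].
rewrite -autA_eval // -mobiusA_eval // -(ps_eval_comp hv cE) //; last first.
- exact: mobiusA_bound.
- exact: mobiusA_null.
rewrite -mulrA -(ps_evalM hv cE) // /ps_eval -(vsumZ hv cE).
  by congr vsum; apply: funext => n; rewrite slashE mulrA.
by apply: (ps_eval_null hv) => //; exact: (ps_mul_null hv).
Qed.

Lemma slash_null h : nullseq v h -> nullseq v (slash v psi k h M).
Proof.
move=> nh.
have na : nullseq v (autA M) := slope1_null autA_slope.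
have nc : nullseq v (ps_comp v h (mobiusA M)).
  by apply: (ps_comp_null hv cE) => //; [exact: mobiusA_null | exact: mobiusA_bound].
have -> : slash v psi k h M =
    fun n => kappa (M 1 1) * ps_mul (autA M) (ps_comp v h (mobiusA M)) n.
  by apply: funext => n; rewrite slashE.
by apply: (nullseqZ hv); exact: (ps_mul_null hv).
Qed.

Lemma slash_lin x h h' : nullseq v h -> nullseq v h' ->
  slash v psi k (fun n => x * h n + h' n) M =
  fun n => x * slash v psi k h M n + slash v psi k h' M n.
Proof.
move=> nh nh'; apply: funext => n; rewrite !slashE.
have [_ lin _] := ps_comp_op hv cE mobiusA_null mobiusA_bound.
by rewrite lin // ps_mulC ps_mul_linl !(ps_mulC _ (autA M)); ring.
Qed.

Lemma slash_sum q (h : nat -> nat -> E) : (forall j, nullseq v (h j)) ->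
  slash v psi k (fun n => \sum_(j < q) h j n) M =
  fun n => \sum_(j < q) slash v psi k (h j) M n.
Proof.
move=> nh; elim: q => [|q IH].
  have n0 : nullseq v (fun=> 0) by exact: (nullseq_fin hv (N := 0)).
  have := slash_lin (-1) n0 n0.
  have -> : (fun n => \sum_(j < 0) h j n) = fun=> 0.
    by apply: funext => n; rewrite big_ord0.
  have -> : (fun _ : nat => -1 * 0 + 0 : E) = fun=> 0.
    by apply: funext => n; rewrite mulr0 addr0.
  by move=> ->; apply: funext => n; rewrite big_ord0 mulN1r addNr.
have nq : nullseq v (fun n => \sum_(j < q) h j n).
  by apply: (nullseq_sum hv) => j _; exact: nh.
have -> : (fun n => \sum_(j < q.+1) h j n) = fun n => 1 * h q n + \sum_(j < q) h j n.
  by apply: funext => n; rewrite big_ord_recr /= mul1r addrC.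
rewrite slash_lin // IH; apply: funext => n.
by rewrite big_ord_recr /= mul1r addrC.
Qed.

(** With [s = 0] the action is contractive for the sup norm. With [s = 1] it gains
    convergence as soon as the Möbius map sends the disc of radius [p] to the
    unit disc. *)
Lemma slash_slope s h r : s <= 1 -> nullseq v h -> seq_bound v h r ->
  slope_bound v s (mobiusA M) 0 -> slope_bound v s (slash v psi k h M) r.
Proof.
move=> s1 nh hr ms n; rewrite slashE; apply: (vge_mull hv).
  by apply: kappa_int; case: SM.
have H := slope_bound_mul hv (slope_bound_le s1 autA_slope)
  (ps_comp_slope hv cE nh mobiusA_bound hr ms).
by have := H n; rewrite add0r.
Qed.

Lemma slash_bound h r : nullseq v h -> seq_bound v h r ->
  seq_bound v (slash v psi k h M) r.
Proof.
move=> nh hr; apply/slope_bound0; apply: slash_slope => //.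
by apply/slope_bound0; exact: mobiusA_bound.
Qed.

End Action.

(** The weight factor is a cocycle; this is checked at the points of the
    closed disc, where composition of Möbius maps is plain algebra. *)
Lemma slash_comp h M N : Sigma0 M -> Sigma0 N -> nullseq v h ->
  slash v psi k (slash v psi k h M) N = slash v psi k h (M * N).
Proof.
move=> SM SN nh; have SMN := Sigma0M SM SN.
have vp : v (p%:R%:A) = 1%E by rewrite hvp val_p.
apply: (ps_eval_inj hv cE vp).
- by apply: slash_null => //; exact: slash_null.
- exact: slash_null.
move=> z z0; rewrite !slash_eval //; last first.
- exact: slash_null.
- exact: mobiusA_point.
set z' := ((N 0 0)%:A * z + _) / _.
have z'0 : (0 <= v z')%E by exact: mobiusA_point.
have [dM dN] := (Sigma0_d_neq0 SM, Sigma0_d_neq0 SN).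
have [eM eN] := (Sigma0_den_neq0 SM z'0, Sigma0_den_neq0 SN z0).
have eMN := Sigma0_den_neq0 SMN z0.
have dMN := Sigma0_d_neq0 SMN.
(* The lower right entry of [M * N] is the product of those of [M] and [N] times
   [1 + x]. *)
pose x := M 1 0 * N 0 1 / (M 1 1 * N 1 1).
have [_ _ cm d0] := SM; have [_ b'0 _ d'0] := SN.
have dd0 : vK (M 1 1 * N 1 1) = 0%E by rewrite (valM hvK) d0 d'0 adde0.
have ddn : M 1 1 * N 1 1 != 0 by exact: unit_neq0.
have xm : (m%:R%:E <= vK x)%E.
  rewrite /x; apply: (vge_mulr hvK); first exact: (vge_mulr hvK).
  by rewrite (valV hvK) // dd0 oppe0.
have dE : (M * N) 1 1 = M 1 1 * N 1 1 * (1 + x).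
  by rewrite mx2M /x mulrDr mulr1 mulrCA divff // mulr1 addrC.
have x1 : (1%:E <= v (1 + x%:A - 1)%R)%E.
  by rewrite addrAC subrr add0r hvp; exact: vge_level1.
rewrite [kappa ((M * N) 1 1)](_ : _ = kappa (M 1 1) * kappa (N 1 1) * upow (1 + x%:A)); last first.
  by rewrite dE kappaM.
have upE : upow (1 + x%:A) * upow (1 + ((M * N) 1 0)%:A / ((M * N) 1 1)%:A * z) =
  upow (1 + (N 1 0)%:A / (N 1 1)%:A * z) * upow (1 + (M 1 0)%:A / (M 1 1)%:A * z').
  rewrite -!upowM //; try exact: Sigma0_aut.
  congr upow; move: dMN; rewrite !mx2M /x /z' !algE => dMN.
  exact: aut_factor_mul.
have -> : (((M * N) 0 0)%:A * z + ((M * N) 0 1)%:A) / (((M * N) 1 0)%:A * z + ((M * N) 1 1)%:A)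
  = ((M 0 0)%:A * z' + (M 0 1)%:A) / ((M 1 0)%:A * z' + (M 1 1)%:A).
  by rewrite !mx2M /z' !algE mobius_mul.
rewrite -[kappa (M 1 1) * kappa (N 1 1) * _ * _]mulrA upE; ring.
Qed.

Lemma slash1 h : nullseq v h -> slash v psi k h 1 = h.
Proof.
move=> nh; have S1 := Sigma0_1.
have vp : v (p%:R%:A) = 1%E by rewrite hvp val_p.
apply: (ps_eval_inj hv cE vp) => //; first exact: slash_null.
move=> z z0; rewrite slash_eval // !mxE /= !algE mul0r mul0r addr0 upow1 mul1r addr0 add0r divr1.
rewrite mulr1; suff -> : kappa 1 = 1 by rewrite mul1r.
case: hpsi => psi1 _ _; rewrite kappaE ?(val1 hvK) // psi1 mul1r.
rewrite /one_unit_part (_ : teichmuller 1 = 1) ?divr1 ?alg1 ?upow1 //.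
apply: (teichE pr_p); rewrite ?(val1 hvK) ?expr1n // subrr.
by rewrite (val0 hvK) leey.
Qed.

End Slash.

(** * Characteristic series of matrices with divisible rows *)

Section Determinants.

(** Sylvester's determinant identity: both sides are the determinant of the
    block matrix with rows [1, B] and [C, 1]. *)
Lemma det_1Bmulmx (A : comPzRingType) (m n : nat) (B : 'M[A]_(m, n)) (C : 'M[A]_(n, m)) :
  \det (1%:M - B *m C) = \det (1%:M - C *m B).
Proof.
have E1 : block_mx 1%:M B C 1%:M *m block_mx 1%:M 0 (- C) 1%:M =
  block_mx (1%:M - B *m C) B 0 1%:M.
  by rewrite mulmx_block !mulmx1 !mul1mx !mulmx0 !mulmxN !add0r subrr.
have E2 : block_mx 1%:M 0 (- C) 1%:M *m block_mx 1%:M B C 1%:M =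
  block_mx 1%:M B 0 (1%:M - C *m B).
  by rewrite mulmx_block !mulmx1 !mul1mx !mul0mx !mulNmx !addr0 addNr addrC.
have := det_ublock (1%:M - B *m C) B 1%:M.
rewrite -E1 det_mulmx mulrC -det_mulmx E2 det_ublock !det1 mul1r mulr1.
by move=> <-.
Qed.

End Determinants.

Section FredholmDet.
Variables (R : realType) (E : fieldType) (v : E -> \bar R).
Hypothesis hv : is_valuation v.
Implicit Types (r : R) (P Q : {poly E}).

Definition fdet N (A : 'M[E]_N) : {poly E} := \det (1%:M - 'X *: map_mx polyC A).

(** For rectangular factors this exchanges determinants of different sizes. *)
Lemma fdet_mulC m n (B : 'M[E]_(m, n)) (C : 'M[E]_(n, m)) :
  fdet (B *m C) = fdet (C *m B).
Proof.
by rewrite /fdet !map_mxM scalemxAl det_1Bmulmx -scalemxAr.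
Qed.

Definition pint P := forall n, (0 <= v P`_n)%E.

Definition pcong r P Q := [/\ pint P, pint Q & forall n, (r%:E <= v (P`_n - Q`_n)%R)%E].

Lemma pcong_refl r P : pint P -> pcong r P P.
Proof. by move=> iP; split=> // n; rewrite subrr; exact: (vge0 hv). Qed.

Lemma pintD P Q : pint P -> pint Q -> pint (P + Q).
Proof. by move=> iP iQ n; rewrite coefD; exact: (vgeD hv). Qed.

Lemma pintM P Q : pint P -> pint Q -> pint (P * Q).
Proof.
move=> iP iQ n; rewrite coefM; apply: (vge_sum hv) => i _.
by rewrite -[0]addr0; apply: (vgeM hv); [exact: iP | exact: iQ].
Qed.

Lemma pcongD r P Q P' Q' : pcong r P P' -> pcong r Q Q' -> pcong r (P + Q) (P' + Q').
Proof.
move=> [iP iP' PP'] [iQ iQ' QQ']; split; try exact: pintD.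
by move=> n; rewrite !coefD opprD addrACA; exact: (vgeD hv).
Qed.

Lemma pcongM r P Q P' Q' : pcong r P P' -> pcong r Q Q' -> pcong r (P * Q) (P' * Q').
Proof.
move=> [iP iP' PP'] [iQ iQ' QQ']; split; try exact: pintM.
move=> n; rewrite !coefM -sumrB; apply: (vge_sum hv) => i _.
apply: (vge_trans hv (y := P'`_i * Q`_(n - i))).
  by rewrite -mulrBl; apply: (vge_mulr hv); [exact: PP' | exact: iQ].
by rewrite -mulrBr; apply: (vge_mull hv); [exact: iP' | exact: QQ'].
Qed.

Lemma pintC x : (0 <= v x)%E -> pint x%:P.
Proof. by move=> x0 n; rewrite coefC; case: eqP => // _; exact: (vge0 hv). Qed.

Lemma fdet_entry N (A : 'M[E]_N) i j :
  (1%:M - 'X *: map_mx polyC A) i j = (i == j)%:R%:P - 'X * (A i j)%:P.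
Proof. by rewrite !mxE raddfMn. Qed.

Lemma pint_entry (x y : E) : (0 <= v x)%E -> (0 <= v y)%E -> pint (x%:P - 'X * y%:P).
Proof.
move=> x0 y0 n; rewrite coefB coefXM; apply: (vgeB hv); first exact: pintC.
by case: eqP => _; [exact: (vge0 hv) | exact: pintC].
Qed.

Lemma vbool (b : bool) : (0 <= v b%:R)%E.
Proof. exact: (vint_nat hv). Qed.

Lemma fdet_cong N (A B : 'M[E]_N) r :
  (forall i j, (0 <= v (A i j))%E) -> (forall i j, (0 <= v (B i j))%E) ->
  (forall i j, (r%:E <= v (A i j - B i j)%R)%E) ->
  forall n, (r%:E <= v ((fdet A)`_n - (fdet B)`_n)%R)%E.
Proof.
move=> iA iB AB; suff [_ _ //] : pcong r (fdet A) (fdet B).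
rewrite /fdet /determinant; apply: (big_ind2 (pcong r)).
- by apply: pcong_refl => n; rewrite coef0; exact: (vge0 hv).
- by move=> *; exact: pcongD.
move=> s _; apply: pcongM.
  apply: pcong_refl; case: (perm.odd_perm s); rewrite ?expr1 ?expr0.
    by rewrite -polyCN; apply: pintC; rewrite (valN hv) (val1 hv).
  by apply: pintC; rewrite (val1 hv).
apply: (big_ind2 (pcong r)).
- by apply: pcong_refl; apply: pintC; rewrite (val1 hv).
- by move=> *; exact: pcongM.
move=> i _; rewrite !fdet_entry; split; try exact: pint_entry (vbool _) _.
move=> n; rewrite !coefB !coefXM opprB addrC addrA addrNK.
case: eqP => [_|_]; first by rewrite subrr; exact: (vge0 hv).
rewrite !coefC; case: eqP => [_|_]; last by rewrite subrr; exact: (vge0 hv).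
by apply: (vgeC hv); exact: AB.
Qed.

Variable w : nat -> R.
Hypothesis w_homo : {homo w : i j / (i <= j)%N >-> i <= j}.
Hypothesis w_ge0 : 0 <= w 0.

Definition row_sum n : R := \sum_(i < n) w i.

Lemma w_pos i : 0 <= w i.
Proof. by apply: le_trans w_ge0 _; exact: w_homo. Qed.

(** The degree bound is part of the induction: the new factor contributes [w N],
    which is at least [w n] only for [n <= N]. *)
Lemma prod_row_bound N (a b : 'I_N -> E) :
  (forall i, (0 <= v (a i))%E) -> (forall i : 'I_N, ((w i)%:E <= v (b i))%E) ->
  let P := \prod_i ((a i)%:P - 'X * (b i)%:P) in
  forall n, ((row_sum n)%:E <= v P`_n)%E /\ ((N < n)%N -> P`_n = 0).
Proof.
elim: N a b => [|N IH] a b a0 bw /= n.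
  rewrite big_ord0 coefC; case: n => [|n] /=; last by split=> //; exact: (vge0 hv).
  by rewrite /row_sum big_ord0 (val1 hv).
rewrite big_ord_recr /=; set P := \prod_(i < N) _.
have {IH} H := IH (a \o widen_ord (leqnSn N)) (b \o widen_ord (leqnSn N))
  (fun i => a0 _) (fun i => bw _); rewrite -/P in H.
rewrite mulrBr mulrA coefB !coefMC coefMX; split; last first.
  case: n => // n nN /=; rewrite ltnS in nN.
  by rewrite ((H n).2 nN) ((H n.+1).2 (leqW nN)) !mul0r subrr.
apply: (vgeB hv); first by rewrite -[row_sum n]addr0; apply: (vgeM hv); [exact: (H n).1 | exact: a0].
case: n => [|n]; first by rewrite eqxx mul0r; exact: (vge0 hv).
rewrite [n.+1 == 0%N]/= [n.+1.-1]/=.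
have [nN|Nn] := leqP n N; last by rewrite (H n).2 // mul0r; exact: (vge0 hv).
rewrite /row_sum big_ord_recr /=; apply: (vgeM hv); first exact: (H n).1.
by apply: (vge_le _ (bw _)); exact: w_homo.
Qed.

(** The coefficient of [X^n] is a sum of [n x n] minors; each one has valuation
    at least the sum of the weights of its rows, hence at least the sum of
    the [n] smallest weights. *)
Lemma fdet_row_bound N (A : 'M[E]_N) n :
  (forall i j, ((w (val i))%:E <= v (A i j))%E) -> ((row_sum n)%:E <= v (fdet A)`_n)%E.
Proof.
move=> Aw; rewrite /fdet /determinant coef_sum; apply: (vge_sum hv) => s _.
have [H _] := @prod_row_bound N (fun i => (i == s i)%:R) (fun i => A i (s i))
  (fun i => vbool _) (fun i => Aw _ _) n.
rewrite (eq_bigr (fun i => (i == s i)%:R%:P - 'X * (A i (s i))%:P)) => [|i _]; last first.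
  exact: fdet_entry.
case: (perm.odd_perm s); rewrite ?expr1 ?expr0 ?mulN1r ?mul1r //.
by rewrite coefN (valN hv).
Qed.

Lemma fdet_factor_cong N L (A : 'M[E]_N) (C : 'M[E]_(N, L)) (B : 'M[E]_(L, N)) r :
  (forall i j, (0 <= v (A i j))%E) -> (forall i j, (0 <= v (C i j))%E) ->
  (forall i j, (0 <= v (B i j))%E) ->
  (forall i j, (r%:E <= v (A i j - (C *m B) i j)%R)%E) ->
  forall n, (r%:E <= v ((fdet A)`_n - (fdet (B *m C))`_n)%R)%E.
Proof.
move=> iA iC iB AB n; rewrite fdet_mulC; apply: fdet_cong => // i j.
rewrite mxE; apply: (vge_sum hv) => l _.
by rewrite -[0]addr0; apply: (vgeM hv).
Qed.

(** Conjugating by an integral change of basis destroys the divisibility of the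
    rows but not the bound, since the factors may be exchanged. *)
Lemma fdet_factor_bound N L (A : 'M[E]_N) (C : 'M[E]_(N, L)) (B : 'M[E]_(L, N)) n :
  (forall i j, (0 <= v (A i j))%E) -> (forall i j, (0 <= v (C i j))%E) ->
  (forall i j, ((w (val i))%:E <= v (B i j))%E) ->
  (forall i j, ((row_sum n)%:E <= v (A i j - (C *m B) i j)%R)%E) ->
  ((row_sum n)%:E <= v (fdet A)`_n)%E.
Proof.
move=> iA iC Bw AB.
have iB i j : (0 <= v (B i j))%E by apply: (vge_le _ (Bw i j)); exact: w_pos.
rewrite -[(fdet A)`_n](subrK (fdet (B *m C))`_n); apply: (vgeD hv).
  exact: fdet_factor_cong.
apply: fdet_row_bound => i j; rewrite mxE; apply: (vge_sum hv) => l _.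
exact: (vge_mulr hv).
Qed.

Hypothesis cE : vcomplete v.

(** Modulo a high power of the uniformizer only the first [L] rows are nonzero, and
    then the larger matrix is a product in which the factors may be exchanged
    to give its upper left [L x L] block. *)
Lemma fdet_cvg (a : nat -> nat -> E) n :
  (forall r, exists i, r <= w i) ->
  (forall i j, ((w i)%:E <= v (a i j))%E) ->
  exists c, vcvg v (fun N => (fdet (\matrix_(i < N, j < N) a (val i) (val j)))`_n) c.
Proof.
move=> w_oo aw; apply: cE => r; have [L rL] := w_oo r.
have a0 i j : (0 <= v (a i j))%E by apply: (vge_le _ (aw i j)); exact: w_pos.
set A := fun N => \matrix_(i < N, j < N) a (val i) (val j).
have key N : (L <= N)%N -> (r%:E <= v ((fdet (A N))`_n - (fdet (A L))`_n)%R)%E.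
  move=> LN.
  pose C : 'M[E]_(N, L) := \matrix_(i, j) (val i == val j)%:R.
  pose B : 'M[E]_(L, N) := \matrix_(i, j) a (val i) (val j).
  have -> : A L = B *m C.
    apply/matrixP => i j; rewrite !mxE (bigD1 (widen_ord LN j)) //= !mxE eqxx mulr1.
    rewrite big1 ?addr0 // => l; rewrite -val_eqE /= => /negPf lj.
    by rewrite !mxE lj mulr0.
  apply: fdet_factor_cong => i j; rewrite ?mxE //; first exact: vbool.
  have [iL|Li] := ltnP i L.
    rewrite (bigD1 (Ordinal iL)) //= !mxE eqxx mul1r big1 ?addr0 ?subrr ?(vge0 hv) // => l.
    by rewrite -val_eqE /= !mxE eq_sym => /negPf ->; rewrite mul0r.
  rewrite big1 ?subr0 => [|l _]; last first.
    rewrite !mxE gtn_eqF ?mul0r //; exact: leq_trans (ltn_ord l) Li.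
  by apply: (vge_le _ (aw _ _)); apply: le_trans rL _; exact: w_homo.
exists L => i j Li Lj; apply: (vge_trans hv (key _ Li)).
by apply: (vgeC hv); exact: key.
Qed.

End FredholmDet.

(** * Newton polygons *)

Section Polygon.
Variables (R : realType) (E : fieldType) (v : E -> \bar R).
Hypothesis hv : is_valuation v.

(** Raising [n] to [n + 1] increases by one the terms with [i %/ t <= n]; there are
    at most [t (n + 1)] of them. *)
Lemma sum_divn_line (t n j : nat) : (0 < t)%N ->
  (\sum_(i < j) (n - i %/ t) <= t * 'C(n.+1, 2))%N.
Proof.
move=> t0; elim: n => [|n IH].
  by rewrite muln0 leqn0 sum_nat_eq0; apply/forallP => i; apply/implyP => _; rewrite sub0n.
rewrite binS bin1 mulnDr.
have -> : (\sum_(i < j) (n.+1 - i %/ t) =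
  \sum_(i < j) (n - i %/ t) + \sum_(i < j) (i %/ t <= n))%N.
  by rewrite -big_split /=; apply: eq_bigr => i _; case: leqP; lia.
apply: leq_add IH _; rewrite -big_mkcond /= sum1_card.
rewrite (leq_trans (n := #|'I_(t * n.+1)|)) ?card_ord //.
pose f (i : 'I_j) : nat := i.
rewrite cardE -(size_map f) -[X in (_ <= X)%N](size_iota 0).
apply: uniq_leq_size.
  by rewrite map_inj_uniq ?enum_uniq //; exact: val_inj.
move=> k /mapP[i]; rewrite mem_enum => it ->; have {it} : (i %/ t <= n)%N by [].
by rewrite mem_iota /= add0n /f mulnC -ltn_divLR ?ltnS.
Qed.

(** The left side is the line through the vertices [n] and [n + 1] of the polygon,
    evaluated at [j]. *)
Lemma natr_sum_line (t n j : nat) : (0 < t)%N ->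
  n%:R * (n%:R - 1) / 2%:R * t%:R + n%:R * (j%:R - (n * t)%:R)
    <= \sum_(i < j) (i %/ t)%N%:R :> R.
Proof.
move=> t0.
have H1 : n%:R * j%:R <= \sum_(i < j) (i %/ t)%N%:R + (t * 'C(n.+1, 2))%:R :> R.
  apply: le_trans (_ : \sum_(i < j) (i %/ t)%N%:R + (\sum_(i < j) (n - i %/ t))%N%:R <= _);
    last by rewrite lerD2l ler_nat sum_divn_line.
  rewrite -natr_sum -natrD -natrM ler_nat -big_split /=.
  have -> : (n * j = \sum_(i < j) n)%N by rewrite sum_nat_const card_ord mulnC.
  by apply: leq_sum => i _; lia.
have H2 : 2%:R * 'C(n.+1, 2)%:R = (n.+1)%:R * n%:R :> R.
  by rewrite -!natrM mul2n bin2 /= even_halfK // oddM /= andNb.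
move: H1 H2; rewrite !natrM -(addn1 n) natrD; set C := 'C(_, _)%:R.
set x := n%:R; set y := t%:R; set z := j%:R; set S := \sum_(_ < _) _.
move=> H1 H2.
have CE : C = (x + 1) * x / 2%:R.
  by rewrite -H2 mulrAC divff ?mul1r // pnatr_eq0.
rewrite CE in H1.
have -> : x * (x - 1) / 2%:R * y + x * (z - x * y) =
  x * z - y * ((x + 1) * x / 2%:R) by field.
by rewrite lerBlDr.
Qed.

(** The lower bounds for the [v (c n)] lie above the line through each side of
    the polygon, and being above a line passes to the convex hull. *)
Lemma newton_lies_above (c : nat -> E) (t : nat) : (0 < t)%N ->
  (forall n, ((\sum_(i < n) (i %/ t)%N%:R)%:E <= v (c n))%E) ->
  lies_above (newton_polygon v c)
    (fun n : nat => ((n * t)%:R, n%:R * (n%:R - 1) / 2%:R * t%:R)).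
Proof.
move=> t0 cb n s s01 /=; apply: le_ereal_inf_tmp => _ [z [[N [u [u0 u1 uc ->]]] /= zx] <-].
rewrite lee_fin.
set V := n%:R * (n%:R - 1) / 2%:R * t%:R.
have -> : (1 - s) * V + s * ((n.+1)%:R * ((n.+1)%:R - 1) / 2%:R * t%:R) =
  V + n%:R * ((1 - s) * (n * t)%:R + s * (n.+1 * t)%:R - (n * t)%:R).
  by rewrite /V !natrM -(addn1 n) natrD; field.
rewrite -zx.
have -> : V + n%:R * (\sum_(i < N) u i * (val i)%:R - (n * t)%:R) =
  \sum_(i < N) u i * (V + n%:R * ((val i)%:R - (n * t)%:R)).
  rewrite [RHS](eq_bigr (fun i => u i * (V - n%:R * (n * t)%:R) + n%:R * (u i * (val i)%:R))).
    by rewrite [RHS]big_split /= -mulr_suml u1 -[in RHS]mulr_sumr; ring.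
  by move=> i _; ring.
apply: ler_sum => i _; case: (eqVneq (c (val i)) 0) => [/uc ->|ci].
  by rewrite !mul0r.
apply: ler_wpM2l => //; apply: le_trans (natr_sum_line n (val i) t0) _.
by rewrite -lee_fin (fineK (val_fin hv ci)).
Qed.

End Polygon.

(** * The adelic group and its level subgroup *)

Section Components.
Variables (R : realType) (Q_ : forall l : primeT, padicField R (val l)).
Variable D : falgType rat.
Local Notation Dfx := (Dfx Q_ D).
Local Notation e i := ((vbasis {:D})`_i).

Lemma ext_mulE (K : comPzRingType) (f : {rmorphism rat -> K}) (x y : ext D f) k :
  (x * y) 0 k = \sum_i \sum_j
    x 0 i * y 0 j * f (coord (vbasis {:D}) k (e (val i) * e (val j))).
Proof.
rewrite -[x * y]/(ext_mul x y) /ext_mul summxE; apply: eq_bigr => i _.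
by rewrite summxE; apply: eq_bigr => j _; rewrite !mxE.
Qed.

Lemma adele_at_sum l (I : finType) (F : I -> adele Q_) :
  adele_at (\sum_i F i) l = \sum_i adele_at (F i) l.
Proof.
apply: (big_morph (fun x : adele Q_ => adele_at x l)) => //=.
exact: (rmorph0 (padic_rat (Q_ l))).
Qed.

Lemma componentM l (x y : Dfx) : component l (x * y)%g = component l x * component l y.
Proof.
apply/rowP => k; rewrite !mxE ext_mulE /= ext_mulE adele_at_sum.
apply: eq_bigr => i _; rewrite adele_at_sum; apply: eq_bigr => j _.
by rewrite !mxE.
Qed.

Lemma component1 l : component l (1%g : Dfx) = 1.
Proof.
apply/rowP => k; rewrite mxE.
rewrite -[RHS]/((ext_in (padic_rat (Q_ l)) 1) 0 k).
by rewrite -[uval 1%g]/(ext_in (adele_rat Q_) (1 : D)) !mxE.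
Qed.

Lemma componentV l (x : Dfx) y : component l x * y = 1 -> component l x^-1%g = y.
Proof.
move=> xy; rewrite -[component l x^-1%g]mulr1 -xy mulrA -componentM.
by rewrite mulVg component1 mul1r.
Qed.

(** This shows that the choice made in [at_p] is not vacuous. Adeles are glued from
    their components; away from [q] these are the coordinates of [1], which are
    rational and so integral at almost all primes. *)
Lemma local_unit (q : primeT) (x y : local_alg D (Q_ q)) : x * y = 1 -> y * x = 1 ->
  exists g : Dfx, component q g = x /\ forall l, l <> q -> component l g = 1.
Proof.
have glue (z : local_alg D (Q_ q)) : exists g : Df Q_ D,
    forall k, (g : 'rV[adele Q_]_(\dim {:D})) 0 k q = z 0 k /\
      forall l, l <> q -> (g : 'rV[adele Q_]_(\dim {:D})) 0 k l =
        (1 : local_alg D (Q_ l)) 0 k.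
  pose at_ k l : Q_ l := match pselect (q = l) with
    | left e => eq_rect q (fun l => Q_ l) (z 0 k) l e
    | right _ => (1 : local_alg D (Q_ l)) 0 k end.
  have fin k : finite_set [set l | ~ (0 <= padic_val (at_ k l))%E].
    apply: (sub_finite_set (B := [set q] `|`
      [set l | ~ (0 <= padic_val (padic_rat (Q_ l) (coord (vbasis {:D}) k 1)))%E])).
      move=> l /=; rewrite /at_; case: pselect => [ql _|ql]; first by left.
      by rewrite mxE => ?; right.
    by rewrite finite_setU; split; [exact: finite_set1 | exact: padic_int_rat].
  exists (\row_k Adele (fin k)) => k; rewrite mxE /= /at_; split.
    (* [eq_rect] along a proof of [q = q] is the identity. *)
    case: pselect => // qq; rewrite (_ : qq = erefl q) //; exact: Prop_irrelevance.
  by move=> l lq; case: pselect => // ql; case: lq.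
move=> xy yx; have [[g gE] [g' g'E]] := (glue x, glue y).
have gg' (a b : local_alg D (Q_ q)) (u w : Df Q_ D) : a * b = 1 ->
    (forall k, (u : 'rV[adele Q_]_(\dim {:D})) 0 k q = a 0 k /\
      forall l, l <> q -> (u : 'rV[adele Q_]_(\dim {:D})) 0 k l =
        (1 : local_alg D (Q_ l)) 0 k) ->
    (forall k, (w : 'rV[adele Q_]_(\dim {:D})) 0 k q = b 0 k /\
      forall l, l <> q -> (w : 'rV[adele Q_]_(\dim {:D})) 0 k l =
        (1 : local_alg D (Q_ l)) 0 k) -> u * w = 1.
  move=> ab uE wE; apply/rowP => k; apply: adele_ext => l.
  have mulE : adele_at ((u * w) 0 k) l =
      ((\row_k (u : 'rV[adele Q_]_(\dim {:D})) 0 k l : local_alg D (Q_ l)) *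
       (\row_k (w : 'rV[adele Q_]_(\dim {:D})) 0 k l : local_alg D (Q_ l))) 0 k.
    rewrite ext_mulE /= ext_mulE adele_at_sum.
    apply: eq_bigr => i _; rewrite adele_at_sum; apply: eq_bigr => j _.
    by rewrite !mxE.
  pose ul : local_alg D (Q_ l) := \row_k (u : 'rV[adele Q_]_(\dim {:D})) 0 k l.
  pose wl : local_alg D (Q_ l) := \row_k (w : 'rV[adele Q_]_(\dim {:D})) 0 k l.
  have /rowP/(_ k) := component1 l; rewrite mxE mulE -/ul -/wl => ->.
  suff -> : ul * wl = 1 by [].
  have [lq|lq] := pselect (l = q).
    subst l; rewrite -ab; congr (_ * _); apply/rowP => i; rewrite mxE.
      exact: (uE i).1.
    exact: (wE i).1.
  rewrite -[RHS]mul1r; congr (_ * _); apply/rowP => i; rewrite mxE.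
    exact: ((uE i).2 l lq).
  exact: ((wE i).2 l lq).
exists (Unitg (gg' _ _ _ _ xy gE g'E) (gg' _ _ _ _ yx g'E gE)); split.
  by apply/rowP => k; rewrite mxE (gE k).1.
by move=> l lq; apply/rowP => k; rewrite mxE ((gE k).2 l lq).
Qed.

End Components.

Section LevelGroup.
Variables (R : realType) (Q_ : forall l : primeT, padicField R (val l)).
Variable D : falgType rat.
Variable eta : forall l : primeT, 'M[Q_ l]_2 -> local_alg D (Q_ l).
Variables (p : primeT) (Ul : forall l : primeT, set (local_alg D (Q_ l))).
Hypothesis eta_p : alg_iso (eta (l := p)).
Hypothesis hUl : forall l : primeT, l <> p -> open_compact_unit_subgroup (@Ul l).
Variable m : nat.
Hypothesis m0 : (0 < m)%N.
Local Notation Dfx := (Dfx Q_ D).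
Local Notation K := (Q_ p).
Local Notation vK := (@padic_val R (val p) K).
Local Notation "''eta'" := (@eta p).
Local Notation U0m := (@U0 R Q_ p m).
Let hvK : is_valuation vK := padic_valuation K.
Let pr_p : prime (val p) := valP p.

Definition level_at (u : Dfx) (M : 'M[K]_2) :=
  level eta p Ul m u /\ component p u = eta M.

Lemma eta_inj : injective 'eta.
Proof. by case: eta_p => /bij_inj. Qed.

Lemma etaM M N : eta (M * N) = 'eta M * 'eta N.
Proof. by case: eta_p. Qed.

Lemma eta1 : 'eta 1 = 1.
Proof. by case: eta_p. Qed.

Lemma level_at_U0 u M : level_at u M -> U0m M.
Proof. by move=> [[_ [N N0 ->]] /eta_inj <-]. Qed.

Lemma level_at_inj u M N : level_at u M -> level_at u N -> M = N.
Proof. by move=> [_ uM] [_ uN]; apply: eta_inj; rewrite -uM. Qed.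

Lemma level_ex u : level eta p Ul m u -> exists M, level_at u M.
Proof. by move=> lu; have [_ [M _ uM]] := lu; exists M. Qed.

Lemma val_level (c : K) : (m%:R%:E <= vK c)%E -> (1%:E <= vK c)%E.
Proof. by apply: (vge_le _); rewrite ler1n. Qed.

Lemma U0_Sigma0 M : U0m M -> Sigma0 m M.
Proof. by move=> [a b c d]; split=> //; rewrite a. Qed.

Lemma U0M M N : U0m M -> U0m N -> U0m (M * N).
Proof.
move=> UM UN; have [a b c d] := UM; have [a' b' c' d'] := UN.
have c0 : (0 <= vK (M 1%R 0%R))%E by apply: (vge_le _ c); exact: ler0n.
have c'0 : (0 <= vK (N 1%R 0%R))%E by apply: (vge_le _ c'); exact: ler0n.
rewrite /U0 /= !mx2M; split.
- apply: (vunitD hvK ltr01); first by rewrite (valM hvK) a a' adde0.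
  by apply: (vge_mull hvK) => //; exact: val_level.
- by apply: (vgeD hvK); apply: (vge_mull hvK); rewrite ?a ?d'.
- by apply: (vgeD hvK); [apply: (vge_mulr hvK) | apply: (vge_mull hvK)]; rewrite ?a' ?d.
rewrite addrC; apply: (vunitD hvK ltr01); first by rewrite (valM hvK) d d' adde0.
by apply: (vge_mulr hvK) => //; exact: val_level.
Qed.

Lemma mx2P (M N : 'M[K]_2) : M 0 0 = N 0 0 -> M 0 1 = N 0 1 -> M 1 0 = N 1 0 ->
  M 1 1 = N 1 1 -> M = N.
Proof.
move=> a b c d; apply/matrixP => i j.
have ord2 (x : 'I_2) : x = 0 \/ x = 1.
  by case: x => [[|[|//]] xi]; [left | right]; exact: val_inj.
by have [-> | ->] := ord2 i; have [-> | ->] := ord2 j.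
Qed.

Lemma U0V M : U0m M -> exists2 N, U0m N & M * N = 1 /\ N * M = 1.
Proof.
move=> [a b c d]; pose dt := M 0 0 * M 1 1 - M 0 1 * M 1 0.
have c0 : (0 <= vK (M 1%R 0%R))%E by apply: (vge_le _ c); exact: ler0n.
have vdt : vK dt = 0%E.
  apply: (vunitD hvK ltr01); first by rewrite (valM hvK) a d adde0.
  by rewrite (valN hvK); apply: (vge_mull hvK) => //; exact: val_level.
have dt0 : dt != 0 by exact: unit_neq0.
have vdt1 : vK dt^-1 = 0%E by rewrite (valV hvK) // vdt oppe0.
pose N : 'M[K]_2 := \matrix_(i, j) (dt^-1 *
  (if i == 0 then (if j == 0 then M 1 1 else - M 0 1)
   else (if j == 0 then - M 1 0 else M 0 0))).
exists N; first (rewrite /U0 /= !mxE /=; split).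
- by rewrite (valM hvK) vdt1 d adde0.
- by apply: (vge_mull hvK); rewrite ?vdt1 ?(valN hvK).
- by apply: (vge_mull hvK); rewrite ?vdt1 ?(valN hvK).
- by rewrite (valM hvK) vdt1 a adde0.
by split; apply: mx2P; rewrite !mx2M !mxE /=; move: dt0; rewrite /dt => dt0; field.
Qed.

Lemma level_at1 : level_at 1%g 1.
Proof.
split; last by rewrite component1 eta1.
split; first by move=> l lp; rewrite component1; have [_ _ ? _ _] := hUl lp.
exists 1; last by rewrite component1 eta1.
by rewrite /U0 /= !mxE /= (val1 hvK) (val0 hvK); split; rewrite ?leey.
Qed.

Lemma level_atM u w M N : level_at u M -> level_at w N -> level_at (u * w)%g (M * N).
Proof.
move=> uM wN; have [UM UN] := (level_at_U0 uM, level_at_U0 wN).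
move: uM wN => [[lu _] uM] [[lw _] wN].
have uw : component p (u * w)%g = eta (M * N) by rewrite componentM uM wN etaM.
split=> //; split; last by exists (M * N) => //; exact: U0M.
move=> l lp; rewrite componentM; have [_ _ _ mulU _] := hUl lp.
by apply: mulU; [exact: lu | exact: lw].
Qed.

Lemma level_atV u M : level_at u M -> exists N, level_at u^-1%g N.
Proof.
move=> uM; have [N UN [MN _]] := U0V (level_at_U0 uM).
move: uM => [[lu _] uM]; exists N.
have uN : component p u^-1%g = eta N by apply: componentV; rewrite uM -etaM MN eta1.
split=> //; split; last by exists N.
move=> l lp; have [_ _ _ _ /(_ _ (lu l lp))[y Uy [uy _]]] := hUl lp.
by rewrite (componentV uy).
Qed.

(** ** The matrices of the operator [U_p] *)

Local Notation hecke := (@hecke_mx R Q_ p m).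

Lemma hecke_Sigma0 j : Sigma0 m (hecke j).
Proof.
split; rewrite !mxE /=.
- exact: (vint_nat hvK).
- by rewrite (val0 hvK) leey.
- by apply: (vge_mull hvK); [exact: (vint_nat hvK) | rewrite val_pX].
exact: (val1 hvK).
Qed.

Definition hecke_inv (j : nat) : 'M[K]_2 := \matrix_(a < 2, b < 2)
  if a == 0 then (if b == 0 then (val p)%:R^-1 else 0)
  else (if b == 0 then - j%:R * (val p)%:R ^+ m / (val p)%:R else 1).

Lemma p_neq0 : ((val p)%:R : K) != 0.
Proof. by apply: natf_neq0; exact: prime_gt0. Qed.

Lemma hecke_mulV j : hecke j * hecke_inv j = 1 /\ hecke_inv j * hecke j = 1.
Proof.
by split; apply: mx2P; rewrite !mx2M !mxE /=; field; first [exact: p_neq0 | by []].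
Qed.

Lemma at_pP j : component p (at_p eta (hecke j)) = eta (hecke j) /\
  forall l, l <> p -> component l (at_p eta (hecke j)) = 1.
Proof.
rewrite /at_p; case: xgetP => [g -> //|H].
have [h1 h2] := hecke_mulV j.
have [||g gP] := @local_unit _ Q_ D p (eta (hecke j)) (eta (hecke_inv j)).
- by rewrite -etaM h1 eta1.
- by rewrite -etaM h2 eta1.
by have := H g gP.
Qed.

(** Right translation by an element of the level permutes the [p] cosets
    defining [U_p]: the lower left entry of [v_j M v_i^-1] is divisible by
    [p ^ m] exactly when [i] is the residue of [(j a + c / p^m) / d]. *)
Lemma hecke_swap u M : level_at u M ->
  exists2 sg : 'I_(val p) -> 'I_(val p), injective sg & forall j, exists u' M',
    [/\ level_at u' M',
        (u * (at_p eta (hecke (sg j)))^-1 = (at_p eta (hecke j))^-1 * u')%g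
      & M' * hecke (sg j) = hecke j * M].
Proof.
move=> uM; have [a b c d] := level_at_U0 uM.
pose P : K := (val p)%:R.
have vP : vK P = 1%E by exact: val_p.
have vPm : vK (P ^+ m) = m%:R%:E by exact: val_pX.
have P0 : P != 0 := p_neq0.
have Pm0 : P ^+ m != 0 by rewrite expf_neq0.
pose c1 := M 1 0 / P ^+ m.
have c1i : (0 <= vK c1)%E.
  rewrite /c1 (valM hvK) (valV hvK) // vPm.
  by rewrite sube_ge0 //; rewrite ?fin_numE //.
have ji (j : nat) : (0 <= vK j%:R)%E by exact: (vint_nat hvK).
have Pmi : (1%:E <= vK (P ^+ m))%E by rewrite vPm lee_fin ler1n.
pose e (j : nat) := j%:R * P ^+ m * M 0 1 + M 1 1.
have ve j : vK (e j) = 0%E.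
  rewrite /e addrC; apply: (vunitD hvK ltr01) => //.
  by apply: (vge_mulr hvK) => //; exact: (vge_mull hvK).
have e0 j : e j != 0 by exact: unit_neq0.
(* [e j] and [j a + c1] are the lower entries of [v_j M], the second one divided by
   [p ^ m]. *)
pose y (j : nat) := (j%:R * M 0 0 + c1) / e j.
have yi j : (0 <= vK (y j))%E.
  apply: (vge_mulr hvK); last by rewrite (valV hvK) // ve oppe0.
  by apply: (vgeD hvK) => //; apply: (vge_mull hvK); rewrite ?a.
have /choice[s0 s0P] (j : 'I_(val p)) : exists i : 'I_(val p), (1%:E <= vK (y j - i%:R)%R)%E.
  have [n yn] := nat_dense pr_p 1 (yi j).
  exists (Ordinal (ltn_pmod n (prime_gt0 pr_p))) => /=.
  apply: (vge_trans hvK yn); apply: (val_eqmod _ pr_p (N := 1)).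
  by rewrite expn1 modn_mod.
have main (j : 'I_(val p)) : (1%:E <= vK (j%:R * M 0%R 0%R + c1 - (s0 j)%:R * e j)%R)%E.
  have -> : j%:R * M 0 0 + c1 - (s0 j)%:R * e j = (y j - (s0 j)%:R) * e j.
    by rewrite /y mulrBl mulfVK.
  by apply: (vge_mulr hvK); rewrite ?ve.
exists s0.
  move=> i j sij; apply: val_inj; apply/eqP.
  have /val_eqmod1 : (1%:E <= vK (i%:R - j%:R)%R)%E.
    have a0 : M 0 0 != 0 by exact: unit_neq0.
    have -> : vK (i%:R - j%:R) = vK ((i%:R - j%:R) * M 0 0).
      by rewrite (valM hvK) a adde0.
    have -> : (i%:R - j%:R) * M 0 0 = (i%:R * M 0 0 + c1 - (s0 i)%:R * e i) -
      (j%:R * M 0 0 + c1 - (s0 j)%:R * e j) +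
      P ^+ m * ((s0 j)%:R * (i%:R - j%:R) * M 0 1).
      by rewrite sij /e; ring.
    apply: (vgeD hvK); first by apply: (vgeB hvK).
    apply: (vge_mulr hvK) => //; apply: (vge_mull hvK) => //.
    by apply: (vge_mull hvK) => //; apply: (vgeB hvK).
  by move/eqP; rewrite !modn_small.
move=> j; set i := s0 j.
pose M' : 'M[K]_2 := \matrix_(r < 2, s < 2)
  if r == 0 then (if s == 0 then M 0 0 - i%:R * P ^+ m * M 0 1 else P * M 0 1)
  else (if s == 0 then (j%:R * M 0 0 + c1 - i%:R * e j) / P * P ^+ m else e j).
have M'E : M' * hecke i = hecke j * M.
  by apply: mx2P; rewrite !mx2M !mxE /= -/P /e /c1; field; rewrite ?P0 ?Pm0.
pose u' := (at_p eta (hecke j) * u * (at_p eta (hecke i))^-1)%g.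
have [pj lj] := at_pP j; have [pi li] := at_pP i.
have uP : component p (at_p eta (hecke i))^-1%g = eta (hecke_inv i).
  by apply: componentV; rewrite pi -etaM (hecke_mulV i).1 eta1.
have u'p : component p u' = eta M'.
  rewrite !componentM uP pj uM.2 -!etaM -M'E -mulrA (hecke_mulV i).1 mulr1.
  by [].
have UM' : U0m M'.
  rewrite /U0 /= !mxE /=; split.
  - apply: (vunitD hvK ltr01) => //; rewrite (valN hvK).
    by apply: (vge_mulr hvK) => //; exact: (vge_mull hvK).
  - by apply: (vge_mull hvK); rewrite ?vP.
  - apply: (vge_mull hvK); last by rewrite vPm.
    have := main j; rewrite -/i; set q := (_ - _) => H.
    rewrite (valM hvK) (valV hvK) // vP sube_ge0 ?fin_numE //.
  exact: ve.
exists u', M'; split=> //; last by rewrite /u' !mulgA mulVg mul1g.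
split=> //; split; last by exists M'.
move=> l lp; rewrite !componentM lj // mul1r.
rewrite (@componentV _ _ _ l _ 1) ?mulr1 ?li //.
by case: uM => -[lu _] _; exact: lu.
Qed.

End LevelGroup.

(** * Characteristic series in an orthonormal basis *)

Section CharSeries.
Variables (R : realType) (E : fieldType) (v : E -> \bar R) (X : Type).
Hypotheses (hv : is_valuation v) (cE : vcomplete v).
Variables (S : set (X -> nat -> E)) (T : (X -> nat -> E) -> X -> nat -> E).
Hypothesis S_lin : forall x phi phi', S phi -> S phi' ->
  S (fun g n => x * phi g n + phi' g n).
Hypothesis T_S : forall phi, S phi -> S (T phi).
Implicit Types (phi : X -> nat -> E) (e : nat -> X -> nat -> E) (a b : nat -> E).

Lemma expands_lin e x a b phi phi' : expands v e a phi -> expands v e b phi' ->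
  expands v e (fun i => x * a i + b i) (fun g n => x * phi g n + phi' g n).
Proof.
move=> [a0 aphi] [b0 bphi]; have [B xB] := vge_ex hv x; split=> r.
  have [[N aN] [M bM]] := (a0 (r - B), b0 r); exists (maxn N M) => n.
  rewrite geq_max => /andP[Nn Mn]; rewrite subr0; apply: (vgeD hv).
    rewrite -[r](subrK B) addrC; apply: (vgeM hv) => //.
    by have := aN n Nn; rewrite subr0.
  by have := bM n Mn; rewrite subr0.
have [[N aN] [M bM]] := (aphi (r - B), bphi r); exists (maxn N M) => n.
rewrite geq_max => /andP[Nn Mn] g i.
have -> : x * phi g i + phi' g i - \sum_(j < n) (x * a j + b j) * e j g i =
  x * (phi g i - \sum_(j < n) a j * e j g i) + (phi' g i - \sum_(j < n) b j * e j g i).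
  rewrite (eq_bigr (fun j : 'I_n => x * (a j * e j g i) + b j * e j g i)); last first.
    by move=> j _; ring.
  by rewrite big_split -mulr_sumr /=; ring.
apply: (vgeD hv); last exact: bM.
by rewrite -[r](subrK B) addrC; apply: (vgeM hv) => //; exact: aN.
Qed.

Lemma expands_basis e j : expands v e (fun i => (i == j)%:R) (e j).
Proof.
split=> r; exists j.+1 => n jn.
  by rewrite subr0 gtn_eqF //; exact: (vge0 hv).
move=> g i; rewrite (bigD1 (Ordinal jn)) //= eqxx mul1r big1 ?addr0 ?subrr ?(vge0 hv) //.
by move=> l; rewrite -val_eqE /= => /negPf ->; rewrite mul0r.
Qed.

(** An orthonormal basis consists of vectors of norm at most one: expand a basis
    vector in the basis. *)
Lemma basis_bound e j : orthonormal_basis v S e -> sup_bound v (e j) 0.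
Proof.
move=> [eS _ eb]; apply/(eb _ _ (eS j) (expands_basis e j)) => i.
exact: (vint_nat hv).
Qed.

Variables (eps : nat -> X -> nat -> E) (w : nat -> R).
Hypothesis eps_basis : orthonormal_basis v S eps.
Hypothesis w_homo : {homo w : i j / (i <= j)%N >-> i <= j}.
Hypothesis w_ge0 : 0 <= w 0.
Hypothesis T_rows : forall phi a, S phi -> sup_bound v phi 0 ->
  expands v eps a (T phi) -> forall i, ((w i)%:E <= v (a i))%E.

(** The matrix of [T] in the basis [eps] has divisible rows, so its characteristic
    series converges coefficientwise. *)
Lemma char_series_exists : (forall r, exists i, r <= w i) ->
  exists c, fredholm_series v S T c.
Proof.
move=> w_oo; have [eS eX _] := eps_basis.
have /choice[a aP] j : exists a, expands v eps a (T (eps j)).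
  by apply: eX; exact: T_S.
pose A i j := a j i.
have Aw i j : ((w i)%:E <= v (A i j))%E.
  by apply: (T_rows (eS j) _ (aP j)); exact: basis_bound.
have /choice[c cP] n := fdet_cvg hv w_homo w_ge0 cE n w_oo Aw.
by exists c, eps, A; split.
Qed.

(** In any other orthonormal basis the matrix of [T] is, modulo a high power of
    the uniformizer, the product of an integral matrix (the expansions of the
    [eps l]) by the matrix of the [eps]-coordinates of the [T (e j)], whose
    rows are divisible as prescribed. *)
Lemma char_series_bound c n : fredholm_series v S T c ->
  ((row_sum w n)%:E <= v (c n))%E.
Proof.
move=> [e [a [eb aT cc]]]; have [eS eX ebd] := eb; have [epsS epsX epsbd] := eps_basis.
apply: (vcvg_ge hv (cc n)) => N; set r := row_sum w n.
have Te j : S (T (e j)) by exact: T_S.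
have /choice[b bP] j : exists b, expands v eps b (T (e j)) by exact: epsX.
have bw j i : ((w i)%:E <= v (b j i))%E.
  by apply: (T_rows (eS j) _ (bP j)); exact: basis_bound.
have /choice[f fP] l : exists f, expands v e f (eps l) by exact: eX.
have f0 l i : (0 <= v (f l i))%E.
  by have := (ebd _ _ (epsS l) (fP l) 0).1; apply; exact: basis_bound.
have /choice[L LP] j : exists L, forall L', (L <= L')%N ->
    sup_bound v (fun g i => T (e j) g i - \sum_(l < L') b j l * eps l g i) r.
  by have [_ /(_ r)] := bP j.
pose M := \max_(j < N) L j.
(* Subtracting the [eps]-expansion term by term stays inside [S], where the bound on
   the remainder can be read off from its [e]-coordinates. *)
have rest l' j : S (fun g i => T (e j) g i - \sum_(l < l') b j l * eps l g i) /\
    expands v e (fun i => a i j - \sum_(l < l') b j l * f l i)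
      (fun g i => T (e j) g i - \sum_(l < l') b j l * eps l g i).
  elim: l' => [|l' [IHS IHe]].
    have -> : (fun g i => T (e j) g i - \sum_(l < 0) b j l * eps l g i) = T (e j).
      by apply: funext => g; apply: funext => i; rewrite big_ord0 subr0.
    have -> : (fun i => a i j - \sum_(l < 0) b j l * f l i) = a^~ j.
      by apply: funext => i; rewrite big_ord0 subr0.
    by split.
  have -> : (fun g i => T (e j) g i - \sum_(l < l'.+1) b j l * eps l g i) =
      fun g i => - b j l' * eps l' g i +
        (T (e j) g i - \sum_(l < l') b j l * eps l g i).
    by apply: funext => g; apply: funext => i; rewrite big_ord_recr /=; ring.
  have -> : (fun i => a i j - \sum_(l < l'.+1) b j l * f l i) =
      fun i => - b j l' * f l' i + (a i j - \sum_(l < l') b j l * f l i).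
    by apply: funext => i; rewrite big_ord_recr /=; ring.
  split; first exact: S_lin.
  exact: expands_lin.
rewrite -/(fdet _).
apply: (@fdet_factor_bound _ _ v hv w w_homo w_ge0 N M _
  (\matrix_(i < N, l < M) f l i) (\matrix_(l < M, j < N) b j l)) => i j; rewrite !mxE //.
- have [_ H] := rest 0%N j; have := (ebd _ _ (Te j) (aT j) 0).1; apply.
  have e0 := basis_bound j eb.
  have Tb := (epsbd _ _ (Te j) (bP j) 0).2; apply: Tb => l.
  by apply: (vge_le _ (bw j l)); exact: w_pos.
- have [HS He] := rest M j; have := (ebd _ _ HS He r).1.
  rewrite (eq_bigr (fun l : 'I_M => b j l * f l i)); last first.
    by move=> l _; rewrite !mxE mulrC.
  apply; apply: LP; exact: (leq_bigmax (F := fun j : 'I_N => L j)).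
Qed.

End CharSeries.

(** * Double cosets *)

Section DoubleCosets.
Variables (R : realType) (Q_ : forall l : primeT, padicField R (val l)).
Variable D : falgType rat.
Variable eta : forall l : primeT, 'M[Q_ l]_2 -> local_alg D (Q_ l).
Variables (p : primeT) (Ul : forall l : primeT, set (local_alg D (Q_ l))).
Hypothesis eta_p : alg_iso (eta (l := p)).
Hypothesis hUl : forall l : primeT, l <> p -> open_compact_unit_subgroup (@Ul l).
Variable m : nat.
Hypothesis m0 : (0 < m)%N.
Local Notation Dfx := (Dfx Q_ D).
Local Notation level := (level eta p Ul m).
Local Notation level_at := (@level_at R Q_ D eta p Ul m).
Local Notation Dx := (@Dx_in R Q_ D).
Hypothesis hU : forall (d : unitg D) (x : Dfx),
  level (x^-1 * Dx d * x)%g -> (x^-1 * Dx d * x)%g = 1%g.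

Lemma Dx_inM (d e : unitg D) : Dx (d * e)%g = (Dx d * Dx e)%g.
Proof. by apply: uval_inj => /=; rewrite rmorphM. Qed.

Lemma Dx_in1 : Dx 1%g = 1%g.
Proof. by apply: uval_inj => /=; rewrite rmorph1. Qed.

Lemma Dx_inVM (d : unitg D) : (Dx d^-1 * Dx d)%g = 1%g.
Proof. by rewrite -Dx_inM mulVg Dx_in1. Qed.

Section Representatives.
Variables (n : nat) (rep : 'I_n -> Dfx).

Definition dcoset (g : Dfx) s (M : 'M[Q_ p]_2) := exists d u, level_at u M /\ g = (Dx d * rep s * u)%g.

Definition inequivalent := forall s s' d u, level u ->
  (Dx d * rep s * u)%g = rep s' -> s = s'.

Hypothesis rep_inj : inequivalent.

(** Two decompositions of [g] over the same representative [x] differ by an element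
    of [x^-1 D^x x] lying in the level subgroup, which is trivial there. *)
Lemma dcoset_uniq g s s' M M' : dcoset g s M -> dcoset g s' M' -> s = s' /\ M = M'.
Proof.
move=> [d [u [uM ->]]] [d' [u' [uM' e]]].
have [N' uN'] := level_atV eta_p hUl m0 uM'.
have lV := level_atM eta_p hUl m0 uM uN'.
have ss : s = s'.
  apply: (rep_inj (d := (d'^-1 * d)%g) lV.1).
  transitivity (Dx d'^-1 * (Dx d * rep s * u * u'^-1))%g.
    by rewrite Dx_inM !mulgA.
  by rewrite e mulgK mulgA Dx_inVM mul1g.
subst s'; split=> //.
have [N uN] := level_atV eta_p hUl m0 uM.
have lW := level_atM eta_p hUl m0 uM' uN.
have conj : ((rep s)^-1 * Dx (d'^-1 * d) * rep s = u' * u^-1)%g.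
  apply: (canRL (mulgK _)).
  transitivity ((rep s)^-1 * (Dx d'^-1 * (Dx d * rep s * u)))%g.
    by rewrite Dx_inM !mulgA.
  rewrite e; transitivity ((rep s)^-1 * ((Dx d'^-1 * Dx d') * (rep s * u')))%g.
    by rewrite !mulgA.
  by rewrite Dx_inVM mul1g mulKg.
have u1 : (u' * u^-1 = 1)%g by rewrite -conj; apply: hU; rewrite conj; exact: lW.1.
have uu : u' = u by rewrite -[u'](mulgVK u) u1 mul1g.
by subst u'; exact: level_at_inj uM uM'.
Qed.

Lemma dcoset_act g s M d u N : dcoset g s M -> level_at u N ->
  dcoset (Dx d * g * u)%g s (M * N).
Proof.
move=> [d' [u' [uM ->]]] uN; exists (d * d')%g, (u' * u)%g; split.
  exact: level_atM.
by rewrite Dx_inM !mulgA.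
Qed.

Lemma dcoset_actV g s M d u : dcoset (Dx d * g * u)%g s M -> level u ->
  exists M', dcoset g s M'.
Proof.
move=> H /(level_ex)[N uN]; have [N' uN'] := level_atV eta_p hUl m0 uN.
have := dcoset_act d^-1%g H uN'.
by rewrite !mulgA Dx_inVM mul1g mulgK; exists (M * N').
Qed.

Lemma dcoset_rep s : dcoset (rep s) s 1.
Proof.
exists 1%g, 1%g; split; first exact: level_at1.
by rewrite Dx_in1 mul1g mulg1.
Qed.

(** The function with prescribed values on each double coset; by [dcoset_uniq] the
    choice of a decomposition of [g] is immaterial. *)
Definition dcoset_fun (Y : Type) (F : 'I_n -> 'M[Q_ p]_2 -> Y) (y0 : Y) (g : Dfx) : Y :=
  if pselect (exists sM, dcoset g sM.1 sM.2) is left h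
  then F (projT1 (cid h)).1 (projT1 (cid h)).2 else y0.

Lemma dcoset_funE (Y : Type) F (y0 : Y) g s M : dcoset g s M ->
  dcoset_fun F y0 g = F s M.
Proof.
rewrite /dcoset_fun => gsM; case: pselect => [h|[]]; last by exists (s, M).
case: cid => -[s' M'] /= H.
by have [-> ->] := dcoset_uniq H gsM.
Qed.

Lemma dcoset_fun0 (Y : Type) F (y0 : Y) g : (forall s M, ~ dcoset g s M) ->
  dcoset_fun F y0 g = y0.
Proof. by rewrite /dcoset_fun; case: pselect => // -[[s M] /= H] /(_ s M). Qed.

End Representatives.

(** ** Counting double cosets by classical forms *)

Variables (E : fieldExtType (Q_ p)) (psi : Q_ p -> E).
Hypothesis hpsi : finite_character psi.
Hypothesis hcond : factors_mod psi m.
Local Notation classical := (classical_forms eta Ul m psi).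

Lemma psi_U0M M N : @U0 R Q_ p m M -> @U0 R Q_ p m N ->
  psi ((M * N) 1 1) = psi (M 1 1) * psi (N 1 1).
Proof.
move=> UM UN; have hv := padic_valuation (Q_ p).
have [_ b _ d] := UM; have [_ b' c' d'] := UN.
have [_ psiM _] := hpsi.
rewrite -psiM //; have [_ _ _ dMN] := U0M m0 UM UN; apply: hcond => //.
  by rewrite (valM hv) d d' adde0.
have [_ b'' c'' _] := UM.
by rewrite mx2M addrK; apply: (vge_mulr hv).
Qed.

Lemma indicator_classical n (rep : 'I_n -> Dfx) s0 : inequivalent rep ->
  classical (dcoset_fun rep (fun s M => if s == s0 then psi (M 1 1) else 0) 0).
Proof.
move=> rep_inj d g u N lu uN.
have luN : level_at u N by split.
have UN := level_at_U0 eta_p luN.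
have [[s [M gsM]]|nog] := pselect (exists s M, dcoset rep g s M).
  rewrite (dcoset_funE rep_inj _ _ (dcoset_act d gsM luN)) (dcoset_funE rep_inj _ _ gsM).
  case: eqP => _; last by rewrite mulr0.
  have [d' [u' [uM _]]] := gsM.
  by rewrite (psi_U0M (level_at_U0 eta_p uM) UN) mulrC.
rewrite !dcoset_fun0 ?mulr0 // => s M H; apply: nog.
  by exists s, M.
by have [M' ?] := dcoset_actV H lu; exists s, M'.
Qed.

(** The indicator forms of the cosets, twisted by [psi], are linearly independent:
    evaluating them at the representatives factors the identity matrix through
    a space of dimension [t]. *)
Lemma inequivalent_leq n (rep : 'I_n -> Dfx) t : inequivalent rep ->
  has_dim classical t -> (n <= t)%N.
Proof.
move=> rep_inj [b [bS bE]].
pose f s0 := dcoset_fun rep (fun s M => if s == s0 then psi (M 1 1) else 0) 0.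
have /choice[a aP] s : exists a : 'rV[E]_t, f s = fun x => \sum_i a 0 i * b i x.
  by have [a [? _]] := bE _ (indicator_classical s rep_inj); exists a.
pose A : 'M[E]_(n, t) := \matrix_(s, i) a s 0 i.
pose B : 'M[E]_(t, n) := \matrix_(i, s) b i (rep s).
have AB : A *m B = 1%:M.
  apply/matrixP => s s'; rewrite !mxE.
  have := congr1 (fun F => F (rep s')) (aP s) => /=.
  rewrite {1}/f (dcoset_funE rep_inj _ _ (dcoset_rep rep s')) mxE /=.
  have [psi1 _ _] := hpsi; rewrite psi1 eq_sym => e.
  rewrite (eq_bigr (fun i => a s 0 i * b i (rep s'))); last by move=> i _; rewrite !mxE.
  by rewrite -e; case: eqP.
have := mxrankM_maxl A B; rewrite AB mxrank1 => /leq_trans; apply.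
exact: rank_leq_col.
Qed.

(** Finiteness of the number of double cosets is a consequence of the dimension
    hypothesis: families of inequivalent elements have at most [t] members, and
    one of maximal size represents every double coset. *)
Lemma exists_reps t : has_dim classical t -> exists n (rep : 'I_n -> Dfx),
  [/\ (0 < n)%N, (n <= t)%N, inequivalent rep
    & forall g, exists s M, dcoset rep g s M].
Proof.
move=> ht; pose P n := `[< exists rep : 'I_n -> Dfx, inequivalent rep >].
have P1 : P 1%N.
  by apply/asboolP; exists (fun=> 1%g) => s s' d u _ _; rewrite (ord1 s) (ord1 s').
have Pt n : P n -> (n <= t)%N.
  by move=> /asboolP[rep rep_inj]; exact: inequivalent_leq rep_inj ht.
case: (ex_maxnP (ex_intro P _ P1) Pt) => n /asboolP[rep rep_inj] nmax.
exists n, rep; split=> //; [exact: nmax | by apply: Pt; apply/asboolP; exists rep|].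
move=> g; apply: contrapT => nog.
suff /nmax : P n.+1 by rewrite ltnn.
apply/asboolP.
(* Otherwise [g] could be added to the family. *)
exists (fun i => if unlift ord_max i is Some j then rep j else g) => i i' d u lu.
case: unliftP => [j ->|->]; case: unliftP => [j' ->|->] //.
- by move=> /(rep_inj _ _ _ _ lu) ->.
- move=> e; exfalso; apply: nog; have [M uM] := level_ex lu.
  by exists j, M, d, u.
move=> e; exfalso; apply: nog; have [M uM] := level_ex lu.
have [M' H] : exists M', dcoset rep g j' M'.
  apply: (@dcoset_actV _ rep g j' 1 d u _ lu).
  by rewrite e; exact: dcoset_rep.
by exists j', M'.
Qed.

End DoubleCosets.

(** * Overconvergent forms *)

Section Overconvergent.
Variables (R : realType) (Q_ : forall l : primeT, padicField R (val l)).
Variable D : falgType rat.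
Variable eta : forall l : primeT, 'M[Q_ l]_2 -> local_alg D (Q_ l).
Variables (p : primeT) (Ul : forall l : primeT, set (local_alg D (Q_ l))).
Hypothesis eta_p : alg_iso (eta (l := p)).
Hypothesis hUl : forall l : primeT, l <> p -> open_compact_unit_subgroup (@Ul l).
Variable m : nat.
Local Notation Dfx := (Dfx Q_ D).
Local Notation K := (Q_ p).
Local Notation level := (level eta p Ul m).
Local Notation level_at := (@level_at R Q_ D eta p Ul m).
Local Notation Dx := (@Dx_in R Q_ D).
Hypothesis hU : forall (d : unitg D) (x : Dfx),
  level (x^-1 * Dx d * x)%g -> (x^-1 * Dx d * x)%g = 1%g.
Variables (E : fieldExtType K) (v : E -> \bar R).
Hypothesis hv : is_valuation v.
Hypothesis hvp : forall x : K, v x%:A = padic_val x.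
Variable psi : K -> E.
Hypothesis hpsi : finite_character psi.
Hypothesis hcond : has_conductor psi m.
Variable k : K.
Hypothesis hk : (0 <= padic_val k)%E.

Let pr_p : prime (val p) := valP p.
Let hvK : is_valuation (@padic_val R (val p) K) := padic_valuation K.
Let cE : vcomplete v := ext_complete hvK hv hvp (@padic_vcomplete R (val p) K).
Let m0 : (0 < m)%N := m_gt0 hcond.

Local Notation forms := (overconvergent_forms eta Ul m v psi k).
Local Notation slash := (slash v psi k).
Local Notation Up := (Up eta m v psi k).
Local Notation hecke := (@hecke_mx R Q_ p m).
Implicit Types (phi : Dfx -> nat -> E) (g u : Dfx) (M N : 'M[K]_2).

Lemma forms_null phi g : forms phi -> nullseq v (phi g).
Proof. by move=> [H _]; exact: H. Qed.

Lemma forms_act phi d g u M : forms phi -> level_at u M ->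
  phi (Dx d * g * u)%g = slash (phi g) M.
Proof. by move=> [_ H] [lu uM]; exact: H. Qed.

Lemma level_at_Sigma0 u M : level_at u M -> Sigma0 m M.
Proof. by move=> uM; apply: U0_Sigma0; exact: level_at_U0 uM. Qed.

Lemma forms_lin x phi phi' : forms phi -> forms phi' ->
  forms (fun g n => x * phi g n + phi' g n).
Proof.
move=> fphi fphi'; split=> [g|d g u M lu uM].
  change (nullseq v (fun n => x * phi g n + phi' g n)).
  by apply: (nullseqD hv); [apply: (nullseqZ hv)|]; exact: forms_null.
have luM : level_at u M by split.
rewrite (slash_lin hv hvp hcond k (level_at_Sigma0 luM)); try exact: forms_null.
by rewrite -!(forms_act d g _ luM).
Qed.

(** ** The operator [U_p] *)

Local Notation V j := (at_p eta (hecke j)).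

(** Right translation by the level permutes the summands of [U_p]; the cocycle
    relation carries the corresponding identity of matrices over to series. *)
Lemma Up_forms phi : forms phi -> forms (Up phi).
Proof.
move=> fphi; split=> [g|d g u M lu uM].
  change (nullseq v (Up phi g)); apply: (nullseq_sum hv) => j _.
  apply: (slash_null pr_p hv hvp hcond hk (hecke_Sigma0 Q_ p m j)).
  exact: forms_null.
have luM : level_at u M by split.
have SM := level_at_Sigma0 luM.
have [sg sg_inj sgP] := hecke_swap eta_p m0 luM.
have sh (j : nat) : nullseq v (slash (phi (g * (V j)^-1)%g) (hecke j)).
  apply: (slash_null pr_p hv hvp hcond hk (hecke_Sigma0 Q_ p m j)).
  exact: forms_null.
rewrite [slash (Up phi g) M](slash_sum hv hvp hcond k SM _ sh).
apply: funext => n; rewrite /Defs.Up (reindex_inj sg_inj); apply: eq_bigr => j _.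
have [u' [M' [u'M' swap MM]]] := sgP j.
rewrite (_ : (Dx d * g * u * (V (sg j))^-1)%g = (Dx d * (g * (V j)^-1) * u')%g); last first.
  by rewrite -[LHS]mulgA swap !mulgA.
rewrite (forms_act _ _ fphi u'M').
have ng := forms_null (g * (V j)^-1)%g fphi.
rewrite (slash_comp pr_p hv hvp hpsi hcond hk (level_at_Sigma0 u'M') (hecke_Sigma0 Q_ p m _) ng).
by rewrite (slash_comp pr_p hv hvp hpsi hcond hk (hecke_Sigma0 Q_ p m j) SM ng) MM.
Qed.

(** On the disc of radius [p] both [p z] and the inverse of [j p^m z + 1] are bounded
    by one. *)
Lemma mobius_hecke_slope j : slope_bound v 1 (mobiusA E (hecke j)) 0.
Proof.
rewrite mobiusA_mul -[X in slope_bound _ _ _ X]addr0.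
apply: (slope_bound_mul hv).
  move=> n; rewrite /numA hvp add0r mulr1 !mxE /=.
  case: n => [|[|n]] /=; rewrite ?nth_nil ?(vge0 hvK) //.
  by rewrite val_p.
exact: (geomA_slope hv hvp hcond (hecke_Sigma0 Q_ p m j)).
Qed.

(** The values of [U_p] extend to the disc of radius [p]: the coefficient of [z^n]
    gains a factor [p^n]. This is the only source of slopes. *)
Lemma Up_slope phi r : forms phi -> sup_bound v phi r ->
  forall g, slope_bound v 1 (Up phi g) r.
Proof.
move=> fphi br g n; apply: (vge_sum hv) => j _.
have nh := forms_null (g * (V j)^-1)%g fphi.
apply: (slash_slope pr_p hv hvp hpsi hcond hk (hecke_Sigma0 Q_ p m j)) => //.
exact: mobius_hecke_slope.
Qed.

(** ** The basis of monomials at representatives of the double cosets *)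

Variables (n0 : nat) (rep : 'I_n0 -> Dfx).
Hypothesis n0_gt0 : (0 < n0)%N.
Local Notation dcoset := (@dcoset R Q_ D eta p Ul m n0 rep).
Hypothesis rep_inj : @inequivalent R Q_ D eta p Ul m n0 rep.
Hypothesis rep_all : forall g, exists s M, dcoset g s M.

Definition form_of (h : 'I_n0 -> nat -> E) : Dfx -> nat -> E :=
  @dcoset_fun R Q_ D eta p Ul m n0 rep _ (fun s M => slash (h s) M) (fun=> 0).

Lemma form_ofE h g s M : dcoset g s M -> form_of h g = slash (h s) M.
Proof. by move=> H; exact: (dcoset_funE eta_p hUl m0 hU rep_inj _ _ H). Qed.

Lemma dcoset_Sigma0 g s M : dcoset g s M -> Sigma0 m M.
Proof. by move=> [d [u [uM _]]]; exact: level_at_Sigma0 uM. Qed.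

Lemma form_of_forms h : (forall s, nullseq v (h s)) -> forms (form_of h).
Proof.
move=> nh; split=> [g|d g u N lu uN].
  have [s [M gsM]] := rep_all g; rewrite (form_ofE _ gsM).
  exact: (slash_null pr_p hv hvp hcond hk (dcoset_Sigma0 gsM)).
have luN : level_at u N by split.
have [s [M gsM]] := rep_all g; rewrite (form_ofE _ gsM).
rewrite (form_ofE _ (dcoset_act eta_p hUl m0 d gsM luN)).
by rewrite (slash_comp pr_p hv hvp hpsi hcond hk (dcoset_Sigma0 gsM)
  (level_at_Sigma0 luN) (nh s)).
Qed.

Lemma form_of_rep h s : nullseq v (h s) -> form_of h (rep s) = h s.
Proof.
by move=> nh; rewrite (form_ofE _ (dcoset_rep eta_p hUl m rep s)) (slash1 pr_p hv hvp hpsi hcond hk).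
Qed.

Lemma forms_dcoset phi g s M : forms phi -> dcoset g s M ->
  phi g = slash (phi (rep s)) M.
Proof. by move=> fphi [d [u [uM ->]]]; exact: forms_act. Qed.

(** The action is contractive, so the sup norm of a form is attained on the
    representatives. *)
Lemma forms_bound phi r : forms phi -> (forall s, seq_bound v (phi (rep s)) r) ->
  sup_bound v phi r.
Proof.
move=> fphi H g n; have [s [M gsM]] := rep_all g; rewrite (forms_dcoset fphi gsM).
apply: (slash_bound pr_p hv hvp hpsi hcond hk (dcoset_Sigma0 gsM)) => //.
exact: forms_null.
Qed.

(** The basis is indexed by pairs (representative, degree), listed by increasing
    degree: [i] has degree [i %/ n0] and sits at the representative number
    [i %% n0]. *)
Definition cls i : 'I_n0 := Ordinal (ltn_pmod i n0_gt0).

Definition coord_at phi i : E := phi (rep (cls i)) (i %/ n0)%N.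

Definition eps i : Dfx -> nat -> E :=
  form_of (fun s => if s == cls i then @ps_mono E (i %/ n0)%N else fun=> 0).

Lemma eps_null i s :
  nullseq v ((fun s => if s == cls i then @ps_mono E (i %/ n0)%N else fun=> 0) s).
Proof.
rewrite /=; case: eqP => _; first exact: ps_mono_null.
exact: (nullseq_fin hv (N := 0)).
Qed.

Lemma eps_forms i : forms (eps i).
Proof. by apply: form_of_forms => s; exact: eps_null. Qed.

Lemma eps_rep i (s : 'I_n0) n : eps i (rep s) n = (n * n0 + s == i)%N%:R.
Proof.
rewrite /eps form_of_rep; last exact: eps_null.
rewrite (_ : (n * n0 + s == i)%N = (s == cls i) && (n == i %/ n0)%N).
  by case: (s == cls i).
rewrite -val_eqE /=; apply/eqP/andP => [<-|[/eqP -> /eqP ->]].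
  by rewrite modnMDl modn_small // divnMDl // divn_small // addn0.
by rewrite -divn_eq.
Qed.

Lemma coord_atE phi (s : 'I_n0) n : coord_at phi (n * n0 + s) = phi (rep s) n.
Proof.
rewrite /coord_at divnMDl // divn_small // addn0; congr (phi (rep _) _).
by apply: val_inj; rewrite /= modnMDl modn_small.
Qed.

Lemma coord_at_null phi : forms phi -> nullseq v (coord_at phi).
Proof.
move=> fphi r; have /choice[N NP] s := forms_null (rep s) fphi r.
exists ((\max_s N s) * n0)%N => i Ni; apply: NP.
apply: leq_trans (leq_bigmax (cls i)) _.
by rewrite leq_divRL.
Qed.

Lemma sum_coord_eps (c : nat -> E) (N : nat) (s : 'I_n0) (n : nat) :
  \sum_(i < N) c i * eps i (rep s) n =
  if (n * n0 + s < N)%N then c (n * n0 + s)%N else 0.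
Proof.
have [lt|ge] := ltnP (n * n0 + s)%N N.
  rewrite (bigD1 (Ordinal lt)) //= eps_rep eqxx mulr1 big1 ?addr0 // => i.
  by rewrite -val_eqE eps_rep eq_sym => /negPf /= ->; rewrite mulr0.
rewrite big1 // => i _; rewrite eps_rep gtn_eqF ?mulr0 //.
exact: leq_trans (ltn_ord i) ge.
Qed.

Lemma forms_sub_sum phi (c : nat -> E) (N : nat) : forms phi ->
  forms (fun g n => phi g n - \sum_(i < N) c i * eps i g n).
Proof.
move=> fphi; elim: N => [|N IH].
  rewrite (_ : (fun _ => _) = phi) //.
  by apply: funext => g; apply: funext => n; rewrite big_ord0 subr0.
have := forms_lin (- c N) (eps_forms N) IH.
congr (forms _); apply: funext => g; apply: funext => n.
by rewrite big_ord_recr /=; ring.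
Qed.

(** The difference with a partial sum is again a form, so it is enough to bound its
    coordinates, which are those beyond the cut. *)
Lemma forms_expand phi : forms phi -> expands v eps (coord_at phi) phi.
Proof.
move=> fphi; have ncoord := coord_at_null fphi; split=> r.
  by have [N cN] := ncoord r; exists N => n /cN; rewrite subr0.
have [N cN] := ncoord r; exists N => N' NN'.
apply: forms_bound => [|s n]; first exact: forms_sub_sum.
rewrite sum_coord_eps; case: ltnP => [_|H].
  by rewrite coord_atE subrr; exact: (vge0 hv).
by rewrite subr0 -coord_atE; apply: cN; exact: leq_trans H.
Qed.

(** A coordinate of a partial sum is stationary once its index is included. *)
Lemma expand_coord phi a : expands v eps a phi -> a = coord_at phi.
Proof.
move=> [_ aphi]; apply: funext => i; apply: (vge_all_eq hv) => r.
have [N NP] := aphi r.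
have := NP (maxn N i.+1) (leq_maxl _ _) (rep (cls i)) (i %/ n0)%N.
by rewrite sum_coord_eps /= -divn_eq leq_maxr; apply: vgeC.
Qed.

Lemma eps_basis : orthonormal_basis v forms eps.
Proof.
split=> [i|phi fphi|phi a fphi /expand_coord -> r]; first exact: eps_forms.
  by exists (coord_at phi); exact: forms_expand.
split=> H; first by move=> i; exact: H.
apply: forms_bound => // s n; rewrite -coord_atE; exact: H.
Qed.

Lemma Up_rows phi a : forms phi -> sup_bound v phi 0 -> expands v eps a (Up phi) ->
  forall i, ((i %/ n0)%N%:R%:E <= v (a i))%E.
Proof.
move=> fphi b0 /expand_coord -> i.
by have := Up_slope fphi b0 (rep (cls i)) (i %/ n0)%N; rewrite add0r mulr1.
Qed.

Lemma Up_char_series_exists : exists c, fredholm_series v forms Up c.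
Proof.
apply: (char_series_exists hv cE Up_forms eps_basis (w := fun i => (i %/ n0)%N%:R)).
- by move=> i j ij; rewrite ler_nat leq_div2r.
- by rewrite div0n.
- exact: Up_rows.
by move=> r; have [N rN] := nat_bound r; exists (N * n0)%N; rewrite mulnK.
Qed.

Lemma Up_char_series_bound c n : fredholm_series v forms Up c ->
  ((\sum_(i < n) (i %/ n0)%N%:R)%:E <= v (c n))%E.
Proof.
apply: (char_series_bound hv forms_lin Up_forms eps_basis (w := fun i => (i %/ n0)%N%:R)).
- by move=> i j ij; rewrite ler_nat leq_div2r.
- by rewrite div0n.
exact: Up_rows.
Qed.

End Overconvergent.

(** * The Newton polygon of [U_p] *)

Theorem theorem4p8 (R : realType)
  (Q_ : forall l : primeT, padicField R (val l))
  (p : primeT)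
  (D : falgType rat)
  (hD : quaternion_algebra D)
  (hDdef : definite R D)
  (S : set primeT)
  (hSfin : finite_set S)
  (hSp : S p)
  (hSram : forall l : primeT, ramified D (Q_ l) -> S l)
  (eta : forall l : primeT, 'M[Q_ l]_2 -> local_alg D (Q_ l))
  (heta : forall l : primeT, l = p \/ ~ S l -> alg_iso (eta l))
  (heta_int : finite_set [set l : primeT | ~ S l /\
     ~ (forall M : 'M[Q_ l]_2, integral_mx M <-> integral_vec (eta l M))])
  (Ul : forall l : primeT, set (local_alg D (Q_ l)))
  (hUl : forall l : primeT, l <> p -> open_compact_unit_subgroup (Ul l))
  (hUlS : forall l : primeT, ~ S l -> Ul l = eta l @` GL2Z (Q_ l))
  (m : nat)
  (hU : forall (d : unitg D) (x : Dfx Q_ D),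
     level eta p Ul m (x^-1 * Dx_in Q_ d * x)%g ->
     (x^-1 * Dx_in Q_ d * x)%g = 1%g)
  (E : fieldExtType (Q_ p))
  (v : E -> \bar R)
  (hv : is_valuation v)
  (hvp : forall x : Q_ p, v x%:A = padic_val x)
  (psi : Q_ p -> E)
  (hpsi : finite_character psi)
  (hpsi_cond : has_conductor psi m)
  (t : nat)
  (ht : has_dim (classical_forms eta Ul m psi) t)
  (k : Q_ p)
  (hk : (0 <= padic_val k)%E) :
  let is_char_series := fredholm_series v
    (overconvergent_forms eta Ul m v psi k) (Up eta m v psi k) in
  (exists c : nat -> E, is_char_series c) /\
  (forall c : nat -> E, is_char_series c ->
     lies_above (newton_polygon v c)
       (fun n : nat => ((n * t)%:R, n%:R * (n%:R - 1) / 2%:R * t%:R))).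
Proof.
  (* your proof *)
Proof.
have eta_p := heta p (or_introl erefl).
have m0 := m_gt0 hpsi_cond; have [_ fac _] := hpsi_cond.
have [n0 [rep [n0_gt0 n0t rep_inj rep_all]]] :=
  exists_reps eta_p hUl m0 hU hpsi fac ht.
split.
  exact: (Up_char_series_exists eta_p hUl hU hv hvp hpsi hpsi_cond hk n0_gt0
    rep_inj rep_all).
move=> c cc; apply: (newton_lies_above hv) => [|n]; first exact: leq_trans n0t.
apply: le_trans (Up_char_series_bound eta_p hUl hU hv hvp hpsi hpsi_cond hk n0_gt0
  rep_inj rep_all n cc).
by rewrite lee_fin; apply: ler_sum => i _; rewrite ler_nat leq_div2l.
Qed.
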